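(* Let $\Gamma$ be a finitely generated discrete amenable group and let $f\in\mathbb{Z}\Gamma$. Assume that: (a) $\Gamma$ has a strong Følner sequence; (b) $f$ is a unit in the $L^1$-convolution algebra $L^1(\Gamma)$; (c) $f$ is positive in the group von Neumann algebra $\mathcal{N}\Gamma$. Then $$h_f=\log\det\nolimits_{\mathcal{N}\Gamma} f .$$
   Context: Strong Følner sequence: a sequence $(F_n)$ of nonempty finite subsets of $\Gamma$ such that for every finite nonempty $K\subset\Gamma$, $\lim_{n\to\infty}\frac{|F_nK\setminus F_n|}{|F_n|}\log(1+|F_nK\setminus F_n|)=0$. (Right) Følner sequence: a sequence $(F_n)$ of nonempty finite subsets of $\Gamma$ with $\lim_{n\to\infty}|F_nK\,\triangle\,F_n|/|F_n|=0$ for every finite nonempty $K\subset\Gamma$. $\Gamma$ is amenable iff it has one. Dynamical system: $X_f=\widehat{\mathbb{Z}\Gamma/\mathbb{Z}\Gamma f}$ is the (compact metrizable) Pontryagin dual of the discrete group $\mathbb{Z}\Gamma/\mathbb{Z}\Gamma f$, with left $\Gamma$-action $(\gamma\chi)(a)=\chi(\gamma^{-1}a)$. Equivalently, $X_f=\{x\in(\mathbb{R}/\mathbb{Z})^\Gamma : xf^*=0\}$, where elements of $(\mathbb{R}/\mathbb{Z})^\Gamma$ are written as formal sums $\sum_\gamma x_\gamma\gamma$, $(\sum a_\gamma\gamma)^*=\sum\overline{a_\gamma}\gamma^{-1}$, and $\Gamma$ acts by left multiplication. Entropy: $h_f$ is the topological entropy of the $\Gamma$-action on $X_f$. For a left action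 of $\Gamma$ by homeomorphisms on a compact metrizable space $X$ the topological entropy is $\sup_{\mathfrak U}\lim_{n\to\infty}\frac1{|F_n|}\log N(\mathfrak U^{F_n})$, where $(F_n)$ is any Følner sequence, $\mathfrak U$ runs over open covers of $X$, $\mathfrak U^F=\bigvee_{\gamma\in F}\gamma\mathfrak U$ is the common refinement, and $N(\cdot)$ is the minimal cardinality of a subcover (the limit exists and is independent of $(F_n)$). Von Neumann algebra and determinant: $L^1(\Gamma)$ is the complex Banach algebra of absolutely summable functions on $\Gamma$ under convolution (the $\|\cdot\|_1$-completion of $\mathbb{C}\Gamma$). $\mathcal{N}\Gamma=\mathcal{B}(L^2(\Gamma))^\Gamma$ is the algebra of bounded operators on $L^2(\Gamma)$ commuting with the left $\Gamma$-action $(\gamma x)_{\gamma'}=x_{\gamma^{-1}\gamma'}$. It contains $\mathbb{C}\Gamma$ and $L^1(\Gamma)$ via the injective algebra homomorphism $r(\sum a_\gamma\gamma)=\sum a_\gamma R_{\gamma^{-1}}$, where $R_\gamma(x)=x\gamma$ is right multiplication on formal sums. An invertible operator $T$ is positive if it is self-adjoint with $(Tv,v)>0$ for all $v\ne0$; $f$ is positive in $\mathcal{N}\Gamma$ if $r(f)$ is. The trace is $\mathrm{tr}_{\mathcal{N}\Gamma}(g)=(g(e),e)$, with $e\in\Gamma\subset L^2(\Gamma)$ the unit element. For a unit $u\in\mathcal{N}\Gamma$, the Fuglede–Kadison determinant is $\det_{\mathcal{N}\Gamma}u=\exp\left(\tfrac12\mathrm{tr}_{\mathcal{N}\Gamma}(\log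 uu^* )\right)$ (functional calculus), and $\det_{\mathcal{N}\Gamma}f:=\det_{\mathcal{N}\Gamma}r(f)$. *)

(* Defs.v *)
From HB Require Import structures.
From mathcomp Require Import all_boot all_order all_algebra.
From mathcomp Require Import finmap complex.
From mathcomp Require Import all_classical all_reals all_analysis.
From mathcomp Require summability.
From mathcomp Require Import ring lra.

Set Implicit Arguments.
Unset Strict Implicit.
Unset Printing Implicit Defensive.

Import Order.TTheory GRing.Theory Num.Theory.
Import numFieldNormedType.Exports.
Import ComplexField.Normc.

Local Open Scope classical_set_scope.
Local Open Scope ring_scope.

Section Foelner.
Variable G : groupType.
Implicit Types (K S : {fset G}) (F : nat -> {fset G}).

Definition finitely_generated : Prop :=
  exists S, forall H : {pred G},
    group_closed H -> {subset S <= H} -> forall g, g \in H.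

Definition fset_mulg S K : {fset G} := [fset (s * k)%g | s in S, k in K]%fset.

Variable R : realType.

Definition Foelner F : Prop :=
  (forall n, F n != fset0) /\
  forall K, K != fset0 ->
    let FK n := fset_mulg (F n) K in
    (#|` (FK n `\` F n) `|` (F n `\` FK n) |%:R / #|` F n|%:R : R)%fset
      @[n --> \oo] --> (0 : R).

Definition amenable : Prop := exists F, Foelner F.

Definition strong_Foelner F : Prop :=
  (forall n, F n != fset0) /\
  forall K, K != fset0 ->
    let d n : R := #|` (fset_mulg (F n) K `\` F n)%fset |%:R in
    d n / #|` F n|%:R * ln (1 + d n) @[n --> \oo] --> (0 : R).

End Foelner.

Section Entropy.
Variables (R : realType) (G : groupType) (X : topologicalType).
Variable act : G -> X -> X.
Implicit Types (U V W : set (set X)) (F : {fset G}).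

Definition covers W : Prop := \bigcup_(u in W) u = setT.

Definition open_cover U : Prop := U `<=` open /\ covers U.

Definition refinement U F : set (set X) :=
  [set \bigcap_(g in [set` F]) (act g @` u g)
  | u in [set u : G -> set X | forall g, g \in F -> U (u g)]].

Definition has_subcover_card V (n : nat) : Prop :=
  exists W, [/\ W `<=` V, covers W & (W #= `I_n)%card].

(* The default 0 is only taken when V has no finite subcover. *)
Definition covering_number V : nat :=
  xget 0%N [set n | has_subcover_card V n /\
                    forall m, has_subcover_card V m -> (n <= m)%N].

(* For an action of an amenable group by homeomorphisms of a compact space and
   any right Foelner sequence Fs, the limits exist and do not depend on Fs
   (Ornstein-Weiss lemma). *)
Definition topological_entropy (Fs : nat -> {fset G}) : \bar R :=
  ereal_sup
    [set limn (fun n =>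
       (ln (covering_number (refinement U (Fs n)))%:R / #|` Fs n|%:R : R)%:E)
    | U in open_cover].

End Entropy.

Definition group_ring (G : groupType) := {fsfun G -> int with 0%R}.

Section GroupRing.
Variable G : groupType.
Local Notation ZG := (group_ring G).
Implicit Types a b c : ZG.

HB.instance Definition _ := Choice.on ZG.

Definition gr_zero : ZG := [fsfun].
Definition gr_opp a : ZG := [fsfun g in finsupp a => - a g].
Definition gr_add a b : ZG :=
  [fsfun g in (finsupp a `|` finsupp b)%fset => a g + b g].
Definition gr_one : ZG := [fsfun g in [fset 1%g]%fset => 1].
Definition gr_mul a b : ZG :=
  [fsfun g in fset_mulg (finsupp a) (finsupp b) =>
     \sum_(h <- finsupp a) a h * b (h^-1 * g)%g].

Fact gr_zeroE g : gr_zero g = 0. Proof. by rewrite fsfunE. Qed.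

Fact gr_oppE a g : gr_opp a g = - a g.
Proof. by rewrite fsfunE; case: finsuppP => // _; rewrite oppr0. Qed.

Fact gr_addE a b g : gr_add a b g = a g + b g.
Proof.
rewrite fsfunE in_fsetU.
by case: finsuppP => _; case: finsuppP => _ //=; rewrite addr0.
Qed.

Fact gr_oneE g : gr_one g = (g == 1%g)%:R.
Proof. by rewrite fsfunE inE; case: eqP. Qed.

Fact gr_addA : associative gr_add.
Proof. by move=> a b c; apply/fsfunP => g; rewrite !gr_addE addrA. Qed.
Fact gr_addC : commutative gr_add.
Proof. by move=> a b; apply/fsfunP => g; rewrite !gr_addE addrC. Qed.
Fact gr_add0 : left_id gr_zero gr_add.
Proof. by move=> a; apply/fsfunP => g; rewrite gr_addE gr_zeroE add0r. Qed.
Fact gr_addN : left_inverse gr_zero gr_opp gr_add.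
Proof.
by move=> a; apply/fsfunP => g; rewrite gr_addE gr_oppE gr_zeroE addNr.
Qed.

HB.instance Definition _ := GRing.isZmodule.Build ZG
  gr_addA gr_addC gr_add0 gr_addN.

Lemma group_ring0E g : (0 : ZG) g = 0. Proof. exact: gr_zeroE. Qed.
Lemma group_ringNE a g : (- a) g = - a g. Proof. exact: gr_oppE. Qed.
Lemma group_ringDE a b g : (a + b) g = a g + b g. Proof. exact: gr_addE. Qed.

Fact sumsupp a (S : {fset G}) (u : G -> int) : (finsupp a `<=` S)%fset ->
  \sum_(h <- finsupp a) a h * u h = \sum_(h <- S) a h * u h.
Proof.
move=> aS; apply: (big_fset_incl _ aS) => h _ ha.
by rewrite fsfun_dflt// mul0r.
Qed.

Fact gr_mulE a b g : gr_mul a b g = \sum_(h <- finsupp a) a h * b (h^-1 * g)%g.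
Proof.
rewrite fsfunE; case: ifPn => // gab; rewrite big_seq big1// => h ha.
have [|hb] := finsuppP b (h^-1 * g)%g; first by rewrite mulr0.
case/negP: gab; apply/imfset2P; exists h => //.
by exists (h^-1 * g)%g => //; rewrite mulVKg.
Qed.

Fact gr_mulES a b g (S : {fset G}) : (finsupp a `<=` S)%fset ->
  gr_mul a b g = \sum_(h <- S) a h * b (h^-1 * g)%g.
Proof.
by move=> aS; rewrite gr_mulE; exact: (sumsupp (fun h => b (h^-1 * g)%g)).
Qed.

Fact gr_mul1 : left_id gr_one gr_mul.
Proof.
move=> a; apply/fsfunP => g.
rewrite (@gr_mulES _ _ _ [fset 1%g]%fset) ?finsupp_sub//.
by rewrite big_seq_fset1 gr_oneE eqxx mul1r invg1 mul1g.
Qed.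

Fact gr_1mul : right_id gr_one gr_mul.
Proof.
move=> a; apply/fsfunP => g.
rewrite (@gr_mulES _ _ _ (g |` finsupp a)%fset) ?fsubsetUr//.
rewrite (big_fsetD1 g)/= ?fset1U1// gr_oneE mulVg eqxx mulr1.
rewrite big_seq big1 ?addr0// => h; rewrite !inE => /andP[hg _].
rewrite gr_oneE -(inj_eq (mulgI h)) mulVKg mulg1 eq_sym.
by rewrite (negbTE hg) mulr0.
Qed.

Fact gr_mulDl : left_distributive gr_mul +%R.
Proof.
move=> a b c; apply/fsfunP => g.
set S := (finsupp a `|` finsupp b)%fset.
rewrite group_ringDE !(@gr_mulES _ _ _ S) ?fsubsetUl ?fsubsetUr//; last first.
  by rewrite finsupp_sub.
by rewrite -big_split/=; apply: eq_bigr => h _; rewrite group_ringDE mulrDl.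
Qed.

Fact gr_mulDr : right_distributive gr_mul +%R.
Proof.
move=> a b c; apply/fsfunP => g.
rewrite group_ringDE !gr_mulE -big_split/=.
by apply: eq_bigr => h _; rewrite group_ringDE mulrDr.
Qed.

Fact gr_mulA : associative gr_mul.
Proof.
move=> a b c; apply/fsfunP => g.
set K := fset_mulg (finsupp a) (finsupp b).
rewrite (@gr_mulES (gr_mul a b) c g K) ?finsupp_sub// gr_mulE.
under [RHS]eq_bigr do rewrite gr_mulE mulr_suml.
rewrite exchange_big/= big_seq [RHS]big_seq; apply: eq_bigr => h ha.
rewrite (@gr_mulES b c _ [fset (h^-1 * k)%g | k in K]%fset); last first.
  apply/fsubsetP => m mb; apply/imfsetP; exists (h * m)%g => /=.
    by apply/imfset2P; exists h => //; exists m.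
  by rewrite mulKg.
rewrite big_imfset/=; last by move=> ? ? _ _; exact: mulgI.
rewrite mulr_sumr; apply: eq_bigr => k _.
by rewrite invgM invgK mulrA -!mulgA mulVKg.
Qed.

Fact gr_one_neq0 : gr_one != 0.
Proof. by apply/eqP => /fsfunP/(_ 1%g); rewrite gr_oneE group_ring0E eqxx. Qed.

HB.instance Definition _ := GRing.Zmodule_isNzRing.Build ZG
  gr_mulA gr_mul1 gr_1mul gr_mulDl gr_mulDr gr_one_neq0.

Lemma group_ringME a b g :
  (a * b) g = \sum_(h <- finsupp a) a h * b (h^-1 * g)%g.
Proof. exact: gr_mulE. Qed.

Definition gr_elt (g : G) : ZG := [fsfun h in [fset g]%fset => 1].

End GroupRing.

Section DynamicalSystem.
Variable G : groupType.
Local Notation ZG := (group_ring G).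

Definition left_ideal (f : ZG) : {pred ZG} :=
  [pred b | `[< exists a : ZG, b = a * f >]].

Fact left_ideal_zmod_closed f : zmod_closed (left_ideal f).
Proof.
split; first by apply/asboolP; exists 0; rewrite mul0r.
move=> _ _ /asboolP[a ->] /asboolP[b ->].
by apply/asboolP; exists (a - b); rewrite mulrBl.
Qed.

HB.instance Definition _ f :=
  GRing.isZmodClosed.Build ZG (left_ideal f) (left_ideal_zmod_closed f).

(* ZG / ZG f as an abelian group; its left G-action is quot_translate. *)
Definition quot_module (f : ZG) : zmodType := Quotient.quot (left_ideal f).

Definition quot_translate f (g : G) (m : quot_module f) : quot_module f :=
  (\pi_(quot_module f) (gr_elt g * repr m))%qT.

Fact quot_translateD f g : {morph @quot_translate f g : m n / m + n}.
Proof.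
move=> m n; rewrite /quot_translate -raddfD/=; apply/eqP.
rewrite -Quotient.idealrBE -mulrDr -mulrBr.
suff: repr (m + n) - (repr m + repr n) \in left_ideal f.
  by move=> /asboolP[a ->]; apply/asboolP; exists (gr_elt g * a); rewrite mulrA.
by rewrite Quotient.idealrBE raddfD/= !reprK.
Qed.

Variable R : realType.

(* The compact-open topology on the group of characters of a discrete group is
   the topology of pointwise convergence. *)
Definition characters (A : zmodType) : set {ptws A -> R[i]^o} :=
  [set chi | (forall a, `|chi a| = 1) /\
             (forall a b, chi (a + b) = chi a * chi b)].

Definition pontryagin_dual (A : zmodType) : topologicalType :=
  set_type (@characters A).

Definition dual_system (f : ZG) : topologicalType :=
  pontryagin_dual (quot_module f).

Fact dual_act_subproof f (g : G) (chi : dual_system f) :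
  (fun m => val chi (quot_translate g^-1%g m)) \in @characters (quot_module f).
Proof.
case: chi => chi /set_mem[/= chi1 chiD]; apply/mem_set; split=> [m|m n] //=.
by rewrite quot_translateD chiD.
Qed.

Definition dual_act f (g : G) (chi : dual_system f) : dual_system f :=
  exist (fun psi => psi \in @characters (quot_module f)) _
    (dual_act_subproof g chi).

End DynamicalSystem.

Section Operators.
Variables (R : realType) (G : groupType).
Local Notation C := R[i]^o.

Definition absolutely_summable (a : G -> C) : Prop :=
  (\esum_(g in setT) (normc (a g))%:E < +oo)%E.

Definition to_l1 (f : group_ring G) : G -> C := fun g => (f g)%:~R.

Definition convolution (a b : G -> C) : G -> C :=
  fun g => summability.sum (fun h => a h * b (h^-1 * g)%g).

Definition delta (g : G) : G -> C := fun h => (h == g)%:R.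

Definition l1_unit (a : G -> C) : Prop :=
  absolutely_summable a /\
  exists b, [/\ absolutely_summable b,
    convolution a b = delta 1%g & convolution b a = delta 1%g].

Definition square_summable : {pred G -> C} :=
  [pred x : G -> C | (\esum_(g in setT) (normc (x g) ^+ 2)%:E < +oo)%E].

Fact le_esumZ (c : R) (a b : G -> R) : 0 <= c -> (forall g, 0 <= b g) ->
  (forall g, a g <= c * b g) ->
  (\esum_(g in setT) (a g)%:E <= c%:E * \esum_(g in setT) (b g)%:E)%E.
Proof.
move=> c0 b0 ab; apply: ge_ereal_sup => _ [A [finA _] <-].
apply: (@le_trans _ _ (\sum_(g \in A) (c%:E * (b g)%:E))%E).
  by apply: lee_fsum => // g _; rewrite -EFinM lee_fin.
rewrite -ge0_mule_fsumr; last by move=> g; rewrite lee_fin.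
by rewrite lee_wpmul2l ?lee_fin//; apply: esum_ge; exists A.
Qed.

Fact normc_ge0 (z : C) : 0 <= normc z.
Proof. by case: z => a b; exact: sqrtr_ge0. Qed.

Fact square_summable_submod_closed : submod_closed square_summable.
Proof.
split=> [|k x y]; rewrite !inE.
  by rewrite esum1// => g _; rewrite normc0 expr0n.
move=> xfin yfin.
apply: (@le_lt_trans _ _ (2%:E * (\esum_(g in setT)
    (normc (k * x g) ^+ 2 + normc (y g) ^+ 2)%:E))%E).
  apply: le_esumZ => // [g|g]; first by rewrite addr_ge0 ?sqr_ge0.
  apply: (@le_trans _ _ ((normc (k * x g) + normc (y g)) ^+ 2)).
    by rewrite ler_sqr ?nnegrE ?addr_ge0 ?normc_ge0 ?le_normcD.
  by have := sqr_ge0 (normc (k * x g) - normc (y g)); lra.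
under eq_esum do rewrite EFinD.
rewrite esumD//; last 2 first.
- by move=> g _; rewrite lee_fin sqr_ge0.
- by move=> g _; rewrite lee_fin sqr_ge0.
rewrite lte_mul_pinfty// lte_add_pinfty//.
apply: (@le_lt_trans _ _ ((normc k ^+ 2)%:E *
    \esum_(g in setT) (normc (x g) ^+ 2)%:E)%E).
  by apply: le_esumZ => [|g|g]; rewrite ?sqr_ge0// normcM exprMn.
by rewrite lte_mul_pinfty// lee_fin sqr_ge0.
Qed.

HB.instance Definition _ :=
  GRing.isSubmodClosed.Build C (G -> C) square_summable
    square_summable_submod_closed.

Record l2 := L2 { l2_fun :> G -> C; _ : l2_fun \in square_summable }.

HB.instance Definition _ := [isSub for l2_fun].
HB.instance Definition _ := [Choice of l2 by <:].
HB.instance Definition _ := [SubChoice_isSubLmodule of l2 by <:].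

Implicit Types (x y : l2) (S T : l2 -> l2).

Fact square_summable_reindex (s s' : G -> G) x :
  cancel s s' -> cancel s' s -> l2_fun x \o s \in square_summable.
Proof.
move=> sK s'K; rewrite inE /=.
rewrite -(@reindex_esum R G G setT setT s (fun g => (normc (x g) ^+ 2)%:E)).
  by case: x.
split=> [g _//|g h _ _|g _]; first exact: (can_inj sK).
by exists (s' g).
Qed.

Definition left_translate (g : G) x : l2 :=
  L2 (square_summable_reindex x (mulVKg g) (mulKg g)).

Lemma left_translateE g x h : left_translate g x h = x (g^-1 * h)%g.
Proof. by []. Qed.

Definition right_mul (g : G) x : l2 :=
  L2 (square_summable_reindex x (mulgVK g) (mulgK g)).

Lemma right_mulE g x h : right_mul g x h = x (h * g^-1)%g.
Proof. by []. Qed.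

Fact delta_square_summable g : delta g \in square_summable.
Proof.
rewrite inE (_ : esum _ _ = \esum_(h in [set g]) 1%:E)%E.
  by rewrite esum_set1 ?lee_fin// ltry.
rewrite [RHS]esum_mkcond; apply: eq_esum => h _; rewrite /delta.
have [->|hg] := eqVneq h g; first by rewrite mem_set// normc1 expr1n.
by rewrite memNset ?normc0 ?expr0n//; exact/eqP.
Qed.

Definition l2_delta g : l2 := L2 (delta_square_summable g).

Definition inner x y : C := summability.sum (fun g => x g * conjc (y g)).

Definition l2_norm x : R :=
  Num.sqrt (fine (\esum_(g in setT) (normc (x g) ^+ 2)%:E)).

Definition bounded_op T : Prop :=
  linear T /\ exists M : R, forall x, l2_norm (T x) <= M * l2_norm x.

Definition invertible_op T : Prop :=
  bounded_op T /\ exists S, [/\ bounded_op S, cancel T S & cancel S T].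

Definition von_neumann_algebra : set (l2 -> l2) :=
  [set T | bounded_op T /\
           forall g x, T (left_translate g x) = left_translate g (T x)].

Definition vn_trace T : C := inner (T (l2_delta 1%g)) (l2_delta 1%g).

Definition positive_op T : Prop :=
  [/\ invertible_op T, forall x y, inner (T x) y = inner x (T y)
    & forall x, x != 0 -> 0 < inner (T x) x].

(* Every bounded operator has a unique bounded adjoint, so the default value
   is never used on bounded operators. *)
Definition adjoint_op T : l2 -> l2 :=
  xget (0 : l2 -> l2)
    [set S | bounded_op S /\ forall x y, inner (T x) y = inner x (S y)].

Definition spectrum T : set C :=
  [set z | ~ invertible_op (fun x => T x - z *: x)].

Definition horner_op (p : {poly C}) T : l2 -> l2 :=
  fun x => \sum_(i < size p) p`_i *: iter i T x.

(* Continuous functional calculus of a self-adjoint operator: the operator-norm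
   limit of p_n(T) for polynomials p_n converging to phi uniformly on the
   spectrum of T. *)
Definition is_functional_calculus (phi : C -> C) T S : Prop :=
  bounded_op S /\ exists p : nat -> {poly C},
    (forall e : R, 0 < e -> \forall n \near \oo,
       forall z, spectrum T z -> normc ((p n).[z] - phi z) <= e) /\
    (forall e : R, 0 < e -> \forall n \near \oo,
       forall x, l2_norm (horner_op (p n) T x - S x) <= e * l2_norm x).

Definition functional_calculus phi T : l2 -> l2 :=
  xget (0 : l2 -> l2) [set S | is_functional_calculus phi T S].

Definition log_op T : l2 -> l2 :=
  functional_calculus (fun z => (ln (complex.Re z))%:C%C) T.

(* For T invertible in the von Neumann algebra, T \o adjoint_op T is positive
   and invertible, so its spectrum is a compact subset of ]0, +oo[; the trace
   of its self-adjoint logarithm is real, and the real part is taken only to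
   obtain an element of R. *)
Definition FK_det T : R :=
  expR (2^-1 * complex.Re (vn_trace (log_op (T \o adjoint_op T)))).

(* The embedding sending a = \sum_g a_g g to \sum_g a_g R_{g^-1}, where R_g is
   right multiplication by g on formal sums. *)
Definition r_op (f : group_ring G) : l2 -> l2 :=
  fun x => \sum_(g <- finsupp f) ((f g)%:~R : C) *: right_mul g^-1%g x.

Fact l2_norm2_fin x : (\esum_(g in setT) (normc (x g) ^+ 2)%:E \is a fin_num)%E.
Proof.
rewrite ge0_fin_numE; first by case: x.
by apply: esum_ge0 => g _; rewrite lee_fin sqr_ge0.
Qed.

Fact l2_norm2_ge0 x : 0 <= fine (\esum_(g in setT) (normc (x g) ^+ 2)%:E).
Proof. by apply/fine_ge0/esum_ge0 => g _; rewrite lee_fin sqr_ge0. Qed.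

Fact l2_norm_ge0 x : 0 <= l2_norm x. Proof. exact: sqrtr_ge0. Qed.

Fact l2_norm_sqr x :
  (l2_norm x ^+ 2)%:E = (\esum_(g in setT) (normc (x g) ^+ 2)%:E)%E.
Proof. by rewrite sqr_sqrtr ?l2_norm2_ge0// fineK ?l2_norm2_fin. Qed.

Fact l2_normZ (k : C) x : l2_norm (k *: x) <= normc k * l2_norm x.
Proof.
rewrite -ler_sqr ?nnegrE ?mulr_ge0 ?normc_ge0 ?l2_norm_ge0// -lee_fin exprMn.
rewrite l2_norm_sqr EFinM l2_norm_sqr.
apply: le_esumZ => [|g|g]; rewrite ?sqr_ge0//.
by rewrite normcM exprMn.
Qed.

Fact l2_normD x y : l2_norm (x + y) <= 2 * (l2_norm x + l2_norm y).
Proof.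
rewrite -ler_sqr ?nnegrE ?mulr_ge0 ?addr_ge0 ?l2_norm_ge0//.
apply: (@le_trans _ _ (2 * (l2_norm x ^+ 2 + l2_norm y ^+ 2))); last first.
  by have := l2_norm_ge0 x; have := l2_norm_ge0 y; nra.
rewrite -lee_fin l2_norm_sqr EFinM (EFinD (l2_norm x ^+ 2)) !l2_norm_sqr -esumD; last 2 first.
- by move=> g _; rewrite lee_fin sqr_ge0.
- by move=> g _; rewrite lee_fin sqr_ge0.
apply: le_esumZ => // [g|g]; first by rewrite addr_ge0 ?sqr_ge0.
apply: (@le_trans _ _ ((normc (x g) + normc (y g)) ^+ 2)).
  by rewrite ler_sqr ?nnegrE ?addr_ge0 ?normc_ge0 ?le_normcD.
by have := sqr_ge0 (normc (x g) - normc (y g)); lra.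
Qed.

Fact l2_norm_right_mul g x : l2_norm (right_mul g x) = l2_norm x.
Proof.
congr (Num.sqrt (fine _)); rewrite (@reindex_esum R G G setT setT
  (fun h => h * g^-1)%g (fun h => (normc (x h) ^+ 2)%:E))//.
by split=> // [h k _ _|h _]; [exact: mulIg|exists (h * g)%g; rewrite ?mulgK].
Qed.

Lemma r_opE (f : group_ring G) x h :
  r_op f x h = \sum_(g <- finsupp f) ((f g)%:~R : C) * x (h * g)%g.
Proof.
rewrite /r_op; elim/big_rec2: _ => [//|g _ y _ <-].
by rewrite -[X in (h * X)%g]invgK.
Qed.

Lemma r_op_von_neumann (f : group_ring G) : von_neumann_algebra (r_op f).
Proof.
split; first split.
- move=> k x y; rewrite /r_op scaler_sumr -big_split/=.
  apply: eq_bigr => g _; rewrite scalerA [k * _]mulrC -scalerA -scalerDr.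
  by congr (_ *: _); exact: val_inj.
- suff [M [M0 HM]] : exists M : R,
      0 <= M /\ forall x, l2_norm (r_op f x) <= M * l2_norm x.
    by exists M.
  rewrite /r_op; elim: (enum_fset (finsupp f)) => [|g s [M [M0 HM]]].
    exists 0; split=> // x; rewrite big_nil mul0r /l2_norm esum1 ?sqrtr0//.
    by move=> g _; rewrite normc0 expr0n.
  set k : C := (f g)%:~R.
  exists (2 * (normc k + M)); split=> [|x].
    by rewrite mulr_ge0 ?addr_ge0 ?normc_ge0.
  rewrite big_cons -mulrA (mulrDl (normc k)).
  apply: (le_trans (l2_normD _ _)); rewrite ler_pM2l// lerD//.
  by rewrite (le_trans (l2_normZ _ _))// l2_norm_right_mul.
- move=> h x; apply: val_inj; apply/funext => m.
  rewrite [LHS]r_opE [RHS]r_opE; apply: eq_bigr => g _; congr (_ * _).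
  by rewrite !left_translateE mulgA.
Qed.

End Operators.

Arguments finitely_generated G : clear implicits.
Arguments Foelner {G} R F.
Arguments amenable G R : clear implicits.
Arguments strong_Foelner {G} R F.
Arguments topological_entropy R {G X} act Fs.
Arguments dual_system {G} R f.
Arguments dual_act {G} R f g chi.
Arguments to_l1 R {G} f.
Arguments r_op R {G} f.

(* Main.v *)
(* Let T = r(f) and, for finite F, let B_F be the compression of T to l2(F), an
   integral matrix whose spectrum lies in a fixed compact subset of (0, oo) because
   T is positive and invertible. Along a Foelner sequence the traces of the powers
   of B_F, divided by |F|, converge to those of T, so log det B_F / |F| converges to
   log det f, and it remains to compare log det B_F = log |Z^F / B_F Z^F| with the
   covering numbers, up to o(|F|).

   A point of X_f lifts to a bounded real function th with u = T th integral and
   bounded. Modifying th by an integral vector supported in F, one can make u on F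
   one of the det B_F representatives of Z^F / B_F Z^F, at the price of integral
   values near the boundary of F whose l1-norm is o(|F|); there are exp(o(|F|))
   choices for the latter. As f is invertible in l1, the values of u on F and near
   its boundary determine the coordinates of the point on F up to a small error.
   This bounds the covering numbers from above. Conversely, every representative
   is T th for some bounded th, again by inverting f in l1, and the corresponding
   points of X_f are separated by a fixed cover up to exp(o(|F|)) coincidences. *)
Require Import Defs.
From mathcomp Require Import all_boot all_order all_algebra.
From mathcomp Require Import finmap complex.
From mathcomp Require Import all_classical all_reals all_analysis.
From mathcomp Require summability.
From mathcomp Require Import ring lra.

Set Implicit Arguments.
Unset Strict Implicit.
Unset Printing Implicit Defensive.

Import Order.TTheory GRing.Theory Num.Theory.
Import numFieldNormedType.Exports.
Import ComplexField.Normc.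

Local Open Scope classical_set_scope.
Local Open Scope ring_scope.

(** * Sums and the Hilbert space l2 *)

(** Each estimate holds for every finite F with an error e|F| + c|boundary F K|, where K and c do
    not depend on F; a Foelner sequence enters only when these errors are divided by |F|. The
    delicate point is the upper bound. The vector v by which a lift is modified solves an equation
    B_F v = w with w bounded, and coercivity controls v only in l2, by a multiple of sqrt|F|. A
    single boundary value may thus be of order sqrt|F|, and counting boundary values by their
    maximum would cost |boundary| log|F|. AM-GM turns the l2-bound into an l1-bound s|F| +
    C_s|boundary| with s as small as desired, and there are at most 2^L 4^m integral vectors of
    length m and l1-norm at most L, so the cost is linear in L. Large boundary values do no harm
    when two points with the same code are compared: they cancel, and only bounded values away from
    F and its boundary remain. In the lower bound the preimages under T are bounded uniformly in F,
    so each boundary value has a bounded number of possibilities. *)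

Lemma ler_fset_sum (R : numDomainType) (I : choiceType) (u : I -> R)
    (A B : {fset I}) : (forall i, 0 <= u i) -> (A `<=` B)%fset ->
  \sum_(i <- A) u i <= \sum_(i <- B) u i.
Proof.
move=> u0 AB; rewrite [leRHS](big_fsetID _ (mem A))/=.
rewrite (_ : [fset x in B | x \in A] = A)%fset; first by rewrite lerDl sumr_ge0.
apply/fsetP => g; rewrite !inE/=; apply: andb_idl; exact: (fsubsetP AB).
Qed.

Section ComplexModulus.
Variable R : realType.
Local Notation C := R[i]^o.
Implicit Types (z w : C) (r : R).

Lemma normcE z : normc z = Num.sqrt (complex.Re z ^+ 2 + complex.Im z ^+ 2).
Proof. by case: z. Qed.

Lemma sqr_normcE z : normc z ^+ 2 = complex.Re z ^+ 2 + complex.Im z ^+ 2.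
Proof. by rewrite normcE sqr_sqrtr// addr_ge0 ?sqr_ge0. Qed.

(* [le_normcD] and [normcN] are stated on the alias [Rcomplex R] of [R[i]]. *)
Lemma normc_triangle z w : normc (z + w) <= normc z + normc w.
Proof. exact: le_normcD. Qed.

Lemma normc_opp z : normc (- z) = normc z.
Proof. exact: normcN. Qed.

Lemma normc_distC z w : normc (z - w) = normc (w - z).
Proof. by rewrite -normc_opp opprB. Qed.

Lemma normc_sum (I : Type) (s : seq I) (P : pred I) (F : I -> C) :
  normc (\sum_(i <- s | P i) F i) <= \sum_(i <- s | P i) normc (F i).
Proof.
elim/big_rec2: _ => [|i x y _ h]; first by rewrite normc0.
by rewrite (le_trans (normc_triangle _ _))// lerD2l.
Qed.

Lemma normc_real r : normc (r%:C%C) = `|r|.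
Proof. by rewrite normcE/= expr0n/= addr0 sqrtr_sqr. Qed.

Lemma normc_conj z : normc (conjc z) = normc z.
Proof. by case: z => a b; rewrite !normcE/= sqrrN. Qed.

Lemma mul_conjc z : z * conjc z = (normc z ^+ 2)%:C%C.
Proof.
rewrite sqr_normcE; case: z => a b; apply/eqP; rewrite eq_complex/=.
by apply/andP; split; apply/eqP; ring.
Qed.

Lemma conjcD z w : conjc (z + w) = conjc z + conjc w.
Proof. by case: z => a b; case: w => c d; congr Complex; rewrite opprD. Qed.

Lemma conjcN z : conjc (- z) = - conjc z. Proof. by case: z. Qed.

Lemma conjcM z w : conjc (z * w) = conjc z * conjc w.
Proof. by case: z => a b; case: w => c d; congr Complex; ring. Qed.

Lemma conjc_i : conjc ('i%C : C) = - 'i%C.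
Proof. by apply/eqP; rewrite eq_complex/= oppr0 !eqxx. Qed.

Lemma ReD z w : complex.Re (z + w) = complex.Re z + complex.Re w.
Proof. by case: z; case: w. Qed.

Lemma ImD z w : complex.Im (z + w) = complex.Im z + complex.Im w.
Proof. by case: z; case: w. Qed.

Lemma ReN z : complex.Re (- z) = - complex.Re z. Proof. by case: z. Qed.
Lemma ImN z : complex.Im (- z) = - complex.Im z. Proof. by case: z. Qed.

Lemma Re_sum (I : Type) (s : seq I) (P : pred I) (F : I -> C) :
  complex.Re (\sum_(i <- s | P i) F i) = \sum_(i <- s | P i) complex.Re (F i).
Proof. by elim/big_rec2: _ => [//|i x y _ <-]; rewrite ReD. Qed.

Lemma Re_normc z : `|complex.Re z| <= normc z.
Proof. by rewrite normcE -sqrtr_sqr ler_wsqrtr// lerDl sqr_ge0. Qed.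

Lemma Im_normc z : `|complex.Im z| <= normc z.
Proof. by rewrite normcE -sqrtr_sqr ler_wsqrtr// lerDr sqr_ge0. Qed.

Lemma normc_ReIm z : normc z <= `|complex.Re z| + `|complex.Im z|.
Proof.
rewrite -ler_sqr ?nnegrE ?normc_ge0 ?addr_ge0// sqr_normcE.
rewrite sqrrD !real_normK ?num_real// lerD2r lerDl.
by rewrite mulrn_wge0 ?mulr_ge0.
Qed.

Lemma le0_normc z : normc z <= 0 -> z = 0.
Proof.
by move=> h; apply: eq0_normc; apply/eqP; rewrite eq_le h normc_ge0.
Qed.

Lemma eps_normc z (k : R) : (forall e : R, 0 < e -> normc z <= k * e) -> z = 0.
Proof.
move=> h; apply: le0_normc; apply/ler_addgt0Pr => e e0; rewrite add0r.
have k1 : 0 < `|k| + 1 by rewrite ltr_wpDl.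
apply: (le_trans (h (e / (`|k| + 1)) _)); first by rewrite divr_gt0.
rewrite mulrC -mulrA -[leRHS]mulr1 ler_pM2l// ler_pdivrMl//.
by rewrite mulr1 (le_trans (ler_norm k))// lerDl.
Qed.

Section Summation.
Variable I : choiceType.
Implicit Types (a b : I -> C) (A B : {fset I}).

(** [summability.sum] is a [lim], which says nothing without convergence. This epsilon form carries
    the convergence along, so that the rules for [inner] and [convolution] follow from those for
    [has_sum]. *)
Definition has_sum a (l : C) := forall e : R, 0 < e ->
  exists A, forall B, (A `<=` B)%fset -> normc (\sum_(i <- B) a i - l) <= e.

Lemma has_sum_sum a l : has_sum a l -> summability.sum a = l.
Proof.
move=> al; apply: cvg_lim; first exact: norm_hausdorff.
  exact: summability.totally_filter.
apply: (iffRL (@cvgrPdist_le _ C _ _ summability.totally_filter _ _)) => e e0.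
have e_real : e = (complex.Re e)%:C%C by rewrite RRe_real// gtr0_real.
have Re_e : 0 < complex.Re e by move: e0; rewrite e_real ltcR.
have [A hA] := al _ Re_e; exists A => // B AB.
rewrite /summability.partial_sum -(big_seq_fsetE _ _ xpredT a).
by rewrite /= e_real distrC lecR; exact: hA.
Qed.

Lemma has_sumD a b l m : has_sum a l -> has_sum b m ->
  has_sum (fun i => a i + b i) (l + m).
Proof.
move=> al bm e e0; have e2 : 0 < e / 2 by rewrite divr_gt0.
have [A hA] := al _ e2; have [B hB] := bm _ e2.
exists (A `|` B)%fset => S; rewrite fsubUset => /andP[AS BS].
rewrite big_split/= opprD addrACA [e]splitr.
by rewrite (le_trans (normc_triangle _ _))// lerD ?hA ?hB.
Qed.

Lemma has_sumZ (k : C) a l : has_sum a l -> has_sum (fun i => k * a i) (k * l).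
Proof.
move=> al e e0; have k1 : 0 < normc k + 1 by rewrite ltr_wpDl ?normc_ge0.
have [|A hA] := al (e / (normc k + 1)); first by rewrite divr_gt0.
exists A => B AB; rewrite -mulr_sumr -mulrBr normcM.
apply: (@le_trans _ _ ((normc k + 1) * (e / (normc k + 1)))).
  by rewrite ler_pM ?normc_ge0 ?hA// lerDl.
by rewrite mulrCA divff ?gt_eqF// mulr1.
Qed.

Lemma has_sum_conj a l : has_sum a l -> has_sum (fun i => conjc (a i)) (conjc l).
Proof.
move=> al e e0; have [A hA] := al _ e0; exists A => B AB.
by rewrite -rmorph_sum -rmorphB/= normc_conj hA.
Qed.

Lemma has_sum_finite a A : (forall i, i \notin A -> a i = 0) ->
  has_sum a (\sum_(i <- A) a i).
Proof.
move=> a0 e e0; exists A => B AB.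
rewrite -(big_fset_incl _ AB) ?subrr ?normc0 ?ltW// => i iB iA.
exact: a0.
Qed.

End Summation.
End ComplexModulus.

Section L2.
Variables (R : realType) (G : groupType).
Local Notation C := R[i]^o.
Local Notation l2 := (l2 R G).
Implicit Types (x y z : l2) (k : C) (A B : {fset G}).

Lemma l2_eqP x y : (forall g, x g = y g) -> x = y.
Proof. by move=> xy; apply: val_inj; apply/funext. Qed.

Lemma l2DE x y g : (x + y) g = x g + y g. Proof. by []. Qed.
Lemma l2NE x g : (- x) g = - x g. Proof. by []. Qed.
Lemma l2ZE k x g : (k *: x) g = k * x g. Proof. by []. Qed.
Lemma l2BE x y g : (x - y) g = x g - y g. Proof. by []. Qed.

Lemma fset_sum_esum (u : G -> R) (M : R) : (forall g, 0 <= u g) ->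
  (forall A, \sum_(g <- A) u g <= M) ->
  (\esum_(g in setT) (u g)%:E <= M%:E)%E.
Proof.
move=> u0 uM; apply: ge_ereal_sup => _ [A [finA _] <-].
by rewrite fsbig_finite//= sumEFin lee_fin.
Qed.

Lemma fset_sum_norm x A : \sum_(g <- A) normc (x g) ^+ 2 <= l2_norm x ^+ 2.
Proof.
rewrite -lee_fin l2_norm_sqr; apply: esum_ge.
exists [set` A]; first by split.
by rewrite fsbig_finite//= set_fsetK sumEFin.
Qed.

Lemma fset_sum_norm_approx x (e : R) : 0 < e ->
  exists A, l2_norm x ^+ 2 - e < \sum_(g <- A) normc (x g) ^+ 2.
Proof.
move=> e0; have : ((l2_norm x ^+ 2 - e)%:E < \esum_(g in setT) (normc (x g) ^+ 2)%:E)%E.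
  by rewrite -l2_norm_sqr lte_fin ltrBlDr ltrDl.
move=> /ereal_sup_gt[_ [A [finA _] <-]].
rewrite fsbig_finite//= sumEFin lte_fin => h.
by exists (fset_set A).
Qed.

Lemma l2_norm_le x (M : R) : 0 <= M ->
  (forall A, \sum_(g <- A) normc (x g) ^+ 2 <= M ^+ 2) -> l2_norm x <= M.
Proof.
move=> M0 h; rewrite -ler_sqr ?nnegrE ?l2_norm_ge0// -lee_fin l2_norm_sqr.
by apply: fset_sum_esum => // g; rewrite sqr_ge0.
Qed.

Lemma square_summable_bound (u : G -> C) (M : R) :
  (forall A, \sum_(g <- A) normc (u g) ^+ 2 <= M) -> u \in @square_summable R G.
Proof.
move=> uM; rewrite inE/= (@le_lt_trans _ _ M%:E) ?ltry//.
by apply: fset_sum_esum => // g; rewrite sqr_ge0.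
Qed.

Lemma normc_l2_norm x g : normc (x g) <= l2_norm x.
Proof.
rewrite -ler_sqr ?nnegrE ?normc_ge0 ?l2_norm_ge0//.
by have := fset_sum_norm x [fset g]%fset; rewrite big_seq_fset1.
Qed.

Lemma l2_norm_eq0 x : l2_norm x <= 0 -> x = 0.
Proof.
move=> x0; apply: l2_eqP => g; apply: le0_normc.
exact: le_trans (normc_l2_norm x g) x0.
Qed.

Lemma l2_norm0 : l2_norm (0 : l2) = 0.
Proof.
apply/le_anti/andP; split; last exact: l2_norm_ge0.
apply: l2_norm_le => // A; rewrite big1 ?expr0n// => g _.
by rewrite normc0 expr0n.
Qed.

Lemma l2_normN x : l2_norm (- x) = l2_norm x.
Proof.
rewrite /l2_norm; congr (Num.sqrt (fine _)); apply: eq_esum => g _.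
by rewrite l2NE normc_opp.
Qed.

Lemma has_sum_norm x : has_sum (fun g => (normc (x g) ^+ 2)%:C%C : C) (l2_norm x ^+ 2)%:C%C.
Proof.
move=> e e0; have [A hA] := fset_sum_norm_approx x e0.
exists A => B AB; rewrite -rmorph_sum -rmorphB (normc_real (_ - _)) ler_norml.
have hB := fset_sum_norm x B.
have : \sum_(g <- A) normc (x g) ^+ 2 <= \sum_(g <- B) normc (x g) ^+ 2.
  by apply: ler_fset_sum => // g; rewrite sqr_ge0.
move=> hAB; apply/andP; split; lra.
Qed.

Lemma inner_has_sum x y : has_sum (fun g => x g * conjc (y g)) (inner x y).
Proof.
suff [l hl] : exists l, has_sum (fun g => x g * conjc (y g)) l.
  by rewrite /inner (has_sum_sum hl).
(* polarization *)
have -> : (fun g => x g * conjc (y g)) = (fun g => 4^-1 * (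
    (normc ((x + y) g) ^+ 2)%:C%C + - 1 * (normc ((x - y) g) ^+ 2)%:C%C +
    'i%C * (normc ((x + 'i%C *: y) g) ^+ 2)%:C%C +
    (- 'i%C) * (normc ((x - 'i%C *: y) g) ^+ 2)%:C%C)).
  apply/funext => g; rewrite -!mul_conjc !l2BE !l2DE !l2ZE.
  rewrite !(conjcD, conjcN, conjcM) conjc_i.
  have i2 : ('i%C * 'i%C : C) = -1 by rewrite -expr2 sqr_i.
  have n4 : (4%:R : C) != 0 by rewrite pnatr_eq0.
  move: (x g) (y g) (conjc (x g)) (conjc (y g)) ('i%C : C) i2 => a b a' b' i i2.
  apply: (mulfI n4); rewrite [RHS]mulrA mulfV// mul1r.
  (* [ring] treats i as a variable; here i occurs only through its square, which is then replaced by
     -1. *)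
  transitivity (2 * (a * b' + b * a') - 2 * (i * i) * (a * b' - b * a')).
    by rewrite i2; ring.
  by ring.
by eexists; apply: has_sumZ; do 3 (apply: has_sumD; last by
  apply: has_sumZ; exact: has_sum_norm); exact: has_sum_norm.
Qed.

Lemma innerDl x y z : inner (x + y) z = inner x z + inner y z.
Proof.
apply: has_sum_sum; have := has_sumD (inner_has_sum x z) (inner_has_sum y z).
by under eq_fun do rewrite -mulrDl.
Qed.

Lemma innerZl k x y : inner (k *: x) y = k * inner x y.
Proof.
apply: has_sum_sum; have := has_sumZ k (inner_has_sum x y).
by under eq_fun do rewrite mulrA.
Qed.

Lemma inner_conj x y : inner y x = conjc (inner x y).
Proof.
apply: has_sum_sum; have := has_sum_conj (inner_has_sum x y).
by under eq_fun do rewrite conjcM conjcK mulrC.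
Qed.

Lemma innerNl x y : inner (- x) y = - inner x y.
Proof. by rewrite -scaleN1r innerZl mulN1r. Qed.

Lemma innerBl x y z : inner (x - y) z = inner x z - inner y z.
Proof. by rewrite innerDl innerNl. Qed.

Lemma innerDr x y z : inner z (x + y) = inner z x + inner z y.
Proof. by rewrite inner_conj innerDl conjcD -!inner_conj. Qed.

Lemma innerZr k x y : inner x (k *: y) = conjc k * inner x y.
Proof. by rewrite inner_conj innerZl conjcM -inner_conj. Qed.

Lemma innerNr x y : inner x (- y) = - inner x y.
Proof. by rewrite inner_conj innerNl conjcN -inner_conj. Qed.

Lemma innerBr x y z : inner z (x - y) = inner z x - inner z y.
Proof. by rewrite innerDr innerNr. Qed.

Lemma inner_norm x : inner x x = (l2_norm x ^+ 2)%:C%C.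
Proof.
apply: has_sum_sum; have := has_sum_norm x.
by under eq_fun do rewrite -mul_conjc.
Qed.

Lemma inner0l x : inner 0 x = 0.
Proof. by rewrite -(scale0r 0) innerZl mul0r. Qed.

Lemma inner0r x : inner x 0 = 0.
Proof. by rewrite inner_conj inner0l conjc0. Qed.

Lemma inner_deltar x g : inner x (l2_delta R g) = x g.
Proof.
rewrite -[RHS]mulr1; apply: has_sum_sum.
rewrite (_ : x g * 1 = \sum_(h <- [fset g]%fset) x h * conjc (l2_delta R g h)).
  apply: has_sum_finite => h; rewrite inE => hg.
  by rewrite /= /delta (negbTE hg) conjc0 mulr0.
by rewrite big_seq_fset1/= /delta eqxx conjc1.
Qed.

Lemma inner_deltal x g : inner (l2_delta R g) x = conjc (x g).
Proof. by rewrite inner_conj inner_deltar. Qed.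

(** Source of Cauchy-Schwarz, of the triangle inequality and of the contraction estimates below,
    each with its own choice of [k]. *)
Lemma sqr_norm_sub k x y : l2_norm (x - k *: y) ^+ 2 =
  l2_norm x ^+ 2 - 2 * complex.Re (conjc k * inner x y) +
  normc k ^+ 2 * l2_norm y ^+ 2.
Proof.
have : inner (x - k *: y) (x - k *: y) = inner x x -
    (conjc k * inner x y + conjc (conjc k * inner x y)) +
    (normc k ^+ 2)%:C%C * inner y y.
  rewrite innerBl !innerBr !innerZl !innerZr conjcM conjcK -inner_conj -mul_conjc.
  by move: (inner x x) (inner y y) (inner x y) (inner y x) (conjc k) => a b c d e; ring.
rewrite !inner_norm => /(congr1 (@complex.Re R))/= ->.
by case: (conjc k * inner x y) => a b /=; ring.
Qed.

Lemma cauchy_schwarz x y : normc (inner x y) <= l2_norm x * l2_norm y.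
Proof.
have [/l2_norm_eq0->|y0] := leP (l2_norm y) 0.
  by rewrite inner0r normc0 mulr_ge0 ?l2_norm_ge0.
rewrite -ler_sqr ?nnegrE ?normc_ge0 ?mulr_ge0 ?l2_norm_ge0// exprMn.
(* The scalar is the coefficient of the orthogonal projection of x to the line of y. *)
have := sqr_ge0 (l2_norm (x - ((l2_norm y ^- 2)%:C%C * inner x y) *: y)).
rewrite sqr_norm_sub normcM normc_real ger0_norm ?invr_ge0 ?sqr_ge0//.
rewrite conjcM -mulrA [conjc (inner x y) * _]mulrC mul_conjc.
rewrite (_ : complex.Re _ = l2_norm y ^- 2 * normc (inner x y) ^+ 2); last first.
  by rewrite /=; ring.
have y2 : l2_norm y ^+ 2 != 0 by rewrite expf_neq0// gt_eqF.
rewrite exprMn exprVn.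
rewrite (_ : _ + _ = l2_norm x ^+ 2 - normc (inner x y) ^+ 2 / l2_norm y ^+ 2).
  by rewrite subr_ge0 ler_pdivrMr// exprn_gt0.
by field; rewrite gt_eqF.
Qed.

Lemma l2_norm_triangle x y : l2_norm (x + y) <= l2_norm x + l2_norm y.
Proof.
rewrite -ler_sqr ?nnegrE ?l2_norm_ge0 ?addr_ge0 ?l2_norm_ge0//.
have := cauchy_schwarz x (- y); rewrite l2_normN => h.
have := Re_normc (inner x (- y)); rewrite ler_norml => /andP[h1 _].
have -> : x + y = x - 1 *: (- y) by rewrite scale1r opprK.
rewrite sqr_norm_sub l2_normN conjc1 mul1r normc1.
nra.
Qed.

Lemma l2_normZE k x : l2_norm (k *: x) = normc k * l2_norm x.
Proof.
have : inner (k *: x) (k *: x) = (normc k ^+ 2)%:C%C * inner x x.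
  by rewrite innerZl innerZr mulrA mul_conjc.
rewrite !inner_norm -rmorphM => /complexI; rewrite -exprMn => /eqP.
by rewrite eqrXn2 ?mulr_ge0 ?normc_ge0 ?l2_norm_ge0// => /eqP.
Qed.

Lemma l2_norm_distC x y : l2_norm (x - y) = l2_norm (y - x).
Proof. by rewrite -l2_normN opprB. Qed.

Lemma l2_norm_gt0 x : x != 0 -> 0 < l2_norm x.
Proof.
by move=> x0; rewrite ltNge; apply: contra_neqN x0 => /l2_norm_eq0.
Qed.

Lemma l2_norm_delta g : l2_norm (l2_delta R (G := G) g) = 1.
Proof.
apply/eqP; rewrite -(@eqrXn2 _ 2) ?l2_norm_ge0// expr1n; apply/eqP/complexI.
by rewrite -inner_norm inner_deltar/= /delta eqxx.
Qed.

End L2.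

(** * Bounded operators and their spectra *)

Section RealSequences.
Variable R : realType.

Lemma cauchy_real (u e : nat -> R) :
  (forall n m, (n <= m)%N -> `|u n - u m| <= e n) -> e @ \oo --> 0 ->
  cvg (u @ \oo).
Proof.
move=> ue e0; apply: cauchy_cvg; apply: cauchy_exP => d d0.
have [N _ hN] : \forall n \near \oo, e n < d.
  move: e0 => /cvgr0_norm_lt/(_ d d0); apply: filterS => n.
  exact: le_lt_trans (ler_norm _).
exists (u N); exists N => // m /= Nm.
by rewrite -ball_normE/= (le_lt_trans (ue _ _ Nm))// hN/=.
Qed.

Lemma near_le0 (e : nat -> R) : e @ \oo --> 0 ->
  forall d, 0 < d -> exists N, forall n, (N <= n)%N -> e n <= d.
Proof.
move=> e0 d d0; have [N _ hN] : \forall n \near \oo, e n < d.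
  move: e0 => /cvgr0_norm_lt/(_ d d0); apply: filterS => n.
  exact: le_lt_trans (ler_norm _).
by exists N => n Nn; apply: ltW; exact: hN.
Qed.

Lemma le0_of_eps (a k : R) : (forall e, 0 < e -> a <= k * e) -> a <= 0.
Proof.
move=> h; apply/ler_addgt0Pr => e e0; rewrite add0r.
have k1 : 0 < `|k| + 1 by rewrite ltr_wpDl.
apply: (le_trans (h (e / (`|k| + 1)) _)); first by rewrite divr_gt0.
rewrite mulrC -mulrA -[leRHS]mulr1 ler_pM2l// ler_pdivrMl//.
by rewrite mulr1 (le_trans (ler_norm k))// lerDl.
Qed.

End RealSequences.

Section Operators.
Variables (R : realType) (G : groupType).
Local Notation C := R[i]^o.
Local Notation l2 := (l2 R G).
Implicit Types (x y : l2) (k : C) (S T : l2 -> l2).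

Lemma linD T x y : linear T -> T (x + y) = T x + T y.
Proof. by move=> hT; rewrite -[x in LHS]scale1r hT scale1r. Qed.

Lemma lin0 T : linear T -> T 0 = 0.
Proof. by move=> hT; apply: (addrI (T 0)); rewrite -linD// !addr0. Qed.

Lemma linZ T k x : linear T -> T (k *: x) = k *: T x.
Proof. by move=> hT; rewrite -[k *: x]addr0 hT lin0// addr0. Qed.

Lemma linN T x : linear T -> T (- x) = - T x.
Proof. by move=> hT; rewrite -scaleN1r linZ// scaleN1r. Qed.

Lemma linB T x y : linear T -> T (x - y) = T x - T y.
Proof. by move=> hT; rewrite linD// linN. Qed.

Lemma linsum T (I : Type) (s : seq I) (F : I -> l2) : linear T ->
  T (\sum_(i <- s) F i) = \sum_(i <- s) T (F i).
Proof.
by move=> hT; elim/big_rec2: _ => [|i x y _ <-]; [exact: lin0|rewrite linD].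
Qed.

Lemma lin_comp S T : linear S -> linear T -> linear (S \o T).
Proof. by move=> hS hT k x y /=; rewrite hT hS. Qed.

Lemma lin_iter T n : linear T -> linear (iter n T).
Proof. by move=> hT; elim: n => [//|n IHn] k x y /=; rewrite IHn hT. Qed.

Lemma bounded_op_comp S T : bounded_op S -> bounded_op T -> bounded_op (S \o T).
Proof.
move=> [lS [M hM]] [lT [N hN]]; split; first exact: lin_comp.
exists (`|M| * `|N|) => x /=; apply: (le_trans (hM _)); rewrite -mulrA.
apply: (@le_trans _ _ (`|M| * l2_norm (T x))).
  by rewrite ler_wpM2r ?l2_norm_ge0// ler_norm.
by rewrite ler_wpM2l// (le_trans (hN _))// ler_wpM2r ?l2_norm_ge0// ler_norm.
Qed.

Lemma bounded_opD S T : bounded_op S -> bounded_op T ->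
  bounded_op (fun x => S x + T x).
Proof.
move=> [lS [M hM]] [lT [N hN]]; split.
  by move=> k x y; rewrite lS lT scalerDr addrACA.
exists (M + N) => x; rewrite mulrDl.
by rewrite (le_trans (l2_norm_triangle _ _))// lerD.
Qed.

Lemma bounded_opZ k T : bounded_op T -> bounded_op (fun x => k *: T x).
Proof.
move=> [lT [N hN]]; split.
  by move=> c x y; rewrite lT scalerDr !scalerA mulrC.
exists (normc k * N) => x.
by rewrite l2_normZE -mulrA ler_wpM2l ?normc_ge0.
Qed.

Lemma bounded_op_id : bounded_op (fun x : l2 => x).
Proof. by split=> //; exists 1 => x; rewrite mul1r. Qed.

Lemma bounded_op_iter T n : bounded_op T -> bounded_op (iter n T).
Proof.
move=> hT; elim: n => [|n IHn]; first exact: bounded_op_id.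
exact: bounded_op_comp.
Qed.

Lemma bounded_op_sum (I : Type) (s : seq I) (F : I -> l2 -> l2) :
  (forall i, bounded_op (F i)) -> bounded_op (fun x => \sum_(i <- s) F i x).
Proof.
move=> hF; elim: s => [|i s IHs].
  split=> [k x y|]; first by rewrite !big_nil scaler0 addr0.
  by exists 0 => x; rewrite big_nil l2_norm0 mul0r.
under eq_fun do rewrite big_cons; exact: bounded_opD.
Qed.

Lemma bounded_op_pos T : bounded_op T ->
  exists M, 0 < M /\ forall x, l2_norm (T x) <= M * l2_norm x.
Proof.
move=> [_ [M hM]]; exists (`|M| + 1); rewrite ltr_wpDl//; split=> // x.
rewrite (le_trans (hM x))// ler_wpM2r ?l2_norm_ge0//.
by rewrite (le_trans (ler_norm M))// lerDl.
Qed.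

Lemma l2_norm_sum_le (I : Type) (s : seq I) (F : I -> l2) :
  l2_norm (\sum_(i <- s) F i) <= \sum_(i <- s) l2_norm (F i).
Proof.
elim/big_rec2: _ => [|i x y _ h]; first by rewrite l2_norm0.
by rewrite (le_trans (l2_norm_triangle _ _))// lerD2l.
Qed.

(** Completeness of the bounded operators. The limit is built coordinate by coordinate from the
    completeness of the reals; the bounds on finite sets of coordinates pass to the limit and give
    both square summability and the rate. *)
Lemma op_norm_limit (Q : nat -> l2 -> l2) (e : nat -> R) :
  (forall n, bounded_op (Q n)) -> e @ \oo --> 0 ->
  (forall n m x, (n <= m)%N -> l2_norm (Q n x - Q m x) <= e n * l2_norm x) ->
  exists S, bounded_op S /\ forall n x, l2_norm (Q n x - S x) <= e n * l2_norm x.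
Proof.
move=> Qb e0 Qe.
pose s x g : C := Complex (lim ((fun n => complex.Re (Q n x g)) @ \oo))
                  (lim ((fun n => complex.Im (Q n x g)) @ \oo)).
have ex0 x : (fun n => e n * l2_norm x) @ \oo --> 0.
  by rewrite -(mul0r (l2_norm x)); exact: cvgMl.
have cRe x g : (fun n => complex.Re (Q n x g)) @ \oo --> complex.Re (s x g).
  apply: (@cauchy_real _ _ (fun n => e n * l2_norm x)) (ex0 x) => n m nm.
  rewrite -ReN -ReD (le_trans (Re_normc _))//.
  rewrite (le_trans (normc_l2_norm (Q n x - Q m x) g))//.
  exact: Qe.
have cIm x g : (fun n => complex.Im (Q n x g)) @ \oo --> complex.Im (s x g).
  apply: (@cauchy_real _ _ (fun n => e n * l2_norm x)) (ex0 x) => n m nm.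
  rewrite -ImN -ImD (le_trans (Im_normc _))//.
  rewrite (le_trans (normc_l2_norm (Q n x - Q m x) g))//.
  exact: Qe.
have sum_le n x (A : {fset G}) :
    \sum_(g <- A) normc (Q n x g - s x g) ^+ 2 <= (e n * l2_norm x) ^+ 2.
  have cA : (fun m => \sum_(g <- A) normc (Q n x g - Q m x g) ^+ 2) @ \oo -->
      \sum_(g <- A) normc (Q n x g - s x g) ^+ 2.
    elim: (enum_fset A) => [|g t IHt].
      rewrite big_nil; under eq_fun do rewrite big_nil; exact: cvg_cst.
    rewrite big_cons; under eq_fun do rewrite big_cons.
    apply: cvgD IHt; rewrite sqr_normcE !ReD !ImD !ReN !ImN !expr2.
    under eq_fun do rewrite sqr_normcE !ReD !ImD !ReN !ImN !expr2.
    have dRe : (fun m => complex.Re (Q n x g) - complex.Re (Q m x g)) @ \oo -->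
        complex.Re (Q n x g) - complex.Re (s x g).
      by apply: cvgB; [exact: cvg_cst|exact: cRe].
    have dIm : (fun m => complex.Im (Q n x g) - complex.Im (Q m x g)) @ \oo -->
        complex.Im (Q n x g) - complex.Im (s x g).
      by apply: cvgB; [exact: cvg_cst|exact: cIm].
    by apply: cvgD; [apply: (cvgM dRe dRe)|apply: (cvgM dIm dIm)].
  have := @closed_cvg _ _ \oo _ _ (fun r => r <= (e n * l2_norm x) ^+ 2) _ _ _ cA.
  apply; first exact: closed_le.
  exists n => // m /= nm; apply: (@le_trans _ _ (l2_norm (Q n x - Q m x) ^+ 2)).
    exact: (fset_sum_norm (Q n x - Q m x)).
  have h := Qe n m x nm.
  by rewrite ler_sqr ?nnegrE ?l2_norm_ge0// (le_trans _ h) ?l2_norm_ge0.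
have s_l2 x : s x \in @square_summable R G.
  rewrite (_ : s x = l2_fun (Q 0 x) - (fun g => Q 0 x g - s x g)).
    apply: rpredB; first by case: (Q 0 x).
    exact: square_summable_bound (sum_le 0 x).
  apply/funext => g; change (s x g = Q 0%N x g - (Q 0%N x g - s x g)).
  by rewrite opprB addrC subrK.
pose S x : l2 := L2 (s_l2 x).
have hS n x : l2_norm (Q n x - S x) <= e n * l2_norm x.
  apply: l2_norm_le; last exact: sum_le.
  by rewrite (le_trans _ (Qe n n x (leqnn n)))// l2_norm_ge0.
exists S; split=> //; split; last first.
  have [M [_ hM]] := bounded_op_pos (Qb 0%N).
  exists (M + e 0%N) => x; rewrite -[S x](subrK (Q 0%N x)) addrC mulrDl.
  by rewrite (le_trans (l2_norm_triangle _ _))// lerD// l2_norm_distC.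
move=> k x y; apply/eqP; rewrite -subr_eq0; apply/eqP/l2_norm_eq0.
apply: (@le0_of_eps _ _ (l2_norm (k *: x + y) + normc k * l2_norm x + l2_norm y)).
move=> d d0; have [N hN] := near_le0 e0 d0.
have -> : S (k *: x + y) - (k *: S x + S y) =
    - (Q N (k *: x + y) - S (k *: x + y)) + (k *: (Q N x - S x) + (Q N y - S y)).
  rewrite (Qb N).1 scalerBr; apply: l2_eqP => g.
  rewrite !(l2DE, l2NE, l2ZE); ring.
rewrite (le_trans (l2_norm_triangle _ _))// -addrA mulrDl lerD ?l2_normN//.
  by rewrite (le_trans (hS _ _))// mulrC ler_wpM2l ?l2_norm_ge0// hN.
rewrite (le_trans (l2_norm_triangle _ _))// mulrDl lerD//.
  rewrite l2_normZE -mulrA ler_wpM2l ?normc_ge0// (le_trans (hS _ _))//.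
  by rewrite mulrC ler_wpM2l ?l2_norm_ge0// hN.
by rewrite (le_trans (hS _ _))// mulrC ler_wpM2l ?l2_norm_ge0// hN.
Qed.

End Operators.

(** * Power series in a contraction *)

Section Series.
Variables (R : realType) (G : groupType).
Local Notation C := R[i]^o.
Local Notation l2 := (l2 R G).
Implicit Types (x y : l2) (k : C) (A S N : l2 -> l2).

Lemma iter_contraction N (r : R) : 0 <= r ->
  (forall x, l2_norm (N x) <= r * l2_norm x) ->
  forall n x, l2_norm (iter n N x) <= r ^+ n * l2_norm x.
Proof.
move=> r0 hN; elim=> [|n IHn] x; first by rewrite mul1r.
by rewrite iterS (le_trans (hN _))// exprS -mulrA ler_wpM2l.
Qed.

Lemma geometric_tail (r : R) n m : 0 <= r < 1 -> (n <= m)%N ->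
  \sum_(n <= i < m) r ^+ i <= r ^+ n / (1 - r).
Proof.
move=> /andP[r0 r1] nm; rewrite -(subnKC nm).
move: (m - n)%N => d {nm}; elim: d n => [|d IHd] n.
  by rewrite addn0 big_geq// divr_ge0 ?exprn_ge0// subr_ge0 ltW.
rewrite big_ltn ?addnS ?ltnS ?leq_addr// -addSn.
apply: (le_trans (lerD (lexx _) (IHd n.+1))).
have r1' : 1 - r != 0 by rewrite subr_eq0 eq_sym lt_eqF.
by rewrite exprS le_eqVlt; apply/orP; left; apply/eqP; field.
Qed.

(** Needed twice: with all coefficients 1 for the Neumann series, and with the Taylor coefficients
    of the logarithm. *)
Lemma op_series (c : nat -> C) N (K r : R) : linear N -> 0 <= r < 1 ->
  (forall x, l2_norm (N x) <= r * l2_norm x) -> (forall n, normc (c n) <= K) ->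
  exists S, bounded_op S /\ forall n x,
    l2_norm (\sum_(0 <= i < n) c i *: iter i N x - S x) <=
    K * (r ^+ n / (1 - r)) * l2_norm x.
Proof.
move=> lN r01 hN cK; have K0 : 0 <= K by rewrite (le_trans _ (cK 0%N)) ?normc_ge0.
have r0 : 0 <= r by case/andP: r01.
have bN : bounded_op N by split=> //; exists r.
apply: op_norm_limit.
- move=> n; apply: (@bounded_op_sum _ _ _ _ (fun i x => c i *: iter i N x)) => i.
  exact/bounded_opZ/bounded_op_iter.
- rewrite -[0 in X in _ --> X](mulr0 K) -(mul0r (1 - r)^-1).
  apply: cvgMr; apply: cvgMl; apply: cvg_expr.
  by rewrite ger0_norm//; case/andP: r01.
- move=> n m x nm; rewrite l2_norm_distC (big_cat_nat (leq0n n) nm)/=.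
  rewrite [X in l2_norm X]addrAC subrr add0r.
  rewrite (le_trans (l2_norm_sum_le _ _))// -mulrA.
  apply: (@le_trans _ _ (\sum_(n <= i < m) K * (r ^+ i * l2_norm x))).
    apply: ler_sum => i _; rewrite l2_normZE ler_pM ?normc_ge0 ?l2_norm_ge0//.
    exact: iter_contraction.
  rewrite -mulr_sumr ler_wpM2l// -mulr_suml ler_wpM2r ?l2_norm_ge0//.
  exact: geometric_tail.
Qed.

Lemma norm_le_near0 (e : nat -> R) x (k : R) : e @ \oo --> 0 -> 0 <= k ->
  (forall n, l2_norm x <= e n * k) -> x = 0.
Proof.
move=> e0 k0 he; apply/l2_norm_eq0/(@le0_of_eps _ _ k) => d d0.
have [n hn] := near_le0 e0 d0; rewrite (le_trans (he n))// mulrC.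
by rewrite ler_wpM2l// hn.
Qed.

Lemma telescope_iter N n x : linear N ->
  \sum_(0 <= i < n) iter i N (x - N x) = x - iter n N x.
Proof.
move=> lN; elim: n => [|n IHn]; first by rewrite big_geq// subrr.
rewrite big_nat_recr//= IHn (linB _ _ (lin_iter n lN)) -iterSr addrA.
by rewrite subrK.
Qed.

Lemma neumann N (r : R) : linear N -> 0 <= r < 1 ->
  (forall x, l2_norm (N x) <= r * l2_norm x) ->
  exists S, [/\ bounded_op S, (forall x, S (x - N x) = x) &
    (forall x, S x - N (S x) = x)].
Proof.
move=> lN r01 hN; have /andP[r0 r1] := r01.
have r1' : 0 <= (1 - r)^-1 by rewrite invr_ge0 subr_ge0 ltW.
have c1 (n : nat) : normc (1 : C) <= 1 by rewrite normc1.
have [S [bS hS]] := @op_series (fun=> 1) N 1 r lN r01 hN c1.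
have re : (fun n => r ^+ n) @ \oo --> 0 by apply: cvg_expr; rewrite ger0_norm.
have Q n x : \sum_(0 <= i < n) 1 *: iter i N (x - N x) = x - iter n N x.
  by under eq_bigr do rewrite scale1r; exact: telescope_iter.
have QN n x : \sum_(0 <= i < n) 1 *: iter i N x -
    N (\sum_(0 <= i < n) 1 *: iter i N x) = x - iter n N x.
  rewrite -(Q n x) linsum// -sumrB; apply: eq_bigr => i _.
  by rewrite !scale1r (linB _ _ (lin_iter i lN)) -iterS iterSr.
exists S; split=> // x; apply/eqP; rewrite -subr_eq0; apply/eqP.
  apply: (norm_le_near0 (k := (1 - r)^-1 * l2_norm (x - N x) + l2_norm x) re).
    by rewrite addr_ge0 ?mulr_ge0 ?l2_norm_ge0.
  move=> n; have := hS n (x - N x); rewrite Q mul1r => h.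
  rewrite (_ : _ - x = - (x - iter n N x - S (x - N x)) - iter n N x).
    rewrite (le_trans (l2_norm_triangle _ _))// !l2_normN mulrDr mulrA lerD//.
    exact: iter_contraction.
  by apply: l2_eqP => g; rewrite !(l2DE, l2NE); ring.
apply: (norm_le_near0 (k := (1 - r)^-1 * l2_norm x + (1 - r)^-1 * l2_norm x +
  l2_norm x) re).
  by rewrite !addr_ge0 ?mulr_ge0 ?l2_norm_ge0.
move=> n; have := hS n x; rewrite mul1r; have := QN n x.
set y := \sum_(0 <= i < n) _ => hy h.
rewrite (_ : S x - N (S x) - x = - (y - S x) + N (y - S x) - iter n N x).
  rewrite (le_trans (l2_norm_triangle _ _))// l2_normN mulrDr lerD//; last first.
    exact: iter_contraction.
  rewrite (le_trans (l2_norm_triangle _ _))// l2_normN mulrDr mulrA lerD//.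
  rewrite (le_trans (hN _))// (le_trans _ h)// ler_piMl ?l2_norm_ge0//.
  exact: ltW.
have -> : iter n N x = x - (y - N y) by rewrite hy opprB addrC subrK.
by rewrite (linB y (S x) lN); apply: l2_eqP => g; rewrite !(l2DE, l2NE); ring.
Qed.

Definition self_adjoint A := forall x y, inner (A x) y = inner x (A y).

Lemma self_adjoint_real A x : self_adjoint A -> complex.Im (inner (A x) x) = 0.
Proof.
move=> sA; have := inner_conj x (A x); rewrite -sA.
by case: (inner (A x) x) => a b /= [] h; lra.
Qed.

(* With M a bound of P, the operator 1 - t P is a contraction for t = c / M^2. *)
Lemma coercive_invertible P (c : R) : bounded_op P -> 0 < c ->
  (forall x, c * l2_norm x ^+ 2 <= complex.Re (inner (P x) x)) ->
  exists S, [/\ bounded_op S, cancel P S & cancel S P].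
Proof.
move=> bP c0 hP; have lP := bP.1.
have [M0 [M00 hM0]] := bounded_op_pos bP.
(* Adding [c] keeps this a bound of P and makes q = c / M at most 1. The contraction ratio comes
   from 1 - 2tc + t^2 M^2 = 1 - q^2. *)
pose M := M0 + c; have M_gt0 : 0 < M by rewrite addr_gt0.
have hM x : l2_norm (P x) <= M * l2_norm x.
  by rewrite (le_trans (hM0 x))// ler_wpM2r ?l2_norm_ge0// lerDl ltW.
pose t := c / M ^+ 2; have t0 : 0 < t by rewrite divr_gt0 ?exprn_gt0.
pose N x := x - t%:C%C *: P x.
have lN : linear N.
  by move=> k x y; rewrite /N lP; apply: l2_eqP => g; rewrite !(l2DE, l2NE, l2ZE); ring.
pose q := c / M; have q01 : 0 < q <= 1.
  by rewrite divr_gt0//= ler_pdivrMr// mul1r lerDr ltW.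
pose r := Num.sqrt (1 - q ^+ 2).
have r2 : 0 <= 1 - q ^+ 2 by nra.
have r01 : 0 <= r < 1.
  by rewrite sqrtr_ge0/= -[ltRHS]sqrtr1 ltr_sqrt// ltrBlDr ltrDl exprn_gt0//; case/andP: q01.
have hN x : l2_norm (N x) <= r * l2_norm x.
  rewrite -ler_sqr ?nnegrE ?mulr_ge0 ?l2_norm_ge0 ?sqrtr_ge0//.
  rewrite sqr_norm_sub normc_real [(r * _) ^+ 2]exprMn [r ^+ 2]sqr_sqrtr//.
  have -> : complex.Re (conjc t%:C%C * inner x (P x)) = t * complex.Re (inner (P x) x).
    by rewrite (inner_conj (P x)); case: (inner (P x) x) => a b /=; ring.
  have h1 := hP x; have h2 : l2_norm (P x) ^+ 2 <= M ^+ 2 * l2_norm x ^+ 2.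
    by rewrite -exprMn ler_sqr ?nnegrE ?mulr_ge0 ?l2_norm_ge0// ltW.
  have -> : q ^+ 2 = 2 * (t * c) - t ^+ 2 * M ^+ 2.
    by rewrite /t /q; field; rewrite gt_eqF.
  rewrite real_normK ?num_real//.
  have := ler_wpM2l (ltW t0) h1; have := ler_wpM2l (sqr_ge0 t) h2; nra.
have [S [bS S1 S2]] := neumann lN r01 hN.
have NK x : x - N x = t%:C%C *: P x by rewrite /N opprB addrC subrK.
exists (S \o (fun x => t%:C%C *: x)); split.
- exact/bounded_op_comp/bounded_opZ/bounded_op_id.
- by move=> x /=; rewrite -NK S1.
- move=> x /=; have := S2 (t%:C%C *: x); rewrite NK => /(scalerI _); apply.
  by rewrite (inj_eq (@complexI R) t 0) gt_eqF.
Qed.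

End Series.

(** * Spectra of self-adjoint operators *)

Section Spectrum.
Variables (R : realType) (G : groupType).
Local Notation C := R[i]^o.
Local Notation l2 := (l2 R G).
Implicit Types (x y : l2) (k z : C) (A S : l2 -> l2) (p q : {poly C}).

Lemma horner_opE n p A x : (size p <= n)%N ->
  horner_op p A x = \sum_(i < n) p`_i *: iter i A x.
Proof.
move=> pn; rewrite /horner_op -!(big_mkord xpredT (fun i => p`_i *: iter i A x)).
rewrite [RHS](big_cat_nat (leq0n _) pn)/= [X in _ + X]big_nat_cond [X in _ + X]big1 ?addr0//.
by move=> i /andP[/andP[h _] _]; rewrite nth_default// scale0r.
Qed.

Lemma horner_opD p q A x : horner_op (p + q) A x = horner_op p A x + horner_op q A x.
Proof.
set n := maxn (size p) (size q).
rewrite !(@horner_opE n) ?leq_maxl ?leq_maxr ?size_polyD//.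
by rewrite -big_split; apply: eq_bigr => i _; rewrite coefD scalerDl.
Qed.

Lemma horner_opZ k p A x : horner_op (k *: p) A x = k *: horner_op p A x.
Proof.
rewrite (@horner_opE (size p)) ?size_scale_leq// /horner_op scaler_sumr.
by apply: eq_bigr => i _; rewrite coefZ scalerA.
Qed.

Lemma horner_op0 A x : horner_op 0 A x = 0.
Proof. by rewrite /horner_op size_poly0 big_ord0. Qed.

Lemma horner_opC k A x : horner_op k%:P A x = k *: x.
Proof. by rewrite (@horner_opE 1) ?size_polyC_leq1// big_ord1 coefC. Qed.

Lemma horner_opN p A x : horner_op (- p) A x = - horner_op p A x.
Proof. by rewrite -scaleN1r horner_opZ scaleN1r. Qed.

Lemma horner_opMX p A x : linear A -> horner_op (p * 'X) A x = horner_op p A (A x).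
Proof.
move=> lA; rewrite (@horner_opE (size p).+1) ?(leq_trans (size_polyMleq _ _))//; last first.
  by rewrite size_polyX addn2.
rewrite big_ord_recl coefMX scale0r add0r; apply: eq_bigr => i _.
by rewrite coefMX/= -iterSr.
Qed.

Lemma horner_op_sum (I : Type) (s : seq I) (F : I -> {poly C}) A x :
  horner_op (\sum_(i <- s) F i) A x = \sum_(i <- s) horner_op (F i) A x.
Proof.
by elim/big_rec2: _ => [|i u v _ <-]; rewrite ?horner_op0 ?horner_opD.
Qed.

Lemma bounded_horner_op p A : bounded_op A -> bounded_op (horner_op p A).
Proof.
move=> bA; rewrite /horner_op.
apply: (@bounded_op_sum _ _ _ _ (fun (i : 'I_(size p)) x => p`_i *: iter i A x)) => i.
exact/bounded_opZ/bounded_op_iter.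
Qed.

Lemma horner_op_comm p A x : linear A -> horner_op p A (A x) = A (horner_op p A x).
Proof.
move=> lA; rewrite /horner_op linsum//; apply: eq_bigr => i _.
by rewrite linZ// -iterS iterSr.
Qed.

Lemma horner_opM p q A x : linear A ->
  horner_op (p * q) A x = horner_op p A (horner_op q A x).
Proof.
move=> lA; elim/poly_ind: p x => [|p c IHp] x; first by rewrite mul0r !horner_op0.
rewrite mulrDl horner_opD -mulrA ['X * _]mulrC mulrA horner_opMX// IHp.
rewrite horner_opD horner_opMX// horner_opC mul_polyC horner_opZ; congr (_ + _).
by rewrite horner_op_comm.
Qed.

Lemma horner_opM_comm p q A x : linear A ->
  horner_op p A (horner_op q A x) = horner_op q A (horner_op p A x).
Proof. by move=> lA; rewrite -!horner_opM// mulrC. Qed.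

Lemma horner_opX A x : horner_op 'X A x = A x.
Proof.
rewrite (@horner_opE 2) ?size_polyX// !big_ord_recl big_ord0 !coefX/=.
by rewrite scale0r scale1r add0r addr0.
Qed.

Lemma horner_op_exp p n A x : linear A ->
  horner_op (p ^+ n) A x = iter n (horner_op p A) x.
Proof.
move=> lA; elim: n => [|n IHn]; first by rewrite expr0 horner_opC scale1r.
by rewrite exprS horner_opM// IHn.
Qed.

Lemma horner_op_adjoint p A x y : self_adjoint A -> linear A ->
  inner (horner_op p A x) y = inner x (horner_op (map_poly conjc p) A y).
Proof.
move=> sA lA; rewrite (@horner_opE (size p) (map_poly _ p)) ?size_poly//.
have inner_suml (s : seq 'I_(size p)) (F : 'I_(size p) -> l2) u :
    inner (\sum_(i <- s) F i) u = \sum_(i <- s) inner (F i) u.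
  by elim/big_rec2: _ => [|i a b _ <-]; rewrite ?inner0l ?innerDl.
have inner_sumr (s : seq 'I_(size p)) (F : 'I_(size p) -> l2) u :
    inner u (\sum_(i <- s) F i) = \sum_(i <- s) inner u (F i).
  by elim/big_rec2: _ => [|i a b _ <-]; rewrite ?inner0r ?innerDr.
rewrite /horner_op inner_suml inner_sumr; apply: eq_bigr => i _.
rewrite innerZl innerZr coef_map_id0 ?conjc0// conjcK; congr (_ * _).
by elim: (i : nat) x y => [//|n IHn] u v; rewrite iterSr IHn sA -iterS.
Qed.

Lemma bounded_opB_scalar A z : bounded_op A -> bounded_op (fun x => A x - z *: x).
Proof.
move=> bA; under eq_fun do rewrite -scaleNr.
exact/bounded_opD/bounded_opZ/bounded_op_id.
Qed.

(** The product of A - conj z and A - z is coercive with constant e^2, hence has an inverse S; as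
    the two factors commute, S (A - conj z) is a two-sided inverse of A - z. No reality of z is
    presupposed. *)
Lemma bounded_below_invertible A z (e : R) : bounded_op A -> self_adjoint A -> 0 < e ->
  (forall x, e * l2_norm x <= l2_norm (A x - z *: x)) ->
  invertible_op (fun x => A x - z *: x).
Proof.
move=> bA sA e0 hA; split; first exact: bounded_opB_scalar.
pose B w x := A x - w *: x; have bB w : bounded_op (B w) by exact: bounded_opB_scalar.
have adjB w x y : inner (B w x) y = inner x (B (conjc w) y).
  by rewrite innerBl innerBr innerZl innerZr conjcK sA.
have commB w w' x : B w (B w' x) = B w' (B w x).
  rewrite /B !(linB _ _ bA.1) !(linZ _ _ bA.1).
  by apply: l2_eqP => g; rewrite !(l2DE, l2NE, l2ZE); ring.
have [S [bS S1 S2]] : exists S, [/\ bounded_op S, cancel (B (conjc z) \o B z) S &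
    cancel S (B (conjc z) \o B z)].
  apply: (@coercive_invertible _ _ _ (e ^+ 2)); first exact: bounded_op_comp.
    by rewrite exprn_gt0.
  move=> x /=; rewrite adjB conjcK inner_norm /= -exprMn.
  by rewrite ler_sqr ?nnegrE ?mulr_ge0 ?l2_norm_ge0//; exact: ltW.
exists (S \o B (conjc z)); split=> [|x|x] /=; first exact: bounded_op_comp.
- exact: S1.
- have Bx : B z (B (conjc z) (S x)) = x by rewrite commB; exact: S2.
  have -> : S (B (conjc z) x) = B (conjc z) (S x) by rewrite -[in LHS]Bx; exact: S1.
  exact: Bx.
Qed.

(** Together with [approx_spectrum], this identifies the spectrum of a self-adjoint operator with
    its approximate eigenvalues; reality and bounds of the spectrum follow by testing on approximate
    eigenvectors. *)
Lemma spectrum_approx A z : bounded_op A -> self_adjoint A -> spectrum A z ->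
  forall e : R, 0 < e -> exists x, l2_norm (A x - z *: x) < e * l2_norm x.
Proof.
move=> bA sA zA e e0; apply: contrapT => /forallNP h; apply: zA.
apply: (bounded_below_invertible bA sA e0) => x.
by rewrite leNgt; apply/negP; exact: h.
Qed.

Lemma approx_spectrum A z :
  (forall e : R, 0 < e -> exists x, l2_norm (A x - z *: x) < e * l2_norm x) ->
  spectrum A z.
Proof.
move=> h [_ [S [/bounded_op_pos[M [M0 hM]] S1 _]]].
have [|x hx] := h M^-1; first by rewrite invr_gt0.
have := hM (A x - z *: x); rewrite S1 leNgt => /negP; apply.
by rewrite -ltr_pdivlMl.
Qed.

Lemma approx_pos_norm (u x : l2) (e : R) : 0 < e -> l2_norm u < e * l2_norm x ->
  0 < l2_norm x.
Proof.
move=> e0 h; have := le_lt_trans (l2_norm_ge0 u) h.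
by rewrite pmulr_rgt0.
Qed.

Lemma approx_inner A z x (e : R) : 0 < e -> l2_norm (A x - z *: x) < e * l2_norm x ->
  normc (inner (A x) x - z * (l2_norm x ^+ 2)%:C%C) <= e * l2_norm x ^+ 2.
Proof.
move=> e0 h; rewrite -inner_norm -innerZl -innerBl.
rewrite (le_trans (cauchy_schwarz _ _))// expr2 mulrA.
by rewrite ler_wpM2r ?l2_norm_ge0// ltW.
Qed.

Lemma spectrum_real A z : bounded_op A -> self_adjoint A -> spectrum A z ->
  complex.Im z = 0.
Proof.
move=> bA sA zA; apply/eqP; rewrite -normr_le0; apply/ler_addgt0Pr => e e0.
rewrite add0r; have [x hx] := spectrum_approx bA sA zA e0.
have x0 := approx_pos_norm e0 hx; have := approx_inner e0 hx.
move=> /(le_trans (Im_normc _)); rewrite ImD ImN self_adjoint_real// add0r.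
case: (z) => a b /=; rewrite mulr0 add0r normrN normrM.
by rewrite [X in _ * X]ger0_norm ?sqr_ge0// ler_pM2r// exprn_gt0.
Qed.

Lemma spectrum_bounds A z (a b : R) : bounded_op A -> self_adjoint A -> spectrum A z ->
  (forall x, a * l2_norm x ^+ 2 <= complex.Re (inner (A x) x) <= b * l2_norm x ^+ 2) ->
  a <= complex.Re z <= b.
Proof.
move=> bA sA zA hab; suff h e : 0 < e -> a - e <= complex.Re z <= b + e.
  by apply/andP; split; apply/ler_addgt0Pr => e /h /andP[h1 h2]; lra.
move=> e0; have [x hx] := spectrum_approx bA sA zA e0.
have x0 := approx_pos_norm e0 hx; have := approx_inner e0 hx.
move=> /(le_trans (Re_normc _)); rewrite ReD ReN.
have -> : complex.Re (z * (l2_norm x ^+ 2)%:C%C) = complex.Re z * l2_norm x ^+ 2.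
  by case: (z) => c d /=; rewrite mulr0 subr0.
have x2 : 0 < l2_norm x ^+ 2 by rewrite exprn_gt0.
rewrite ler_norml => /andP[h1 h2]; have /andP[h3 h4] := hab x.
rewrite -(ler_pM2r x2) -[X in _ && X](ler_pM2r x2) mulrBl mulrDl.
by apply/andP; split; lra.
Qed.

Lemma prod_bounded_below A (r : seq C) : linear A ->
  (forall z, z \in r -> ~ spectrum A z) -> exists e : R, 0 < e /\
    forall x, e * l2_norm x <= l2_norm (horner_op (\prod_(z <- r) ('X - z%:P)) A x).
Proof.
move=> lA; elim: r => [|z r IHr] hr.
  by exists 1; split=> // x; rewrite big_nil horner_opC scale1r mul1r.
have [d [d0 hd]] := IHr (fun w wr => hr w (mem_behead (s := z :: r) wr)).
have [e [e0 he]] : exists e : R, 0 < e /\ forall x, e * l2_norm x <= l2_norm (A x - z *: x).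
  apply: contrapT => /forallNP h; apply: (hr z); rewrite ?mem_head//.
  apply: approx_spectrum => e e0; have /not_andP[//|/existsNP[x /negP]] := h e.
  by rewrite -ltNge => hx; exists x.
exists (e * d); split=> [|x]; first exact: mulr_gt0.
rewrite big_cons horner_opM// horner_opD horner_opX horner_opN horner_opC.
by rewrite (le_trans _ (he _))// -mulrA (ler_wpM2l (ltW e0) (hd x)).
Qed.

(** Factor p into linear terms. If no root lay in the spectrum, each factor, hence p(A), would be
    bounded below. *)
Lemma approx_root A p : linear A -> p != 0 ->
  (forall e : R, 0 < e -> exists x, l2_norm (horner_op p A x) < e * l2_norm x) ->
  exists z, root p z /\ spectrum A z.
Proof.
move=> lA p0 h.
have [r hr] : exists r : seq C, p = lead_coef p *: \prod_(z <- r) ('X - z%:P).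
  by have [r hr] := @closed_field_poly_normal R[i] p; exists r.
have lc0 : lead_coef p != 0 by rewrite lead_coef_eq0.
have n0 : 0 < normc (lead_coef p).
  by rewrite lt_neqAle normc_ge0 andbT eq_sym; apply: contra_neqN lc0 => /eqP/eq0_normc.
apply: contrapT => /forallNP nz.
have [z zr|e [e0 he]] := @prod_bounded_below A r lA.
  move=> zA; apply: (nz z); split=> //.
  by rewrite hr rootZ// root_prod_XsubC.
have [x] := h _ (mulr_gt0 n0 e0); rewrite hr horner_opZ -hr l2_normZE -mulrA ltr_pM2l//.
by rewrite ltNge he.
Qed.

Section Norm.
Variable A : l2 -> l2.
Hypotheses (bA : bounded_op A) (sA : self_adjoint A).
Let lA : linear A := bA.1.

(** p(A) is normal: its adjoint is the conjugate polynomial in A, and the two commute. *)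
Lemma horner_op_conj_norm p x :
  l2_norm (horner_op (map_poly conjc p) A x) = l2_norm (horner_op p A x).
Proof.
apply/eqP; rewrite -(@eqrXn2 _ 2) ?l2_norm_ge0//; apply/eqP/complexI.
rewrite -!inner_norm horner_op_adjoint// [RHS]horner_op_adjoint// horner_opM_comm//.
congr (inner x (horner_op _ A (horner_op _ A x))).
by apply/polyP => i; rewrite !coef_map_id0 ?conjc0 ?conjcK.
Qed.

(* The maximum l of |p(A)|^2 on unit vectors is an approximate eigenvalue of
   p^*(A) p(A), hence p^* p - l has a root in the spectrum of A. *)
Lemma spectrum_norm_attained p (l : R) :
  (forall x, l2_norm (horner_op p A x) ^+ 2 <= l * l2_norm x ^+ 2) ->
  (forall e : R, 0 < e -> exists x, l2_norm x = 1 /\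
     l - e < l2_norm (horner_op p A x) ^+ 2) ->
  map_poly conjc p * p - (l%:C%C)%:P != 0 ->
  exists z, spectrum A z /\ normc p.[z] ^+ 2 = l.
Proof.
move=> h1 h2 q0.
have l0 : 0 <= l.
  have := h1 (l2_delta R 1%g); rewrite l2_norm_delta expr1n mulr1.
  by apply: le_trans; rewrite sqr_ge0.
pose Q x := horner_op (map_poly conjc p) A (horner_op p A x).
have hQ x : l2_norm (Q x) ^+ 2 <= l ^+ 2 * l2_norm x ^+ 2.
  rewrite /Q horner_op_conj_norm (le_trans (h1 _))// [l ^+ 2]expr2 -mulrA.
  by rewrite ler_wpM2l.
have [] := @approx_root A _ lA q0.
  (* For a unit vector, |Q x - l x|^2 <= 2 l (l - |p(A) x|^2), because |Q x| <= l. The gap makes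
     this less than e^2; l + 1 stands in for l, which may be 0. *)
  move=> e e0; have [|x [x1 hx]] := h2 (e ^+ 2 / (2 * (l + 1))).
    by rewrite divr_gt0 ?exprn_gt0// mulr_gt0// ltr_wpDl.
  exists x; rewrite horner_opD horner_opN horner_opM// horner_opC -/(Q x).
  rewrite -ltr_sqr ?nnegrE ?mulr_ge0 ?l2_norm_ge0 ?ltW// x1 mulr1.
  rewrite sqr_norm_sub normc_real ger0_norm// x1 expr1n mulr1.
  have -> : complex.Re (conjc l%:C%C * inner (Q x) x) = l * l2_norm (horner_op p A x) ^+ 2.
    have -> : inner (Q x) x = (l2_norm (horner_op p A x) ^+ 2)%:C%C.
      by rewrite (inner_conj x) -horner_op_adjoint// inner_norm conjc_real.
    by rewrite /=; ring.
  have := hQ x; rewrite x1 expr1n mulr1 => hQx.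
  rewrite (@le_lt_trans _ _ (2 * l * (l - l2_norm (horner_op p A x) ^+ 2)))//; first by lra.
  rewrite (@le_lt_trans _ _ (2 * l * (e ^+ 2 / (2 * (l + 1)))))//.
    by rewrite ler_wpM2l ?mulr_ge0//; lra.
  have l1 : 0 < l + 1 by rewrite ltr_wpDl.
  have -> : 2 * l * (e ^+ 2 / (2 * (l + 1))) = e ^+ 2 * (l / (l + 1)).
    by field; rewrite gt_eqF.
  by rewrite -[ltRHS]mulr1 ltr_pM2l ?exprn_gt0// ltr_pdivrMr// mul1r ltrDl.
move=> z [/rootP hz zA]; exists z; split=> //; apply/complexI.
(* A spectral value is real, so the conjugate polynomial takes the conjugate value there. *)
have cz : conjc z = z.
  by move: (spectrum_real bA sA zA); case: (z) => a b /= ->; rewrite oppr0.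
rewrite -mul_conjc; move: hz; rewrite !hornerE => /eqP; rewrite subr_eq0 => /eqP <-.
rewrite mulrC; congr (_ * _); rewrite -{2}cz.
by rewrite horner_map.
Qed.

(** The number [l] is the square of the operator norm of p(A). *)
Lemma sup_norm p : exists l : R,
  (forall x, l2_norm (horner_op p A x) ^+ 2 <= l * l2_norm x ^+ 2) /\
  (forall e : R, 0 < e -> exists x, l2_norm x = 1 /\
     l - e < l2_norm (horner_op p A x) ^+ 2).
Proof.
have bp := bounded_horner_op p bA; have [M [M0 hM]] := bounded_op_pos bp.
pose E := [set r : R | exists x, l2_norm x = 1 /\ r = l2_norm (horner_op p A x) ^+ 2].
have supE : has_sup E.
  split; first by exists (l2_norm (horner_op p A (l2_delta R 1%g)) ^+ 2),
    (l2_delta R 1%g); rewrite l2_norm_delta.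
  exists (M ^+ 2) => _ [x [x1 ->]]; rewrite ler_sqr ?nnegrE ?l2_norm_ge0 ?(ltW M0)//.
  by rewrite (le_trans (hM x))// x1 mulr1.
exists (sup E); split=> [x|e e0].
  have [->|/l2_norm_gt0 x0] := eqVneq x 0.
    by rewrite (lin0 bp.1) l2_norm0 expr0n mulr0.
  rewrite -ler_pdivrMr ?exprn_gt0//; apply: ub_le_sup; first by case: supE.
  exists ((l2_norm x)^-1%:C%C *: x).
  rewrite (linZ _ _ bp.1) !l2_normZE normc_real ger0_norm ?invr_ge0 ?l2_norm_ge0//.
  by rewrite mulVf ?gt_eqF// exprMn exprVn mulrC.
have [_ [x [x1 ->]] h] := sup_adherent e0 supE.
by exists x.
Qed.

Lemma spectrum_nonempty : exists z, spectrum A z.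
Proof.
have [l [h1 h2]] := sup_norm 'X.
have [] := spectrum_norm_attained h1 h2.
  apply/eqP => /(congr1 (fun q : {poly C} => q`_2)).
  rewrite coef0 coefD coefN coefC subr0 map_polyX coefXM coefX/= => /eqP.
  by rewrite oner_eq0.
by move=> z [hz _]; exists z.
Qed.

(** By [spectrum_norm_attained] the norm of p(A) is the modulus of p at some spectral value, unless
    p^* p is the constant l. In that case every spectral value will do, and one exists by the case p
    = X, where X^2 - l is never the zero polynomial. *)
Lemma spectrum_norm_bound p (e : R) : 0 <= e ->
  (forall z, spectrum A z -> normc p.[z] <= e) ->
  forall x, l2_norm (horner_op p A x) <= e * l2_norm x.
Proof.
move=> e0 hp x; have [l [h1 h2]] := sup_norm p.
suff le : l <= e ^+ 2.
  rewrite -ler_sqr ?nnegrE ?mulr_ge0 ?l2_norm_ge0// exprMn (le_trans (h1 x))//.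
  by rewrite ler_wpM2r ?sqr_ge0.
suff [z [zA <-]] : exists z, spectrum A z /\ normc p.[z] ^+ 2 = l.
  by rewrite ler_sqr ?nnegrE ?normc_ge0// hp.
have [q0|] := eqVneq (map_poly conjc p * p - (l%:C%C)%:P) 0; last first.
  exact: spectrum_norm_attained.
have [z zA] := spectrum_nonempty; exists z; split=> //.
have cz : conjc z = z.
  by move: (spectrum_real bA sA zA); case: (z) => a b /= ->; rewrite oppr0.
move/(congr1 (horner^~ z)): q0; rewrite !hornerE => /eqP; rewrite subr_eq0 => /eqP hz.
apply/complexI; rewrite -mul_conjc -hz mulrC; congr (_ * _); rewrite -{2}cz.
by rewrite horner_map.
Qed.

End Norm.
End Spectrum.

(** * The logarithm of a positive operator *)

Section LogPolynomials.
Variable R : realType.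

Definition log_coef (D : R) k : R := if k == 0%N then ln D else - k%:R^-1.

(* ln X = ln D - sum_(k >= 1) (1 - X / D)^k / k. *)
Definition log_poly (D : R) m : {poly R} :=
  \sum_(0 <= k < m) log_coef D k *: (1 - D^-1 *: 'X) ^+ k.

(** The derivative of ln(1 - t) is -1/(1 - t); adding the first m terms of the geometric series
    leaves -t^m/(1 - t). *)
Lemma is_derive_log_tail m (c : R) : c < 1 ->
  is_derive c 1 (fun t : R => ln (1 - t) + \sum_(0 <= k < m) t ^+ k.+1 / k.+1%:R)
    (- (c ^+ m / (1 - c))).
Proof.
move=> c1; have c0 : 0 < 1 - c by rewrite subr_gt0.
elim: m => [|m IHm].
  have d1 : is_derive c 1 (fun t : R => 1 - t) (- 1).
    by apply: is_derive_eq; rewrite add0r mul1r.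
  have := @is_derive1_comp R (@ln R) (fun t => 1 - t) c _ _ (is_derive1_ln c0) d1.
  rewrite (_ : _ \o _ = fun t : R => ln (1 - t) + \sum_(0 <= k < 0) t ^+ k.+1 / k.+1%:R).
    by rewrite mulrN1 mul1r.
  by apply/funext => t; rewrite big_geq// addr0.
have dX : is_derive c 1 (fun t : R => t ^+ m.+1 / m.+1%:R) (c ^+ m).
  have := is_derive_poly (m.+1%:R^-1 *: 'X^(m.+1) : {poly R}) c.
  rewrite derivZ derivXn/= hornerZ hornerMn hornerXn -[c ^+ m *+ _]mulr_natl mulrA.
  rewrite mulVf// mul1r.
  rewrite (_ : horner _ = fun t => t ^+ m.+1 / m.+1%:R)//.
  by apply/funext => t; rewrite !hornerE mulrC.
have -> : (fun t : R => ln (1 - t) + \sum_(0 <= k < m.+1) t ^+ k.+1 / k.+1%:R) =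
    (fun t : R => ln (1 - t) + \sum_(0 <= k < m) t ^+ k.+1 / k.+1%:R) +
    (fun t : R => t ^+ m.+1 / m.+1%:R).
  by apply/funext => t; rewrite fctE big_nat_recr//= addrA.
have -> : - (c ^+ m.+1 / (1 - c)) = - (c ^+ m / (1 - c)) + c ^+ m.
  by rewrite exprS; field; rewrite gt_eqF.
exact: is_deriveD.
Qed.

(** Mean value theorem: the function vanishes at 0, and on [0, r] its derivative is at most r^m/(1 -
    r) in absolute value. *)
Lemma log_tail_bound m (r t : R) : 0 <= t <= r -> r < 1 ->
  `|ln (1 - t) + \sum_(0 <= k < m) t ^+ k.+1 / k.+1%:R| <= r ^+ m.+1 / (1 - r).
Proof.
move=> /andP[t0 tr] r1; have r0 := le_trans t0 tr.
set phi := fun t : R => ln (1 - t) + \sum_(0 <= k < m) t ^+ k.+1 / k.+1%:R.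
have phi0 : phi 0 = 0.
  rewrite /phi subr0 ln1 add0r big1// => k _.
  by rewrite exprS mul0r mul0r.
have dphi c : c \in `[0, t] -> is_derive c 1 phi (- (c ^+ m / (1 - c))).
  rewrite in_itv/= => /andP[c0 ct]; apply: is_derive_log_tail.
  by rewrite (le_lt_trans ct) ?(le_lt_trans tr).
have dphi' (c : R) : c \in `]0, t[ -> is_derive c 1 phi (- (c ^+ m / (1 - c))).
  by move=> /subset_itv_oo_cc; exact: dphi.
have cphi : {within `[0, t], continuous phi}.
  by apply: derivable_within_continuous => c /dphi[].
rewrite -[X in `|X|]/(phi t); have [c] := MVT_segment t0 dphi' cphi.
rewrite phi0 !subr0 in_itv/= => /andP[c0 ct] ->.
have cr := le_trans ct tr; have c1 := le_lt_trans cr r1.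
have c1' : 0 < 1 - c by rewrite subr_gt0.
have r1' : 0 < 1 - r by rewrite subr_gt0.
have cm : 0 <= c ^+ m / (1 - c) by rewrite mulr_ge0 ?exprn_ge0// invr_ge0 ltW.
rewrite mulNr normrN (ger0_norm (mulr_ge0 cm t0)).
rewrite (_ : r ^+ m.+1 / (1 - r) = r ^+ m / (1 - r) * r); last by rewrite exprSr mulrAC.
apply: ler_pM => //.
apply: ler_pM; rewrite ?exprn_ge0 ?invr_ge0 ?(ltW c1')//.
  by rewrite lerXn2r ?nnegrE.
by rewrite lef_pV2 ?posrE// lerD2l lerN2.
Qed.

Lemma log_poly_approx (D r mu : R) m : 0 < D -> 0 < mu <= D -> 1 - mu / D <= r ->
  r < 1 -> `|(log_poly D m.+1).[mu] - ln mu| <= r ^+ m.+1 / (1 - r).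
Proof.
move=> D0 /andP[mu0 muD] mur r1.
have h : 0 <= 1 - mu / D <= r by rewrite mur subr_ge0 ler_pdivrMr// mul1r muD.
have := log_tail_bound m h r1; rewrite subKr ln_div ?posrE//; move=> tb.
rewrite /log_poly horner_sum big_ltn// big_add1/= hornerZ expr0 hornerC mulr1.
rewrite -normrN (le_trans _ tb)// le_eqVlt; apply/orP; left; apply/eqP.
rewrite (_ : \sum_(0 <= k < m) _ = - \sum_(0 <= k < m) (1 - mu / D) ^+ k.+1 / k.+1%:R).
  by rewrite /log_coef/=; congr `|_|; ring.
rewrite -sumrN; apply: eq_bigr => k _.
rewrite hornerZ horner_exp hornerD hornerN hornerC hornerZ hornerX.
by rewrite /log_coef/= mulNr mulrC [mu / D]mulrC.
Qed.

End LogPolynomials.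

Section LogTrace.
Variables (R : realType) (G : groupType).
Local Notation C := R[i]^o.
Local Notation l2 := (l2 R G).
Local Notation toC := (map_poly (real_complex R)).
Implicit Types (x y : l2) (A S T : l2 -> l2).

(** [adjoint_op] is a choice; evaluation against the deltas shows that an adjoint is unique, so the
    chosen one is T. *)
Lemma adjoint_self T : bounded_op T -> self_adjoint T -> adjoint_op T = T.
Proof.
move=> bT sT; rewrite /adjoint_op.
have [_ hS] := @xgetPex (l2 -> l2) (0 : l2 -> l2)
  [set S | bounded_op S /\ forall x y, inner (T x) y = inner x (S y)]
  (ex_intro _ T (conj bT sT)).
apply/funext => y; apply: l2_eqP => g; apply: (can_inj (@conjcK R)).
by rewrite -!inner_deltal -hS sT.
Qed.

Lemma Re_toC_horner (p : {poly R}) (z : C) : complex.Im z = 0 ->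
  (toC p : {poly C}).[z] = (p.[complex.Re z])%:C%C.
Proof. by case: z => a b /= ->; rewrite -[Complex a 0]/(a%:C%C) horner_map. Qed.

(** [A] stands for the square of r(f), with spectrum in [a, D]. The single ratio [r] bounds 1 - mu/D
    for spectral values mu and also the norm of 1 - A/D, so the scalar and the operator series
    converge at the same rate. *)
Variables (A : l2 -> l2) (a D r : R).
Hypotheses (bA : bounded_op A) (sA : self_adjoint A).
Hypotheses (a0 : 0 < a) (D0 : 0 < D) (r1 : r < 1) (r0 : 0 <= r) (ar : 1 - a / D <= r).
Hypothesis hA : forall x,
  a * l2_norm x ^+ 2 <= complex.Re (inner (A x) x) <= D * l2_norm x ^+ 2.
Hypothesis hN : forall x, l2_norm (x - (D^-1)%:C%C *: A x) <= r * l2_norm x.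
Let lA : linear A := bA.1.

Let cvg_re : (fun n : nat => r ^+ n / (1 - r)) @ \oo --> 0.
Proof.
by rewrite -(mul0r (1 - r)^-1); apply: cvgMl; apply: cvg_expr; rewrite ger0_norm.
Qed.

Lemma log_poly_spectrum n z : spectrum A z ->
  normc ((toC (log_poly D n.+1) : {poly C}).[z] - (ln (complex.Re z))%:C%C) <=
  r ^+ n.+1 / (1 - r).
Proof.
move=> zA; have /andP[az zD] := spectrum_bounds bA sA zA hA.
rewrite Re_toC_horner; last exact: spectrum_real zA.
rewrite -rmorphB (normc_real (_ - _)); apply: log_poly_approx => //.
  by rewrite zD (lt_le_trans a0).
by rewrite (le_trans _ ar)// lerD2l lerN2 ler_pM2r ?invr_gt0.
Qed.

Lemma horner_op_log_poly n x : horner_op (toC (log_poly D n)) A x =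
  \sum_(0 <= k < n) (log_coef D k)%:C%C *: iter k (fun y => y - (D^-1)%:C%C *: A y) x.
Proof.
rewrite /log_poly rmorph_sum horner_op_sum; apply: eq_bigr => k _.
rewrite /= map_polyZ/= horner_opZ rmorphXn/= horner_op_exp//; congr (_ *: _).
congr (iter k _ x); apply/funext => y.
rewrite rmorphB/= map_polyZ/= map_polyX rmorph1 horner_opD horner_opN horner_opZ.
by rewrite horner_opC scale1r horner_opX.
Qed.

(** Existence has to be shown because [functional_calculus] falls back on 0. The witness is the sum
    of the series of ln in powers of 1 - A/D. *)
Lemma log_functional_calculus :
  exists S, is_functional_calculus (fun z : C => (ln (complex.Re z))%:C%C) A S.
Proof.
have lN : linear (fun y => y - (D^-1)%:C%C *: A y).
  by move=> k x y; rewrite lA; apply: l2_eqP => g; rewrite !(l2DE, l2NE, l2ZE); ring.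
have r01 : 0 <= r < 1 by rewrite r0.
have lc k : normc (log_coef D k)%:C%C <= `|ln D| + 1.
  rewrite normc_real /log_coef; case: eqP => [_|/eqP k0]; first by rewrite lerDl.
  rewrite normrN ger0_norm ?invr_ge0// ler_wpDl// invf_le1 ?ltr0n ?lt0n//.
  by rewrite ler1n lt0n.
have [S [bS hS]] := op_series lN r01 hN lc.
exists S; split=> //; exists (fun n => toC (log_poly D n)); split=> e e0.
  have [N hN'] := near_le0 cvg_re e0; exists N.+1 => // -[//|n] /= Nn z zA.
  by rewrite (le_trans (log_poly_spectrum n zA))// hN'// ltnW.
have K0 : 0 < `|ln D| + 1 by rewrite ltr_wpDl.
have [N hN'] := near_le0 cvg_re (divr_gt0 e0 K0); exists N => // n /= Nn x.
rewrite horner_op_log_poly (le_trans (hS n x))// ler_wpM2r ?l2_norm_ge0//.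
by rewrite mulrC -ler_pdivlMr// hN'.
Qed.

(** The chosen [log_op A] is known only through some polynomials [p m]. On the spectrum both [p m]
    and [q] are close to ln, hence to each other, and [spectrum_norm_bound] carries this over to the
    operators. *)
Lemma log_trace n :
  `|complex.Re (vn_trace (log_op A)) -
    complex.Re (horner_op (toC (log_poly D n.+1)) A (l2_delta R 1%g) 1%g)| <=
  r ^+ n.+1 / (1 - r).
Proof.
have : is_functional_calculus (fun z : C => (ln (complex.Re z))%:C%C) A (log_op A).
  exact: xgetPex log_functional_calculus.
move=> [bS [p [hp hpS]]].
set d := l2_delta R 1%g; set q := toC _.
apply/ler_addgt0Pr => e e0; have e2 : 0 < e / 2 by rewrite divr_gt0.
have [N1 _ h1] := hp _ e2; have [N2 _ h2] := hpS _ e2.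
pose m := maxn N1 N2.
have {}h1 := h1 m (leq_maxl _ _); have {}h2 := h2 m (leq_maxr _ _).
rewrite /vn_trace inner_deltar -ReN -ReD (le_trans (Re_normc _))//.
rewrite (le_trans (normc_l2_norm (log_op A d - horner_op q A d) 1%g))//.
have h3 : l2_norm (horner_op (p m - q) A d) <= (e / 2 + r ^+ n.+1 / (1 - r)) * l2_norm d.
  apply: spectrum_norm_bound => //.
    by rewrite addr_ge0 ?(ltW e2)// divr_ge0 ?exprn_ge0// subr_ge0 ltW.
  move=> z zA; rewrite hornerD hornerN.
  set w := (ln (complex.Re z))%:C%C.
  rewrite (_ : _ - _ = ((p m).[z] - w) - (q.[z] - w)); last by ring.
  rewrite (le_trans (normc_triangle _ _))// normc_opp lerD ?h1//.
  exact: log_poly_spectrum.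
have := h2 d; rewrite l2_norm_distC.
move: h3; rewrite horner_opD horner_opN l2_norm_delta !mulr1 => h3 h4.
have -> : log_op A d - horner_op q A d =
    (log_op A d - horner_op (p m) A d) + (horner_op (p m) A d - horner_op q A d).
  by apply: l2_eqP => g; rewrite !(l2DE, l2NE); ring.
rewrite (le_trans (l2_norm_triangle _ _))// (le_trans (lerD h4 h3))//.
lra.
Qed.

End LogTrace.

(** * Finite sections *)

Section RightConvolution.
Variables (G : groupType) (f : group_ring G).

(* On formal sums this is u |-> u f^*, so that X_f consists of the classes mod Z
   of the real u with tau f u integral, and r(f) is the restriction to l2. *)
Definition tau (K : pzRingType) (u : G -> K) (h : G) : K :=
  \sum_(g <- finsupp f) (f g)%:~R * u (h * g)%g.

(** With p = h g the operator acquires the kernel f(h^-1 p), the form of the entries of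
    [section_mx]. *)
Lemma tau_supported (K : pzRingType) (u : G -> K) (A : {fset G}) h :
  (forall g, g \notin A -> u g = 0) ->
  tau u h = \sum_(p <- A) (f (h^-1 * p)%g)%:~R * u p.
Proof.
move=> uA; pose S := (finsupp f `|` [fset (h^-1 * p)%g | p in A])%fset.
transitivity (\sum_(g <- S) (f g)%:~R * u (h * g)%g).
  apply: big_fset_incl; first exact: fsubsetUl.
  by move=> g _ gf; rewrite fsfun_dflt// mul0r.
transitivity (\sum_(g <- [fset (h^-1 * p)%g | p in A]%fset) (f g)%:~R * u (h * g)%g).
  apply/esym/big_fset_incl; first exact: fsubsetUr.
  move=> g _ gA; rewrite uA ?mulr0//; apply: contra gA => hgA.
  by apply/imfsetP; exists (h * g)%g; rewrite ?mulKg.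
rewrite big_imfset/=; last by move=> ? ? _ _; exact: mulgI.
by apply: eq_bigr => p _; rewrite mulVKg.
Qed.

Lemma tau_translate (K : pzRingType) (u : G -> K) a h :
  tau (fun g => u (a * g)%g) h = tau u (a * h)%g.
Proof. by apply: eq_bigr => g _; rewrite mulgA. Qed.

Lemma iter_tau_translate (K : pzRingType) (u : G -> K) k a h :
  iter k (@tau K) (fun g => u (a * g)%g) h = iter k (@tau K) u (a * h)%g.
Proof.
elim: k h => [//|k IHk] h /=; rewrite -tau_translate; apply: eq_bigr => g _.
by rewrite IHk.
Qed.

Lemma tauB (K : pzRingType) (u v : G -> K) h :
  tau (fun g => u g - v g) h = tau u h - tau v h.
Proof. by rewrite /tau -sumrB; apply: eq_bigr => g _; rewrite mulrBr. Qed.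

Lemma tau_morph (K L : pzRingType) (phi : {rmorphism K -> L}) (u : G -> K) h :
  tau (fun g => phi (u g)) h = phi (tau u h).
Proof.
by rewrite /tau rmorph_sum; apply: eq_bigr => g _; rewrite rmorphM rmorph_int.
Qed.

Variable R : realType.

(** The l1-norm of f, which bounds [tau f] in the sup norm and the row sums of all sections. *)
Definition gr_norm : R := \sum_(g <- finsupp f) `|(f g)%:~R|.

Lemma gr_norm_ge0 : 0 <= gr_norm.
Proof. exact: sumr_ge0. Qed.

Lemma fset_sum_gr_norm (A : {fset G}) : \sum_(g <- A) `|(f g)%:~R : R| <= gr_norm.
Proof.
apply: (@le_trans _ _ (\sum_(g <- (finsupp f `|` A)%fset) `|(f g)%:~R : R|)).
  by apply: ler_fset_sum => //; exact: fsubsetUr.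
rewrite /gr_norm (big_fset_incl _ (fsubsetUl (finsupp f) A))// => g _ gf.
by rewrite fsfun_dflt// normr0.
Qed.

Lemma tau_bound (u : G -> R) (M : R) h : (forall g, `|u (h * g)%g| <= M) ->
  `|tau u h| <= gr_norm * M.
Proof.
move=> uM; rewrite (le_trans (ler_norm_sum _ _ _))// /gr_norm mulr_suml.
by apply: ler_sum => g _; rewrite normrM ler_wpM2l.
Qed.

End RightConvolution.
Arguments tau {G} f {K} u h.
Arguments gr_norm {G} f R.

Section FiniteSections.
Variables (G : groupType) (f : group_ring G) (F : {fset G}).

Definition fset_enum (i : 'I_#|`F|) : G := nth 1%g (enum_fset F) i.
Local Notation s := fset_enum.

Lemma fset_enum_in i : s i \in F.
Proof. by rewrite mem_nth. Qed.

Lemma fset_enum_inj : injective s.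
Proof.
move=> i j /eqP; rewrite nth_uniq// => [/eqP/val_inj//|].
exact: fset_uniq.
Qed.

Lemma fset_enum_onto g : g \in F -> exists i, g = s i.
Proof.
move=> gF; have h : (index g (enum_fset F) < #|`F|)%N by rewrite index_mem.
by exists (Ordinal h); rewrite /fset_enum/= nth_index.
Qed.

Lemma big_fset_enum (V : nmodType) (u : G -> V) :
  \sum_(g <- F) u g = \sum_i u (s i).
Proof. by rewrite (big_nth 1%g) big_mkord. Qed.

(* The compression of r(f) to l2(F). *)
Definition section_mx : 'M[int]_#|`F| := \matrix_(i, j) f ((s i)^-1 * s j)%g.

Definition extend (V : nmodType) (v : 'cV[V]_#|`F|) (g : G) : V :=
  \sum_i v i 0 *+ (s i == g).

Lemma extend_in (V : nmodType) (v : 'cV[V]_#|`F|) i : extend v (s i) = v i 0.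
Proof.
rewrite /extend (bigD1 i)//= eqxx mulr1n big1 ?addr0// => j ji.
by rewrite (inj_eq fset_enum_inj) (negbTE ji) mulr0n.
Qed.

Lemma extend_out (V : nmodType) (v : 'cV[V]_#|`F|) g : g \notin F -> extend v g = 0.
Proof.
move=> gF; rewrite /extend big1// => i _; case: eqP => [ig|]; last by rewrite mulr0n.
by case/negP: gF; rewrite -ig fset_enum_in.
Qed.

Lemma tau_extend (K : pzRingType) (v : 'cV[K]_#|`F|) i :
  tau f (extend v) (s i) = (map_mx intr section_mx *m v) i 0.
Proof.
rewrite (tau_supported _ _ (@extend_out _ v)) big_fset_enum mxE.
by apply: eq_bigr => j _; rewrite extend_in !mxE.
Qed.

End FiniteSections.

Section Coercivity.
Variables (R : realType) (G : groupType) (f : group_ring G).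
Local Notation C := R[i]^o.
Local Notation T := (r_op R f).
Hypothesis posT : positive_op T.

Lemma r_op_tau (x : l2 R G) h : T x h = tau f (l2_fun x) h.
Proof. exact: r_opE. Qed.

Let sT : self_adjoint T. Proof. by case: posT. Qed.
Let bT : bounded_op T. Proof. by case: posT => -[]. Qed.

(** Positivity is only a strict inequality for each vector; uniformity comes from the bounded
    inverse S. With M a bound of S, expanding 0 <= (T y, y) at y = x - M^-1 S x gives (T x, x) >= 2
    M^-1 |x|^2 - M^-2 (x, S x), and (x, S x) <= M |x|^2. *)
Lemma r_op_bounded_below : exists M : R, 0 < M /\
  (forall x : l2 R G, l2_norm x <= M * l2_norm (T x)) /\
  (forall x : l2 R G, M^-1 * l2_norm x ^+ 2 <= complex.Re (inner (T x) x)).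
Proof.
have [[_ [S [bS S1 S2]]] _ pT] := posT; have [M [M0 hM]] := bounded_op_pos bS.
exists M; split=> //; split=> x; first by rewrite -{1}(S1 x).
have pT' (y : l2 R G) : 0 <= complex.Re (inner (T y) y).
  have [->|/pT] := eqVneq y 0; first by rewrite inner0r.
  by rewrite ltcE => /andP[_ /ltW].
have := pT' (x - (M^-1)%:C%C *: S x).
have TS y : T (S y) = y := S2 y.
rewrite (linB _ _ bT.1) (linZ _ _ bT.1) TS innerBl !innerBr !innerZl !innerZr.
rewrite (sT x (S x)) TS inner_norm conjc_real.
have := Re_normc (inner x (S x)); have := cauchy_schwarz x (S x).
have := hM x; have := l2_norm_ge0 x.
case: (inner (T x) x) => a b; case: (inner x (S x)) => c d /= n0 h1 h2 h3 h4.
have h5 : c <= M * l2_norm x ^+ 2.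
  rewrite (le_trans (ler_norm c))// (le_trans h3)// (le_trans h2)//.
  by rewrite mulrC expr2 mulrA ler_wpM2r.
have h6 : M^-1 * (M^-1 * c) <= M^-1 * l2_norm x ^+ 2.
  apply: ler_wpM2l; first by rewrite invr_ge0 ltW.
  by rewrite mulrC ler_pdivrMr// mulrC.
by move: h4 h6; rewrite !(mul0r, mulr0, subr0, addr0, oppr0, expr2); lra.
Qed.

(** Self-adjointness of r(f) read off the matrix coefficients at g and 1, integers being equal to
    their conjugates. *)
Lemma group_ring_symmetric g : f g^-1%g = f g.
Proof.
have h (a b : G) : T (l2_delta R a) b = (f (b^-1 * a)%g)%:~R.
  rewrite r_op_tau (@tau_supported _ _ _ _ [fset a]%fset).
    by rewrite big_seq_fset1 /= /delta eqxx mulr1.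
  by move=> c; rewrite inE /= /delta => /negbTE->.
have := sT (l2_delta R g) (l2_delta R 1%g).
rewrite inner_deltar inner_deltal !h invg1 mul1g mulg1.
rewrite (_ : conjc _ = (f g^-1%g)%:~R); last first.
  by rewrite -[LHS](congr1 conjc (rmorph_int (real_complex R) _)) conjc_real rmorph_int.
by move=> /intr_inj.
Qed.

Variable F : {fset G}.
Local Notation B := (section_mx f F).
Local Notation s := (@fset_enum G F).

Lemma section_mx_sym : B^T = B.
Proof.
by apply/matrixP => i j; rewrite !mxE -group_ring_symmetric invgM invgK.
Qed.

(** The bound is tested on the vector of l2 that is v on F and 0 elsewhere; v is complex so that
    eigenvectors are allowed. *)
Lemma section_mx_coercive (M : R) (v : 'cV[C]_#|`F|) :
  (forall x : l2 R G, M^-1 * l2_norm x ^+ 2 <= complex.Re (inner (T x) x)) ->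
  M^-1 * \sum_i normc (v i 0) ^+ 2 <=
  complex.Re (\sum_i (map_mx intr B *m v) i 0 * conjc (v i 0)).
Proof.
pose x : l2 R G := \sum_i v i 0 *: l2_delta R (s i).
have xE g : x g = extend v g.
  rewrite /x /extend; elim/big_rec2: _ => [//|i a b _ <-].
  rewrite l2DE l2ZE /= /delta eq_sym; congr (_ + _).
  by case: eqP => _; rewrite ?mulr1 ?mulr0.
have inx y : inner y x = \sum_i y (s i) * conjc (v i 0).
  rewrite /x; elim/big_rec2: _ => [|i a b _ <-]; first by rewrite inner0r.
  by rewrite innerDr innerZr inner_deltar mulrC.
move=> /(_ x); rewrite inx.
have -> : l2_norm x ^+ 2 = \sum_i normc (v i 0) ^+ 2.
  apply: complexI; rewrite -inner_norm inx rmorph_sum; apply: eq_bigr => i _.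
  by rewrite xE extend_in mul_conjc.
congr (_ <= complex.Re _); apply: eq_bigr => i _; congr (_ * _).
rewrite r_op_tau (_ : l2_fun x = extend v) ?tau_extend//.
by apply/funext => g; exact: xE.
Qed.

End Coercivity.

Section Eigenvalues.
Variables (R : realType) (G : groupType) (f : group_ring G).
Local Notation C := R[i]^o.
Local Notation T := (r_op R f).
Hypothesis posT : positive_op T.
Variables (F : {fset G}) (M : R).
Hypothesis coercive : forall x : l2 R G,
  M^-1 * l2_norm x ^+ 2 <= complex.Re (inner (T x) x).
Local Notation B := (section_mx f F).
Local Notation n := (#|`F|).

Lemma diag_mx_exp (K : comNzRingType) m (d : 'rV[K]_m) k :
  diag_mx d ^+ k = diag_mx (map_mx (fun x => x ^+ k) d).
Proof.
elim: k => [|k IHk].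
  rewrite expr0; apply/matrixP => i j; rewrite !mxE expr0 //.
rewrite exprS IHk -mulmxE; apply/matrixP => i j; rewrite mul_diag_mx !mxE.
by case: eqP => [->|_]; rewrite ?mulr1n ?mulr0n ?mulr0// exprS.
Qed.

Lemma diagonalized (K : fieldType) m (A P : 'M[K]_m) (d : 'rV[K]_m) :
  P \in unitmx -> A = invmx P *m diag_mx d *m P ->
  [/\ P *m A = diag_mx d *m P, \det A = \prod_i d 0 i &
      forall k, \tr (A ^+ k) = \sum_i d 0 i ^+ k].
Proof.
move=> Pu AE; have PA : P *m A = diag_mx d *m P.
  by rewrite AE -!mulmxA mulKVmx.
split=> // [|k].
  rewrite AE !det_mulmx mulrAC det_inv mulVr; first by rewrite mul1r det_diag.
  by rewrite -unitmxE.
have PAk : P *m A ^+ k = diag_mx d ^+ k *m P.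
  elim: k => [|k IHk]; first by rewrite !expr0 mulmx1 mul1mx.
  by rewrite !exprS -!mulmxE mulmxA PA -mulmxA IHk mulmxA.
rewrite -[A ^+ k](mulKmx Pu) PAk mxtrace_mulC mulmxK// diag_mx_exp mxtrace_diag.
by apply: eq_bigr => i _; rewrite mxE.
Qed.

Lemma section_mx_row_sum (i : 'I_n) :
  \sum_j `|(B i j)%:~R| <= gr_norm f R.
Proof.
under eq_bigr do rewrite mxE.
rewrite -(big_fset_enum F (fun p => `|(f ((fset_enum i)^-1 * p)%g)%:~R|)).
have := fset_sum_gr_norm f R [fset ((fset_enum i)^-1 * p)%g | p in F]%fset.
by rewrite big_imfset//= => ? ? _ _; exact: mulgI.
Qed.

(** The section is real symmetric, so the spectral theorem applies. Coercivity on an eigenvector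
    bounds its eigenvalue from below, row sums bound it from above; neither bound depends on F. *)
Lemma section_mx_eigen : exists l : 'I_n -> R,
  [/\ forall i, M^-1 <= l i <= gr_norm f R,
      (\det B)%:~R = \prod_i l i &
      forall k, (\tr (B ^+ k))%:~R = \sum_i l i ^+ k].
Proof.
pose A : 'M[R[i]]_n := map_mx intr B.
have hA : A \is hermsymmx.
  apply/is_hermitianmxP; rewrite expr0 scale1r; apply/matrixP => i j.
  by rewrite !mxE rmorph_int -(group_ring_symmetric posT) invgM invgK.
have := hermitian_spectral_diag_real hA.
have := hA => /hermitian_normalmx/orthomx_spectralP.
have := spectral_unit A.
move: (spectralmx A) (spectral_diag A) => P sp Pu AE /mxOverP spR.
pose l i := complex.Re (sp 0 i).
have spE i : sp 0 i = (l i)%:C%C by rewrite RRe_real// spR.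
have [PA det_A tr_A] := diagonalized Pu AE.
have intC (z : int) : (z%:~R : R)%:C%C = z%:~R :> R[i].
  exact: (rmorph_int (real_complex R)).
exists l; split.
(* The rows of P are left eigenvectors; by symmetry of the section their transposes are
   eigenvectors. *)
- move=> i; pose v : 'cV[C]_n := (row i P)^T.
  have Av : (map_mx intr B : 'M[C]_n) *m v = sp 0 i *: v.
    rewrite -[map_mx _ _]trmxK -trmx_mul map_trmx (section_mx_sym posT) -/A.
    by rewrite -row_mul PA row_mul row_diag_mx -scalemxAl -rowE linearZ.
  have v0 : 0 < \sum_j normc (v j 0) ^+ 2.
    rewrite lt_neqAle sumr_ge0 ?andbT; last by move=> j _; rewrite sqr_ge0.
    apply/eqP => /esym/psumr_eq0P h.
    have row0 : row i P = 0.
      apply/rowP => j; rewrite [RHS]mxE; apply/eq0_normc/eqP.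
      by rewrite -sqrf_eq0 -[row i P]trmxK mxE h// => k _; rewrite sqr_ge0.
    have : row i (1%:M : 'M[R[i]]_n) = 0.
      by rewrite -(mulmxV Pu) row_mul row0 mul0mx.
    by move=> /rowP/(_ i); rewrite !mxE eqxx => /eqP; rewrite oner_eq0.
  apply/andP; split.
    have := section_mx_coercive v coercive; rewrite Av.
    rewrite (_ : complex.Re _ = l i * \sum_j normc (v j 0) ^+ 2); first by rewrite ler_pM2r.
    rewrite Re_sum mulr_sumr; apply: eq_bigr => j _.
    by rewrite mxE spE -mulrA mul_conjc -rmorphM.
  (* At a coordinate of maximal modulus the eigenvalue equation is dominated by a row sum. *)
  have [j0 _ hj0] : exists2 j0, true & forall j, normc (v j 0) <= normc (v j0 0).
    have [j0 hj0] : exists j0 : 'I_n, true by exists i.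
    exists [arg max_(j > j0) normc (v j 0)]%O => //.
    by case: arg_maxP => // k _ hk j; exact: hk.
  have vj0 : 0 < normc (v j0 0).
    rewrite lt_neqAle normc_ge0 andbT eq_sym; apply: contraTneq v0 => h0.
    rewrite -leNgt sumr_le0// => j _; have := hj0 j; rewrite h0 => /le0_normc ->.
    by rewrite normc0 expr0n.
  apply: (le_trans (ler_norm _)); rewrite -(ler_pM2r vj0) -normc_real -spE -normcM.
  have /matrixP/(_ j0 0) := Av; rewrite [RHS]mxE => <-; rewrite mxE.
  rewrite (le_trans (normc_sum _ _ _))//.
  rewrite (@le_trans _ _ (\sum_j `|(B j0 j)%:~R : R| * normc (v j0 0)))//.
    apply: ler_sum => j _; rewrite normcM ler_pM ?normc_ge0//.
    by rewrite mxE -intC normc_real.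
  by rewrite -mulr_suml ler_wpM2r ?normc_ge0// section_mx_row_sum.
- apply: complexI; rewrite intC [RHS]rmorph_prod -det_map_mx -/A det_A.
  by apply: eq_bigr => i _; exact: spE.
- move=> k; have mapX : A ^+ k = map_mx intr (B ^+ k).
    elim: k => [|k IHk]; first by rewrite !expr0 map_mx1.
    by rewrite !exprS IHk -!mulmxE map_mxM.
  apply: complexI; rewrite intC [RHS]rmorph_sum.
  transitivity (\tr (A ^+ k)).
    by rewrite mapX trace_map_mx.
  by rewrite tr_A; apply: eq_bigr => i _; rewrite spE rmorphXn.
Qed.

End Eigenvalues.

(** * Boundaries and traces of powers of the sections *)

Section Boundary.
Variable G : groupType.
Implicit Types F K : {fset G}.

Definition boundary F K : {fset G} := (fset_mulg F K `\` F)%fset.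

Lemma mem_fset_mulg F K g k : g \in F -> k \in K -> (g * k)%g \in fset_mulg F K.
Proof. by move=> gF kK; apply/imfset2P; exists g => //; exists k. Qed.

Lemma fset_mulgS F K K' : (K `<=` K')%fset -> (fset_mulg F K `<=` fset_mulg F K')%fset.
Proof.
move=> /fsubsetP KK'; apply/fsubsetP => _ /imfset2P[g gF [k kK ->]].
by rewrite mem_fset_mulg// KK'.
Qed.

Lemma boundary_sub F K K' : (K `<=` K')%fset -> (boundary F K `<=` boundary F K')%fset.
Proof. by move=> KK'; rewrite fsetSD// fset_mulgS. Qed.

Lemma card_boundary_le F K K' : (K `<=` K')%fset ->
  (#|`boundary F K| <= #|`boundary F K'|)%N.
Proof. by move=> KK'; rewrite fsubset_leq_card// boundary_sub. Qed.

Lemma card_enum_mem F (X : {fset G}) p :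
  (\sum_(i < #|`F|) ((fset_enum i * p)%g \in X) <= #|`X|)%N.
Proof.
rewrite -big_mkcond/= sum1_card cardE -(size_map (fun i => (fset_enum i * p)%g)).
apply: uniq_leq_size.
  by rewrite map_inj_uniq ?enum_uniq// => i j /mulIg/fset_enum_inj.
by move=> x hx; move/mapP: hx => [j]; rewrite mem_enum => jX ->.
Qed.

(** A translate [fset_enum i * p] that leaves F lies in the boundary, and for fixed p the translates
    are distinct. *)
Lemma card_near_boundary F K :
  (\sum_(i < #|`F|) ~~ all (fun p => (fset_enum i * p)%g \in F) K <=
   #|`K| * #|`boundary F K|)%N.
Proof.
apply: (@leq_trans (\sum_(i < #|`F|) \sum_(p <- K) ((fset_enum i * p)%g \in boundary F K))).
  apply: leq_sum => i _; case: allPn => //= -[p pK ipF].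
  rewrite (big_fsetD1 p)//= inE ipF mem_fset_mulg//.
  by rewrite mem_nth.
rewrite exchange_big/= big_seq.
apply: (@leq_trans (\sum_(p <- K | p \in K) #|`boundary F K|)).
  by apply: leq_sum => p _; exact: card_enum_mem.
by rewrite -big_seq big_const_seq count_predT iter_addn_0 mulnC.
Qed.

End Boundary.

Section Traces.
Variables (R : realType) (G : groupType) (f : group_ring G).
Local Notation C := R[i]^o.
Local Notation T := (r_op R f).

Definition delta1 (g : G) : int := (g == 1%g)%:R.

(** The trace of r(f)^k, an integer. *)
Definition moment k : int := iter k (tau f) delta1 1%g.

(** All products of at most k elements of the support of f: the k-th iterate of [tau f] at h sees
    only the points of h [reach k]. *)
Fixpoint reach k : {fset G} :=
  (1%g |` if k is k'.+1 then fset_mulg (finsupp f) (reach k') else fset0)%fset.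

Lemma reach1 k : 1%g \in reach k.
Proof. by case: k => [|k]; rewrite /= !inE eqxx. Qed.

(** As long as h [reach k] stays inside F, the truncation to F is never noticed. *)
Lemma section_mx_exp_tau (F : {fset G}) (v : 'cV[int]_#|`F|) k i :
  all (fun p => (fset_enum i * p)%g \in F) (reach k) ->
  (section_mx f F ^+ k *m v) i 0 = iter k (tau f) (extend v) (fset_enum i).
Proof.
elim: k i => [|k IHk] i; first by rewrite expr0 mul1mx [RHS]extend_in.
move=> /allP h; rewrite exprS -mulmxE -mulmxA iterS.
have BE : section_mx f F = map_mx intr (section_mx f F).
  by apply/matrixP => a b; rewrite !mxE intz.
rewrite [X in (X *m (_ *m _)) i 0]BE -tau_extend.
change (\sum_(g <- finsupp f) (f g)%:~R *
    extend (section_mx f F ^+ k *m v) (fset_enum i * g)%g =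
  \sum_(g <- finsupp f) (f g)%:~R * iter k (tau f) (extend v) (fset_enum i * g)%g).
rewrite big_seq [RHS]big_seq; apply: eq_bigr => g gf.
have igF : (fset_enum i * g)%g \in F.
  apply: h; rewrite !inE; apply/orP; right.
  by rewrite -[g]mulg1 mem_fset_mulg// reach1.
have [j ij] := fset_enum_onto igF; rewrite ij extend_in IHk//.
apply/allP => p pk; rewrite -ij -mulgA; apply: h.
by rewrite !inE; apply/orP; right; rewrite mem_fset_mulg.
Qed.

Lemma section_mx_exp_diag (F : {fset G}) k i :
  all (fun p => (fset_enum i * p)%g \in F) (reach k) ->
  (section_mx f F ^+ k) i i = moment k.
Proof.
move=> h; have -> : (section_mx f F ^+ k) i i =
    (section_mx f F ^+ k *m (delta_mx i 0 : 'cV_#|`F|)) i 0.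
  by rewrite -colE mxE.
rewrite section_mx_exp_tau// /moment -(mulVg (fset_enum i)) -iter_tau_translate.
congr (iter k _ _ _); apply/funext => g.
have [[j ->]|gF] : (exists j, g = @fset_enum _ F j) \/ g \notin F.
  by have [/fset_enum_onto|] := boolP (g \in F); [left|right].
  rewrite extend_in mxE eqxx andbT /delta1 -(inj_eq (mulgI (fset_enum i))) mulVKg mulg1.
  by rewrite (inj_eq (@fset_enum_inj _ F)) eq_sym.
rewrite extend_out// /delta1 -(inj_eq (mulgI (fset_enum i))) mulVKg mulg1.
by case: eqP => // gi; move: gF; rewrite gi fset_enum_in.
Qed.

Lemma section_mx_exp_bound (F : {fset G}) k i j :
  `|((section_mx f F ^+ k) i j)%:~R : R| <= gr_norm f R ^+ k.
Proof.
elim: k i j => [|k IHk] i j.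
  rewrite !expr0 mxE; case: (i == j); rewrite ?mulr1n ?mulr0n.
    by rewrite normr1.
  by rewrite mulr0z normr0 ler01.
rewrite exprS -mulmxE mxE rmorph_sum (le_trans (ler_norm_sum _ _ _))//.
apply: (@le_trans _ _ (\sum_l `|(section_mx f F i l)%:~R| * gr_norm f R ^+ k)).
  by apply: ler_sum => l _; rewrite rmorphM normrM ler_wpM2l// IHk.
by rewrite -mulr_suml exprS ler_wpM2r ?exprn_ge0 ?gr_norm_ge0// section_mx_row_sum.
Qed.

(** Away from the boundary every diagonal entry of the power equals the moment, by translation
    invariance; each of the few remaining entries contributes at most [c0]. *)
Lemma trace_moment k : exists (K : {fset G}) (c : R), 0 <= c /\ forall F : {fset G},
  `|(\tr (section_mx f F ^+ k))%:~R - #|`F|%:R * (moment k)%:~R| <=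
  c * #|`boundary F K|%:R.
Proof.
pose c0 : R := gr_norm f R ^+ k + `|(moment k)%:~R|.
have c00 : 0 <= c0 by rewrite addr_ge0 ?exprn_ge0 ?gr_norm_ge0.
exists (reach k), (c0 * #|`reach k|%:R); split=> [|F]; first by rewrite mulr_ge0.
rewrite /mxtrace rmorph_sum mulr_natl -[X in _ *+ X]card_ord -sumr_const -sumrB.
rewrite (le_trans (ler_norm_sum _ _ _))//.
apply: (@le_trans _ _ (\sum_(i < #|`F|)
    c0 * (~~ all (fun p => (fset_enum i * p)%g \in F) (reach k))%:R)).
  apply: ler_sum => i _; case: allP => [/allP h|_] /=.
    by rewrite section_mx_exp_diag// subrr normr0 mulr0.
  rewrite mulr1 (le_trans (ler_normB _ _))// lerD2r; exact: section_mx_exp_bound.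
by rewrite -mulr_sumr -mulrA ler_wpM2l// -natr_sum -natrM ler_nat card_near_boundary.
Qed.

(** Only even powers occur because the determinant is defined by the logarithm of T T^*, here the
    square of T. *)
Lemma poly_trace_moment (q : {poly R}) : exists (K : {fset G}) (c : R), 0 <= c /\
  forall F : {fset G},
  `|\sum_(k < size q) q`_k * (\tr (section_mx f F ^+ (2 * k)))%:~R -
    #|`F|%:R * \sum_(k < size q) q`_k * (moment (2 * k))%:~R| <= c * #|`boundary F K|%:R.
Proof.
elim: (size q) => [|n [K [c [c0 hK]]]].
  by exists fset0, 0; split=> // F; rewrite !big_ord0 mulr0 subr0 normr0 mul0r.
have [K' [c' [c'0 hK']]] := trace_moment (2 * n).
exists (K `|` K')%fset, (c + `|q`_n| * c'); split=> [|F].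
  by rewrite addr_ge0 ?mulr_ge0.
rewrite !big_ord_recr/= mulrDr opprD addrACA (le_trans (ler_normD _ _))// mulrDl lerD//.
  by rewrite (le_trans (hK F))// ler_wpM2l// ler_nat card_boundary_le// fsubsetUl.
rewrite mulrCA -mulrBr normrM -mulrA ler_wpM2l// (le_trans (hK' F))// ler_wpM2l//.
by rewrite ler_nat card_boundary_le// fsubsetUr.
Qed.

Lemma iter_r_op_delta j g :
  iter j T (l2_delta R 1%g) g = (iter j (tau f) delta1 g)%:~R.
Proof.
elim: j g => [|j IHj] g; first by rewrite /= /delta /delta1; case: (g == 1%g).
rewrite !iterS r_op_tau -(tau_morph f (intr : {rmorphism int -> C})).
by apply: eq_bigr => h _; rewrite IHj.
Qed.

Lemma horner_op_moment (q : {poly R}) :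
  complex.Re (horner_op (map_poly (real_complex R) q) (T \o T) (l2_delta R 1%g) 1%g) =
  \sum_(k < size q) q`_k * (moment (2 * k))%:~R.
Proof.
rewrite (@horner_opE _ _ (size q)) ?size_map_poly//.
have sumE (s : seq 'I_(size q)) (F : 'I_(size q) -> l2 R G) g :
    (\sum_(i <- s) F i) g = \sum_(i <- s) F i g.
  by elim/big_rec2: _ => [//|i a b _ <-].
rewrite sumE Re_sum; apply: eq_bigr => i _; rewrite l2ZE coef_map/=.
have -> : iter i (T \o T) (l2_delta R 1%g) = iter (2 * i) T (l2_delta R 1%g).
  elim: (i : nat) => [//|k IHk]; rewrite iterS IHk mulnS !iterD//.
rewrite iter_r_op_delta -/(moment _) -(rmorph_int (real_complex R)).
by rewrite -rmorphM.
Qed.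

End Traces.

(** * Asymptotics of the determinants of the sections *)

Section DetAsymptotics.
Variables (R : realType) (G : groupType) (f : group_ring G).
Local Notation C := R[i]^o.
Local Notation T := (r_op R f).
Hypothesis posT : positive_op T.
Implicit Types F K : {fset G}.

Lemma ln_prod_pos (n : nat) (l : 'I_n -> R) : (forall i, 0 < l i) ->
  0 < \prod_i l i /\ ln (\prod_i l i) = \sum_i ln (l i).
Proof.
move=> l0; elim/big_rec2: _ => [|i x y _ [x0 xE]]; first by rewrite ln1.
by rewrite mulr_gt0// lnM ?posrE// xE.
Qed.

Lemma det_section_gt0 F : 0 < \det (section_mx f F).
Proof.
have [M [M0 [_ cM]]] := r_op_bounded_below posT.
have [l [hl dl _]] := section_mx_eigen posT F cM.
have l0 i : 0 < l i by case/andP: (hl i) => h _; rewrite (lt_le_trans _ h)// invr_gt0.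
by have [h _] := ln_prod_pos l0; rewrite -dl ltr0z in h.
Qed.

(* On a common interval containing the squares of the spectra of T and of its
   sections, ln is uniformly close to a polynomial, and the traces of the powers
   of the sections agree with the moments of T up to boundary terms. *)
Lemma det_asymptotics (e : R) : 0 < e -> exists K (c : R), 0 <= c /\
  forall F, `|ln (\det (section_mx f F))%:~R - #|`F|%:R * ln (FK_det T)| <=
    e * #|`F|%:R + c * #|`boundary F K|%:R.
Proof.
move=> e0.
have bT : bounded_op T by case: posT => -[].
have sT : self_adjoint T by case: posT.
have [M [M0 [bbM cM]]] := r_op_bounded_below posT.
have [N [N0 hN]] := bounded_op_pos bT.
pose C0 := gr_norm f R; have C00 : 0 <= C0 := gr_norm_ge0 f R.
(* The operator bounds for T and the eigenvalue bounds for its sections are [1/M, N] and [1/M, C0];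
   [a, D] contains the squares of both intervals. *)
pose a := M^-1 ^+ 2; pose D := (N + C0) ^+ 2.
have a0 : 0 < a by rewrite exprn_gt0 ?invr_gt0.
have NC : 0 < N + C0 by rewrite ltr_wpDr.
have D0 : 0 < D by rewrite exprn_gt0.
pose A := T \o T.
have bA : bounded_op A by exact: bounded_op_comp.
have sA : self_adjoint A by move=> x y; rewrite /A/= !sT.
have AE x : inner (A x) x = (l2_norm (T x) ^+ 2)%:C%C by rewrite /A/= sT inner_norm.
have low x : a * l2_norm x ^+ 2 <= l2_norm (T x) ^+ 2.
  rewrite -exprMn ler_sqr ?nnegrE ?mulr_ge0 ?invr_ge0 ?l2_norm_ge0 ?(ltW M0)//.
  by rewrite mulrC ler_pdivrMr// mulrC.
have up x : l2_norm (T x) ^+ 2 <= D * l2_norm x ^+ 2.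
  rewrite -exprMn ler_sqr ?nnegrE ?mulr_ge0 ?l2_norm_ge0 ?(ltW NC)//.
  by rewrite (le_trans (hN x))// ler_wpM2r ?l2_norm_ge0// lerDl.
have hA x : a * l2_norm x ^+ 2 <= complex.Re (inner (A x) x) <= D * l2_norm x ^+ 2.
  by rewrite AE/= low up.
have aD : a <= D.
  have := le_trans (low (l2_delta R 1%g)) (up (l2_delta R 1%g)).
  by rewrite l2_norm_delta expr1n !mulr1.
(* |A x|^2 <= D |T x|^2 and |T x|^2 >= a |x|^2 give |x - A x / D|^2 <= (1 - a/D) |x|^2. The square
   root is also at least 1 - a/D, as the scalar estimate requires. *)
pose r := Num.sqrt (1 - a / D).
have t01 : 0 <= 1 - a / D < 1.
  by rewrite subr_ge0 ler_pdivrMr// mul1r aD ltrBlDr ltrDl divr_gt0.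
have [t0 t1] := andP t01.
have r0 : 0 <= r by exact: sqrtr_ge0.
have r1 : r < 1 by rewrite -[ltRHS]sqrtr1 ltr_sqrt.
have r2 : r ^+ 2 = 1 - a / D by rewrite sqr_sqrtr.
have ar : 1 - a / D <= r by rewrite -r2 expr2 ler_piMl// ltW.
have hNr x : l2_norm (x - (D^-1)%:C%C *: A x) <= r * l2_norm x.
  rewrite -ler_sqr ?nnegrE ?mulr_ge0 ?l2_norm_ge0// sqr_norm_sub normc_real exprMn r2.
  have -> : complex.Re (conjc (D^-1)%:C%C * inner x (A x)) = D^-1 * l2_norm (T x) ^+ 2.
    by rewrite -sA AE /=; ring.
  rewrite real_normK ?num_real//.
  have h1 := up (T x); have h2 := low x.
  have h3 : D^-1 ^+ 2 * l2_norm (A x) ^+ 2 <= D^-1 * l2_norm (T x) ^+ 2.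
    rewrite [D^-1 ^+ 2]expr2 -mulrA; apply: ler_wpM2l; first by rewrite invr_ge0 ltW.
    by rewrite mulrC ler_pdivrMr// mulrC.
  have h4 : a / D * l2_norm x ^+ 2 <= D^-1 * l2_norm (T x) ^+ 2.
    by rewrite mulrAC mulrC; apply: ler_wpM2l => //; rewrite invr_ge0 ltW.
  by rewrite mulrBl mul1r; lra.
have cvg_re : (fun n : nat => r ^+ n / (1 - r)) @ \oo --> 0.
  by rewrite -(mul0r (1 - r)^-1); apply: cvgMl; apply: cvg_expr; rewrite ger0_norm.
have [m hm] := near_le0 cvg_re e0; have {hm} hm := hm m.+1 (leqnSn m).
pose q := log_poly D m.+1.
have tr := log_trace bA sA a0 D0 r1 r0 ar hA hNr m.
have [K [c [c0 hK]]] := poly_trace_moment f q.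
(* Both sides are compared through squares, so twice the logarithms are estimated: the two errors
   e|F| average to one and c is halved. *)
exists K, (c / 2); split=> [|F]; first by rewrite divr_ge0.
have [l [hl dl tl]] := section_mx_eigen posT F cM.
have l0 i : 0 < l i by case/andP: (hl i) => h _; rewrite (lt_le_trans _ h)// invr_gt0.
have [_ lnl] := ln_prod_pos l0.
have qE (mu : R) : q.[mu ^+ 2] = \sum_(k < size q) q`_k * mu ^+ (2 * k).
  by rewrite horner_coef; apply: eq_bigr => k _; rewrite exprM.
have lndet : `|\sum_(k < size q) q`_k * (\tr (section_mx f F ^+ (2 * k)))%:~R -
     2 * ln (\det (section_mx f F))%:~R| <= #|`F|%:R * e.
  rewrite dl lnl.
  have -> : \sum_(k < size q) q`_k * (\tr (section_mx f F ^+ (2 * k)))%:~R =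
      \sum_i q.[l i ^+ 2].
    under [RHS]eq_bigr do rewrite qE.
    rewrite exchange_big; apply: eq_bigr => k _; by rewrite tl mulr_sumr.
  rewrite mulr_sumr -sumrB (le_trans (ler_norm_sum _ _ _))//.
  have -> : #|`F|%:R * e = \sum_(i < #|`F|) e by rewrite sumr_const card_ord mulr_natl.
  apply: ler_sum => i _.
  have -> : 2 * ln (l i) = ln (l i ^+ 2) by rewrite lnXn ?mulr_natl.
  apply: le_trans hm; apply: log_poly_approx => //.
    rewrite exprn_gt0//= ler_sqr ?nnegrE ?(ltW NC) ?(ltW (l0 i))//.
    by case/andP: (hl i) => _ h; rewrite (le_trans h)// lerDr ltW.
  rewrite (le_trans _ ar)// lerD2l lerN2 ler_pM2r ?invr_gt0//.
  rewrite ler_sqr ?nnegrE ?invr_ge0 ?(ltW M0) ?(ltW (l0 i))//.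
  by case/andP: (hl i).
have Lam : 2 * ln (FK_det T) = complex.Re (vn_trace (log_op A)).
  rewrite /FK_det expRK adjoint_self// -/A mulrA mulfV ?mul1r//.
move: tr; rewrite horner_op_moment -/q -Lam => tr.
have {}tr := le_trans tr hm.
have n0 : 0 <= #|`F|%:R :> R by [].
have := hK F; move: lndet tr n0.
move: (ln (FK_det T)) (ln _) (\sum_(k < _) _) (\sum_(k < _) _) (#|`F|%:R) => L d s1 s2 n.
rewrite !ler_norml => /andP[h1 h2] /andP[h3 h4] n0 /andP[h5 h6].
have h7 := ler_wpM2l n0 h3; have h8 := ler_wpM2l n0 h4.
move: h7 h8; rewrite !mulrBr mulrN [n * (2 * L)]mulrCA => h7 h8.
by apply/andP; split; lra.
Qed.

(** A positive integer is at least 1. *)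
Lemma ln_det_ge0 F : 0 <= ln ((\det (section_mx f F))%:~R : R).
Proof.
by apply: ln_ge0; rewrite ler1z -gtz0_ge1 det_section_gt0.
Qed.

End DetAsymptotics.

(** * The cokernel of a finite section *)

(** The Smith normal form L diag(d) Q identifies the cokernel with the product of the Z/d_i. The
    representatives are then moved into the image of the half-open unit cube, so that their entries
    are bounded by row sums. *)
Lemma coker_representatives (R : realType) n (B : 'M[int]_n) : 0 < \det B ->
  exists (E : finType) (z : E -> 'cV[int]_n), [/\ #|E| = `|\det B|%N,
    forall v, exists e w, v = z e + B *m w,
    forall e e' w, z e - z e' = B *m w -> e = e' &
    forall e, exists t : 'cV[R]_n, (forall i, 0 <= t i 0 < 1) /\
      map_mx intr (z e) = map_mx intr B *m t].
Proof.
move=> detB; have [L Lu [Q Qu [s _ BE]]] := int_Smith_normal_form B.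
pose d (i : 'I_n) : int := s`_i.
have DE : \matrix_(i, j) (s`_i *+ (i == j :> nat)) = diag_mx (\row_i d i) :> 'M[int]_n.
  by apply/matrixP => i j; rewrite !mxE.
rewrite DE in BE; have detE : \det B = \det L * (\prod_i d i) * \det Q.
  by rewrite BE !det_mulmx det_diag; congr (_ * _ * _); apply: eq_bigr => i _; rewrite mxE.
have abs_unit (x : int) : x \is a GRing.unit -> `|x|%N = 1%N.
  by rewrite qualifE/= => /orP[] /eqP->.
have d0 i : d i != 0.
  apply: contraTneq detB => di; rewrite detE (bigD1 i)//= di mul0r mulr0 mul0r.
  by rewrite ltxx.
have d_gt0 i : (0 < `|d i|)%N by rewrite absz_gt0.
pose E := {dffun forall i : 'I_n, 'I_(`|d i|)}.
pose z0 (e : E) : 'cV[int]_n := L *m \col_i (e i : nat)%:Z.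
pose BR : 'M[R]_n := map_mx intr B.
have BRu : BR \in unitmx.
  by rewrite unitmxE det_map_mx unitfE intr_eq0 gt_eqF.
pose c (e : E) : 'cV[R]_n := invmx BR *m map_mx intr (z0 e).
(* Subtracting B times the integral part of B^-1 z0 leaves B times the fractional part. *)
pose fl (e : E) : 'cV[int]_n := \col_i Num.floor (c e i 0).
exists E, (fun e => z0 e - B *m fl e); split.
- rewrite card_dep_ffun foldrE big_image/= detE !abszM.
  rewrite (abs_unit (\det L)) -?unitmxE// (abs_unit (\det Q)) -?unitmxE//.
  rewrite mul1n muln1; elim/big_rec2: _ => [//|i x y _ ->].
  by rewrite abszM card_ord.
- move=> v; have [u vE] : exists u, v = L *m u by exists (invmx L *m v); rewrite mulKVmx.
  have lt_mod i : (`|(u i ord0 %% d i)%Z| < `|d i|)%N.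
    by rewrite -ltz_nat gez0_abs ?modz_ge0// abszE ltz_mod.
  pose e : E := [ffun i => Ordinal (lt_mod i)].
  pose q : 'cV[int]_n := \col_i (u i ord0 %/ d i)%Z.
  exists e, (invmx Q *m q + fl e).
  rewrite mulmxDr addrCA subrK.
  rewrite /z0 BE -!mulmxA (mulKVmx Qu) -mulmxDr vE.
  congr (L *m _).
  apply/colP => i; rewrite mxE mul_diag_mx !mxE ffunE/= gez0_abs ?modz_ge0//.
  by rewrite {1}(divz_eq (u i ord0) (d i)) mulrC.
- move=> e e' w h; have {h} : z0 e - z0 e' = B *m (w + fl e - fl e').
    rewrite mulmxBr mulmxDr -h.
    move: (z0 e) (z0 e') (B *m fl e) (B *m fl e') => a b x y.
    by apply/matrixP => i j; rewrite !mxE; ring.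
  move: (w + fl e - fl e') => x; rewrite /z0 -mulmxBr BE -!mulmxA.
  move=> /(congr1 (mulmx (invmx L))); rewrite !mulKmx// => /colP h.
  apply/ffunP => i; apply/val_inj => /=; have := h i.
  rewrite mul_diag_mx !mxE; move: (\sum_j _) => y hy.
  have : ((e i : nat)%:Z %% d i)%Z = ((e' i : nat)%:Z %% d i)%Z.
    apply/eqP; rewrite eqz_mod_dvd hy; exact: dvdz_mulr.
  rewrite -(modz_abs _ (d i)) -[in RHS](modz_abs _ (d i)) !modz_small ?ltz_nat ?ltn_ord//.
  by case.
- move=> e; exists (\col_i (c e i 0 - (Num.floor (c e i 0))%:~R)); split=> [i|].
    have /andP[h1 h2] := floor_itv (c e i 0).
    by rewrite mxE subr_ge0 h1 ltrBlDr addrC -intrD1 intrD1// -intrD1.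
  have -> : \col_i (c e i 0 - (Num.floor (c e i 0))%:~R) = c e - map_mx intr (fl e).
    by apply/colP => i; rewrite !mxE.
  by rewrite -/BR mulmxBr {1}/c (mulKVmx BRu) map_mxB (map_mxM _ B).
Qed.

(** * Characters and their real lifts *)

Section Circle.
Variable R : realType.
Local Notation C := R[i]^o.
Implicit Types (s t : R) (z : C).

Definition circ t : C := Complex (cos (2 * pi * t)) (sin (2 * pi * t)).

Lemma circD s t : circ (s + t) = circ s * circ t.
Proof.
rewrite /circ mulrDr cosD sinD; apply/eqP; rewrite eq_complex/= eqxx/=.
by apply/eqP; ring.
Qed.

Lemma circ0 : circ 0 = 1.
Proof. by rewrite /circ mulr0 cos0 sin0. Qed.

Lemma circN t : circ (- t) = conjc (circ t).
Proof. by rewrite /circ mulrN cosN sinN. Qed.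

Lemma normc_circ t : normc (circ t) = 1.
Proof. by rewrite normcE/= cos2Dsin2 sqrtr1. Qed.

Lemma circ_nat n : circ n%:R = 1.
Proof.
elim: n => [|n IHn]; first exact: circ0.
rewrite -natr1 circD IHn mul1r /circ mulr1 mulr_natl cos2pi sin2pi//.
Qed.

Lemma circ_int (n : int) : circ n%:~R = 1.
Proof.
case: n => n; first exact: circ_nat.
by rewrite NegzE rmorphN/= circN circ_nat conjc1.
Qed.

Lemma circB s t : circ (s - t) = circ s * conjc (circ t).
Proof. by rewrite circD circN. Qed.

Lemma circ_dist s t : normc (circ s - circ t) = normc (circ (s - t) - 1).
Proof.
have -> : circ s - circ t = (circ (s - t) - 1) * circ t.
  by rewrite mulrBl mul1r -circD subrK.
by rewrite normcM normc_circ mulr1.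
Qed.

Lemma circ_surj z : normc z = 1 -> exists t, `|t| <= 1 /\ z = circ t.
Proof.
have p0 : 0 < 2 * pi :> R by rewrite mulr_gt0// pi_gt0.
move=> z1; have := sqr_normcE z; rewrite z1 expr1n; case: z {z1} => a b /= ab.
have a1 : -1 <= a <= 1.
  by rewrite -ler_norml -[leRHS]sqrtr1 -sqrtr_sqr ler_wsqrtr// ab lerDl sqr_ge0.
have ac0 := acos_ge0 a1; have acp := acos_lepi a1.
have tE t : 2 * pi * (t / (2 * pi)) = t by rewrite mulrC divfK// gt_eqF.
have bn : sin (acos a) = `|b|.
  by rewrite sin_acos// ab addrAC subrr add0r sqrtr_sqr.
have tn : `|acos a / (2 * pi)| <= 1.
  rewrite ger0_norm ?divr_ge0 ?(ltW p0)// ler_pdivrMr// mul1r (le_trans acp)//.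
  by rewrite ler_peMl ?pi_ge0// ler1n.
have cosa : cos (acos a) = a by rewrite acosK// in_itv/=.
have [b0|b0] := leP 0 b.
  by exists (acos a / (2 * pi)); split=> //; rewrite /circ tE cosa bn ger0_norm.
exists (- (acos a / (2 * pi))); split; first by rewrite normrN.
by rewrite circN /circ tE cosa bn /= ltr0_norm// opprK.
Qed.

Lemma circ_near0 (e : R) : 0 < e ->
  exists d : R, 0 < d /\ forall t, `|t| < d -> normc (circ t - 1) < e.
Proof.
move=> e0; have e2 : 0 < e / 2 by rewrite divr_gt0.
have lin0 : (fun t : R => 2 * pi * t) x @[x --> 0] --> (2 * pi * 0 : R).
  by apply: cvgMr; exact: cvg_id.
have c0 : cos (2 * pi * t) @[t --> (0 : R)] --> cos (2 * pi * 0 : R).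
  by apply: continuous_cvg; [exact: continuous_cos|exact: lin0].
have s0 : sin (2 * pi * t) @[t --> (0 : R)] --> sin (2 * pi * 0 : R).
  by apply: continuous_cvg; [exact: continuous_sin|exact: lin0].
rewrite mulr0 cos0 in c0; rewrite mulr0 sin0 in s0.
have := @cvgr_dist_lt _ _ _ _ _ _ _ c0 _ e2.
have := @cvgr_dist_lt _ _ _ _ _ _ _ s0 _ e2.
move=> /(_ _) hs /(_ _) hc; have [d /= d0 hd] := filterI hs hc.
exists d; split=> // t td; have [|h1 h2] := hd t; first by rewrite /= sub0r normrN.
apply: (le_lt_trans (normc_ReIm (circ t - 1))).
rewrite /= subr0 [e]splitr addrC ltrD//.
  by rewrite -normrN -[- _]sub0r.
by rewrite distrC.
Qed.

Definition round t : int := Num.floor (t + 2^-1).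

Lemma round_dist t : `|t - (round t)%:~R| <= 2^-1.
Proof.
have /andP[] := floor_itv (t + 2^-1); rewrite -/(round t) intrD => h1 h2.
by rewrite ler_norml; apply/andP; split; lra.
Qed.

(** Quantitative form of the injectivity of [circ] on R/Z. The threshold is 1 - cos(2 pi e') with e'
    <= 1/2, because cos decreases on [0, pi]. *)
Lemma circ_round (e : R) : 0 < e ->
  exists d : R, 0 < d /\ forall t, normc (circ t - 1) < d -> `|t - (round t)%:~R| < e.
Proof.
move=> e0; pose e' := Num.min e 2^-1.
have e'0 : 0 < e' by rewrite lt_min e0 invr_gt0 ltr0n.
have e'2 : e' <= 2^-1 by rewrite ge_min lexx orbT.
have p0 : 0 < pi :> R := pi_gt0 R.
have mem_pi t : 0 <= t <= 2^-1 -> 2 * pi * t \in `[0, pi].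
  move=> /andP[t0 t1]; rewrite in_itv/= !mulr_ge0 ?(ltW p0)//=.
  by rewrite -mulrA mulrCA ler_piMr ?(ltW p0)//; lra.
exists (1 - cos (2 * pi * e')); split.
  have h1 : 2 * pi * e' \in `[0, pi] by rewrite mem_pi// (ltW e'0).
  have h0 : 0 \in `[0, pi :> R] by rewrite in_itv/= lexx ltW.
  by rewrite subr_gt0 -[ltRHS]cos0 ltr_cos// !mulr_gt0.
move=> t ht; apply: (@lt_le_trans _ _ e'); last by rewrite ge_min lexx.
rewrite ltNge; apply/negP => he.
have := round_dist t; move: he; set s := t - _ => he hs.
have cs : circ t = circ s by rewrite circB circ_int conjc1 mulr1.
move: ht; rewrite cs => /(le_lt_trans (Re_normc _)) /=.
rewrite distrC => /(le_lt_trans (ler_norm _)); rewrite ltrD2l ltrN2.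
rewrite -[cos (2 * pi * s)]cos_norm normrM ger0_norm ?mulr_ge0 ?(ltW p0)//.
have hs' : 0 <= `|s| <= 2^-1 by rewrite normr_ge0 hs.
have he' : 0 <= e' <= 2^-1 by rewrite (ltW e'0).
rewrite ltr_cos ?mem_pi// ltr_pM2l ?mulr_gt0// => h.
by move: he; rewrite leNgt h.
Qed.

Lemma round_bound t : `|(round t)%:~R| <= `|t| + 1.
Proof.
have := round_dist t; rewrite distrC => h.
rewrite -[X in `|X|](subrK t) (le_trans (ler_normD _ _))// addrC lerD2l.
by rewrite (le_trans h)// invf_le1 ?ler1n.
Qed.

End Circle.

Section Pairing.
Variables (R : realType) (G : groupType).
Local Notation ZG := (group_ring G).
Implicit Types (a b : ZG) (th : G -> R) (g h : G).

Lemma gr_eltE g h : gr_elt g h = (h == g)%:R.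
Proof. by rewrite fsfunE inE; case: eqP. Qed.

Lemma finsupp_gr_elt g : finsupp (gr_elt g) = [fset g]%fset.
Proof.
apply/fsetP => h; rewrite mem_finsupp gr_eltE inE.
by case: (h == g).
Qed.

Lemma gr_elt_mulE g a h : (gr_elt g * a) h = a (g^-1 * h)%g.
Proof.
by rewrite group_ringME finsupp_gr_elt big_seq_fset1 gr_eltE eqxx mul1r.
Qed.

Lemma gr_eltM g h : gr_elt g * gr_elt h = gr_elt (g * h)%g.
Proof.
apply/fsfunP => k; rewrite gr_elt_mulE !gr_eltE -(inj_eq (mulgI g)) mulVKg.
by [].
Qed.

Lemma gr_elt1 : gr_elt 1%g = 1 :> ZG.
Proof. by apply/fsfunP => k; rewrite gr_eltE -(gr_oneE k). Qed.

(** The additive functional on ZG with values [th] on the group elements; composed with [circ] it is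
    a character of ZG. *)
Definition pairing th a : R := \sum_(g <- finsupp a) (a g)%:~R * th g.

Lemma pairingE th a (S : {fset G}) : (finsupp a `<=` S)%fset ->
  pairing th a = \sum_(g <- S) (a g)%:~R * th g.
Proof.
by move=> aS; apply: big_fset_incl => // g _ ga; rewrite fsfun_dflt// mul0r.
Qed.

Lemma pairingD th a b : pairing th (a + b) = pairing th a + pairing th b.
Proof.
pose S := ((finsupp a `|` finsupp b) `|` finsupp (a + b)%R)%fset.
rewrite !(@pairingE _ _ S) ?fsubsetUr//; last 2 first.
- by apply/fsubsetP => g ga; rewrite !in_fsetU ga ?orbT.
- by apply/fsubsetP => g ga; rewrite !in_fsetU ga ?orbT.
by rewrite -big_split; apply: eq_bigr => g _; rewrite group_ringDE rmorphD mulrDl.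
Qed.

Lemma pairing0 th : pairing th 0 = 0.
Proof. by apply: (addrI (pairing th 0)); rewrite -pairingD !addr0. Qed.

Lemma pairing_elt th g : pairing th (gr_elt g) = th g.
Proof. by rewrite /pairing finsupp_gr_elt big_seq_fset1 gr_eltE eqxx mul1r. Qed.

Lemma pairing_elt_mul th g a :
  pairing th (gr_elt g * a) = pairing (fun h => th (g * h)%g) a.
Proof.
rewrite (@pairingE _ _ [fset (g * h)%g | h in finsupp a]%fset).
  rewrite big_imfset/=; last by move=> ? ? _ _; exact: mulgI.
  by apply: eq_bigr => h _; rewrite gr_elt_mulE mulKg.
apply/fsubsetP => h; rewrite mem_finsupp gr_elt_mulE => ah.
by apply/imfsetP; exists (g^-1 * h)%g; rewrite ?mem_finsupp//= mulVKg.
Qed.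

(** Bridge between the two descriptions of X_f: the functional is integral on the ideal ZG f as soon
    as [tau f th] is integral. *)
Lemma pairing_mulr th a f :
  pairing th (a * f) = \sum_(h <- finsupp a) (a h)%:~R * tau f th h.
Proof.
pose S := fset_mulg (finsupp a) (finsupp f).
rewrite (@pairingE _ _ S) ?finsupp_sub//.
under eq_bigr do rewrite group_ringME rmorph_sum mulr_suml.
rewrite exchange_big/= big_seq [RHS]big_seq; apply: eq_bigr => h ha.
under eq_bigr do rewrite rmorphM/= -mulrA.
rewrite -mulr_sumr; congr (_ * _).
rewrite -(big_fset_incl _ (A := [fset (h * k)%g | k in finsupp f]%fset)).
- rewrite big_imfset/=; last by move=> ? ? _ _; exact: mulgI.
  by apply: eq_bigr => k _; rewrite mulKg.
- apply/fsubsetP => _ /imfsetP[k/= kf ->]; apply/imfset2P; exists h => //.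
  by exists k.
- move=> g _ gA; rewrite (_ : f _ = 0) ?mul0r//; apply/fsfun_dflt.
  apply: contra gA => hg; apply/imfsetP; exists (h^-1 * g)%g => //=.
  by rewrite mulVKg.
Qed.

Lemma group_ring_ind (P : ZG -> Prop) :
  P 0 -> (forall a b, P a -> P b -> P (a + b)) -> (forall a, P a -> P (- a)) ->
  (forall g, P (gr_elt g)) -> forall a, P a.
Proof.
move=> P0 PD PN Pelt a.
have -> : a = \sum_(g <- finsupp a) gr_elt g *~ a g.
  have sumE (s : seq G) (F : G -> ZG) h : (\sum_(g <- s) F g) h = \sum_(g <- s) F g h.
    by elim/big_rec2: _ => [|g u v _ <-]; rewrite ?group_ring0E ?group_ringDE.
  have mulnE (u : ZG) n h : (u *+ n) h = u h *+ n.
    by elim: n => [|n IHn]; rewrite ?group_ring0E// !mulrS group_ringDE IHn.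
  have mulzE (u : ZG) (n : int) h : (u *~ n) h = u h *~ n.
    by case: n => n; rewrite ?NegzE ?mulrNz ?group_ringNE -!pmulrn mulnE.
  apply/fsfunP => h; rewrite sumE; under eq_bigr do rewrite mulzE gr_eltE.
  have [ha|ha] := boolP (h \in finsupp a).
    rewrite (big_fsetD1 h)//= eqxx intz big_seq big1 ?addr0// => g.
    by rewrite !inE eq_sym => /andP[/negbTE-> _]; rewrite mul0rz.
  rewrite fsfun_dflt// big_seq big1// => g ga.
  by case: eqP ha => [->|_ _]; [rewrite ga|rewrite mul0rz].
elim/big_rec: _ => // g b _ Pb; apply: (PD _ _ _ Pb).
have Pn n : P (gr_elt g *+ n) by elim: n => [//|n IHn]; rewrite mulrS; exact: PD.
by case: (a g) => n; rewrite ?NegzE ?mulrNz -?pmulrn; [|apply: PN]; exact: Pn.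
Qed.

End Pairing.

Section Lifts.
Variables (R : realType) (G : groupType) (f : group_ring G).
Local Notation C := R[i]^o.
Local Notation ZG := (group_ring G).
Local Notation M := (quot_module f).
Local Notation X := (dual_system R f).
Local Notation pi a := (\pi_(quot_module f) a)%qT.
Implicit Types (a b : ZG) (m n : M) (chi : X) (th : G -> R).

Lemma repr_pi_sub a : exists b, repr (pi a) - a = b * f.
Proof.
have : repr (pi a) - a \in left_ideal f by rewrite Quotient.idealrBE reprK.
by move=> /asboolP.
Qed.

Lemma quot_translate_pi g a : quot_translate g (pi a) = pi (gr_elt g * a).
Proof.
rewrite /quot_translate; apply/eqP; rewrite -Quotient.idealrBE -mulrBr.
by have [b ->] := repr_pi_sub a; apply/asboolP; exists (gr_elt g * b); rewrite mulrA.
Qed.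

Definition coord chi a : C := val chi (pi a).

Lemma coordD chi a b : coord chi (a + b) = coord chi a * coord chi b.
Proof. by case: chi => chi h; have [_ hD] := set_mem h; rewrite /coord raddfD/= hD. Qed.

Lemma normc_coord chi a : normc (coord chi a) = 1.
Proof.
case: chi => chi h; have [h1 _] := set_mem h.
have := h1 (pi a); rewrite /coord/=; case: (chi _) => u v /= /(congr1 (@complex.Re R)).
by rewrite normc_def/=.
Qed.

Lemma coord0 chi : coord chi 0 = 1.
Proof.
have n0 : coord chi 0 != 0.
  apply/eqP => h; have := normc_coord chi 0; rewrite h normc0 => /eqP.
  by rewrite eq_sym oner_eq0.
by apply: (mulfI n0); rewrite -coordD mulr1 addr0.
Qed.

Lemma coord_ideal chi a : coord chi (a * f) = 1.
Proof.
rewrite -(coord0 chi) /coord; congr (val chi _); apply/eqP.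
by rewrite -Quotient.idealrBE subr0; apply/asboolP; exists a.
Qed.

Lemma coord_act g chi a : coord (dual_act R f g chi) a = coord chi (gr_elt g^-1%g * a).
Proof. by rewrite /coord -quot_translate_pi. Qed.

Lemma coord_inj chi chi' : (forall a, coord chi a = coord chi' a) -> chi = chi'.
Proof.
move=> h; apply: val_inj; apply/funext => m; rewrite -[m]reprK; exact: h.
Qed.

Lemma dual_actK g chi : dual_act R f g (dual_act R f g^-1%g chi) = chi.
Proof.
by apply: coord_inj => a; rewrite !coord_act invgK mulrA gr_eltM mulgV gr_elt1 mul1r.
Qed.

Lemma dual_actVK g chi : dual_act R f g^-1%g (dual_act R f g chi) = chi.
Proof. by rewrite -{2}[g]invgK dual_actK. Qed.

(* The formal sum of the th g reduces mod Z to the point of X_f given by chi. *)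
Definition lifts th chi := forall a, coord chi a = circ (pairing th a).

Lemma exists_lift chi : exists th, (forall g, `|th g| <= 1) /\ lifts th chi.
Proof.
have h g : exists t : R, `|t| <= 1 /\ coord chi (gr_elt g) = circ t.
  by apply: circ_surj; exact: normc_coord.
have [th hth] := choice h; exists th; split=> [g|]; first by case: (hth g).
apply: group_ring_ind => [|a b ha hb|a ha|g].
- by rewrite coord0 pairing0 circ0.
- by rewrite coordD pairingD circD ha hb.
- have c0 : coord chi a != 0.
    apply/eqP => h0; have := normc_coord chi a; rewrite h0 normc0 => /eqP.
    by rewrite eq_sym oner_eq0.
  apply: (mulfI c0); rewrite -coordD subrr coord0 ha -circD -pairingD subrr.
  by rewrite pairing0 circ0.
- by rewrite pairing_elt; case: (hth g).
Qed.

(** The character is 1 on ([gr_elt h]) f, and by [circ_round] a real t with [circ t] = 1 is within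
    every e of an integer. *)
Lemma lift_tau_int th chi : lifts th chi -> exists y : G -> int,
  forall h, tau f th h = (y h)%:~R.
Proof.
move=> hth; suff hy h : exists n : int, tau f th h = n%:~R.
  by have [y hy'] := choice hy; exists y.
have c1 : circ (tau f th h) = 1.
  rewrite -(coord_ideal chi (gr_elt h)) hth pairing_mulr finsupp_gr_elt.
  by rewrite big_seq_fset1 gr_eltE eqxx mul1r.
exists (round (tau f th h)); apply/eqP; rewrite -subr_eq0 -normr_le0.
apply/ler_addgt0Pr => e e0; rewrite add0r; have [d [d0 hd]] := circ_round e0.
by apply/ltW/hd; rewrite c1 subrr normc0.
Qed.

(** The character is evaluated on representatives; integrality on ZG f makes the value independent
    of them. *)
Lemma exists_character th (y : G -> int) : (forall h, tau f th h = (y h)%:~R) ->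
  exists chi, lifts th chi.
Proof.
move=> ty; have idl b : exists n : int, pairing th (b * f) = n%:~R.
  exists (\sum_(h <- finsupp b) b h * y h); rewrite pairing_mulr rmorph_sum.
  by apply: eq_bigr => h _; rewrite ty rmorphM.
have circ_idl a b c : a - b = c * f -> circ (pairing th a) = circ (pairing th b).
  move=> /eqP; rewrite subr_eq => /eqP ->; rewrite pairingD circD.
  by have [n ->] := idl c; rewrite circ_int mul1r.
pose psi (m : M) : C := circ (pairing th (repr m)).
have psiP : psi \in @characters R M.
  apply/mem_set; split=> [m|m n] /=.
    by rewrite normc_def -normcE normc_circ.
  rewrite /psi -circD -pairingD.
  suff [c hc] : exists c, repr (m + n) - (repr m + repr n) = c * f by exact: circ_idl hc.
  have : repr (m + n) - (repr m + repr n) \in left_ideal f.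
    by rewrite Quotient.idealrBE raddfD/= !reprK.
  by move=> /asboolP.
exists (exist _ psi psiP) => a; rewrite /coord/= /psi.
by have [c hc] := repr_pi_sub a; exact: circ_idl hc.
Qed.

Lemma lifts_act th chi g : lifts th chi ->
  lifts (fun h => th (g^-1 * h)%g) (dual_act R f g chi).
Proof. by move=> hth a; rewrite coord_act hth pairing_elt_mul. Qed.

End Lifts.

(** * Topology of the dual *)

Lemma mem_fset3 (T : choiceType) (a b c : T) :
  [/\ a \in [fset a; b; c]%fset, b \in [fset a; b; c]%fset & c \in [fset a; b; c]%fset].
Proof. by rewrite !inE !eqxx !orbT. Qed.

Section Topology.
Variables (R : realType) (G : groupType) (f : group_ring G).
Local Notation C := R[i]^o.
Local Notation M := (quot_module f).
Local Notation X := (dual_system R f).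
Implicit Types (K : {fset M}) (e : R).

Lemma normc_normr (z : C) : `|z| = (normc z)%:C%C.
Proof. by rewrite normc_def normcE. Qed.

Lemma near_eval (x0 : {ptws M -> C}) (m : M) e : 0 < e ->
  \forall x \near x0, normc (x m - x0 m) < e.
Proof.
move=> e0; have e0' : 0 < e%:C%C :> C by rewrite ltcR.
have := @cvgr_dist_lt _ C _ (nbhs x0) _ _ _ (@proj_continuous M (fun=> C) m x0) _ e0'.
move=> /(_ _); apply: filterS => x /=.
by rewrite /proj normc_normr ltcR normc_distC.
Qed.

Lemma near_eval_fset (x0 : {ptws M -> C}) K e : 0 < e ->
  \forall x \near x0, forall m, m \in K -> normc (x m - x0 m) < e.
Proof.
move=> e0; suff : \forall x \near x0, forall m, m \in enum_fset K -> normc (x m - x0 m) < e.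
  by [].
elim: (enum_fset K) => [|a s IHs].
  by apply: (@filterE _ (nbhs x0) (nbhs_filter x0)) => x m; rewrite in_nil.
apply: (@filterS2 _ (nbhs x0) (nbhs_filter x0) _ _ _ _ (near_eval x0 a e0) IHs).
by move=> x h1 h2 m; rewrite inE => /predU1P[->//|]; exact: h2.
Qed.

Definition eval_ball (x0 : {ptws M -> C}) (p : {fset M} * R) : set {ptws M -> C} :=
  [set x | forall m, m \in p.1 -> normc (x m - x0 m) < p.2].

(** The balls at finitely many points generate a filter that converges to x0 in every coordinate,
    hence in the product topology. *)
Lemma nbhs_eval_ball (x0 : {ptws M -> C}) (O : set {ptws M -> C}) : nbhs x0 O ->
  exists K e, 0 < e /\ eval_ball x0 (K, e) `<=` O.
Proof.
pose F := filter_from [set p : {fset M} * R | 0 < p.2] (eval_ball x0).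
have FF : Filter F.
  apply: filter_from_filter; first by exists (fset0, 1); rewrite /= ltr01.
  move=> [K1 e1] [K2 e2] /= h1 h2; exists ((K1 `|` K2)%fset, Num.min e1 e2).
    by rewrite /= lt_min h1.
  move=> x hx; split=> m mK; (apply: lt_le_trans; first by apply: hx; rewrite inE mK ?orbT).
    by rewrite ge_min lexx.
  by rewrite ge_min lexx orbT.
have cv : F --> x0.
  apply/cvg_sup => m U [V] [[W] oW <-] Wm WU; apply: (filterS WU).
  have : nbhs (x0 m : C) W by apply: open_nbhs_nbhs; split.
  move=> /nbhs_ballP[e /= e0 hW].
  have e_real : e = (complex.Re e)%:C%C by rewrite RRe_real// gtr0_real.
  have e1 : 0 < complex.Re e by move: e0; rewrite e_real ltcR.
  exists ([fset m]%fset, complex.Re e); first exact: e1.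
  move=> x hx; have h : normc (x m - x0 m) < complex.Re e by apply: hx; exact: fset11.
  apply: (hW (x m)); rewrite -ball_normE /ball_/= e_real normc_normr ltcR.
  by rewrite normc_distC.
by move=> /cv[[K e] e0 hO]; exists K, e.
Qed.

(** A limit point is compared with a character close to it at m, n and m + n; the defect of
    multiplicativity is then at most 3 e. *)
Lemma characters_closed : closed (@characters R M).
Proof.
move=> x0 hx0.
have near0 K e : 0 < e -> exists x, @characters R M x /\ eval_ball x0 (K, e) x.
  move=> e0; have [x [xc xb]] := hx0 _ (near_eval_fset x0 K e0).
  by exists x.
have norm1 x m : @characters R M x -> normc (x m) = 1.
  move=> [h1 _]; have := h1 m; rewrite normc_normr => /(congr1 (@complex.Re R)) /=.
  by [].
have n0 m : normc (x0 m) = 1.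
  apply/eqP; rewrite -subr_eq0 -normr_le0; apply/ler_addgt0Pr => e e0; rewrite add0r.
  have [x [x_char hb]] := near0 [fset m]%fset e e0.
  have h : normc (x m - x0 m) < e by apply: hb; exact: fset11.
  have xc := norm1 x m x_char.
  have h1 : normc (x m) <= normc (x0 m) + normc (x m - x0 m).
    by have := normc_triangle (x0 m) (x m - x0 m); rewrite addrC subrK.
  have h2 : normc (x0 m) <= normc (x m) + normc (x m - x0 m).
    rewrite [X in _ + X]normc_distC.
    by have := normc_triangle (x m) (x0 m - x m); rewrite addrC subrK.
  by rewrite xc in h1 h2; rewrite ler_norml; apply/andP; split; lra.
split=> [m|m n]; first by rewrite normc_normr n0.
apply/eqP; rewrite -subr_eq0; apply/eqP/(@eps_normc _ _ 3) => e e0.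
have [x [xc hb]] := near0 [fset m; n; (m + n)%R]%fset e e0.
have [mem1 mem2 mem3] := mem_fset3 m n (m + n).
have h1 : normc (x m - x0 m) < e := hb _ mem1.
have h2 : normc (x n - x0 n) < e := hb _ mem2.
have h3 : normc (x (m + n) - x0 (m + n)) < e := hb _ mem3.
have [_ xD] := xc.
move: xc xD h1 h2 h3 (norm1 x m) (n0 n) => xc xD h1 h2 h3 xm x0n.
have -> : x0 (m + n) - x0 m * x0 n = - (x (m + n) - x0 (m + n)) +
    (x m * (x n - x0 n) + (x m - x0 m) * x0 n).
  rewrite xD; move: (x m) (x n) (x0 m) (x0 n) (x0 (m + n)) => a b c d u; ring.
rewrite (le_trans (normc_triangle _ _))// normc_opp.
have := normc_triangle (x m * (x n - x0 n)) ((x m - x0 m) * x0 n).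
rewrite !normcM (xm xc) x0n mul1r mulr1 => h4.
lra.
Qed.

Lemma circle_compact : compact [set z : C | normc z = 1].
Proof.
have -> : [set z : C | normc z = 1] = @circ R @` `[-1, 1].
  apply/seteqP; split=> [z /circ_surj[t [t1 ->]]|_ [t _ <-]]; last exact: normc_circ.
  by exists t => //; rewrite /= in_itv/= -ler_norml.
apply: continuous_compact; last exact: segment_compact.
apply: continuous_subspaceT => t.
apply: (iffRL (@cvgrPdist_lt _ C _ _ _ _ _)) => e e0.
have e_real : e = (complex.Re e)%:C%C by rewrite RRe_real// gtr0_real.
have e1 : 0 < complex.Re e by move: e0; rewrite e_real ltcR.
have [d [d0 hd]] := circ_near0 e1.
exists d => // s /= ts; rewrite e_real normc_normr ltcR circ_dist.
exact: hd.
Qed.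

Lemma characters_compact : compact (@characters R M).
Proof.
have cB : compact ([set x | forall m, [set z : C | normc z = 1] (x m)] : set {ptws M -> C}).
  exact: (tychonoff (fun=> circle_compact)).
have sub : @characters R M `<=` [set x | forall m, [set z : C | normc z = 1] (x m)].
  move=> x [h1 _] m; have := h1 m.
  by rewrite normc_normr => /(congr1 (@complex.Re R)).
exact: (subclosed_compact characters_closed cB sub).
Qed.

(** Compactness is applied to the filter of pairs (K, e) with K growing and e shrinking. Around each
    point a ball of radius e/2 is used, so that a further e/2 stays inside the same element of the
    cover. *)
Lemma lebesgue_number (U : set (set X)) : open_cover U ->
  exists K e, 0 < e /\ forall chi : X, exists u, U u /\
    forall chi' : X, (forall m, m \in K -> normc (val chi' m - val chi m) < e) -> u chi'.
Proof.
move=> [Uo Uc].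
pose F := filter_from [set p : {fset M} * R | 0 < p.2]
  (fun p => [set q | (p.1 `<=` q.1)%fset /\ q.2 <= p.2]).
have FF : Filter F.
  apply: filter_from_filter; first by exists (fset0, 1); rewrite /= ltr01.
  move=> [K1 e1] [K2 e2] /= h1 h2; exists ((K1 `|` K2)%fset, Num.min e1 e2).
    by rewrite /= lt_min h1.
  move=> [K e] /= [Kq eq]; split=> /=; split.
  - exact: fsubset_trans (fsubsetUl _ _) Kq.
  - by rewrite (le_trans eq)// ge_min lexx.
  - exact: fsubset_trans (fsubsetUr _ _) Kq.
  - by rewrite (le_trans eq)// ge_min lexx orbT.
pose P (q : {fset M} * R) (x : {ptws M -> C}) := exists u, U u /\
    forall chi' : X, eval_ball x q (val chi') -> u chi'.
have /compact_near_coveringP/(_ _ F P FF) := characters_compact.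
case.
  move=> x xc; pose chi : X := exist _ x (mem_set xc).
  have : (\bigcup_(u in U) u) chi by rewrite Uc.
  move=> [u Uu uchi]; have [W oW Wu] := Uo u Uu.
  have Wx : W x by have : (set_val @^-1` W) chi by rewrite Wu.
  have [K [e [e0 hW]]] := nbhs_eval_ball (open_nbhs_nbhs (conj oW Wx)).
  have e2 : 0 < e / 2 by rewrite divr_gt0.
  exists ([set x' | forall m, m \in K -> normc (x' m - x m) < e / 2],
      [set q | (K `<=` q.1)%fset /\ q.2 <= e / 2]).
    split; first exact: near_eval_fset.
    by exists (K, e / 2).
  move=> [x' q] /= [hx' [Kq qe]]; exists u; split=> // chi' hchi'.
  rewrite -Wu; apply: hW => m mK /=.
  have -> : val chi' m - x m = (val chi' m - x' m) + (x' m - x m) by rewrite addrA subrK.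
  rewrite (le_lt_trans (normc_triangle _ _))// [e]splitr ltrD ?hx'//.
  by apply: (lt_le_trans (hchi' m _)) => //; exact: (fsubsetP Kq).
move=> [K e] /= e0 h; exists K, e; split=> // chi.
have [u [Uu hu]] :=
  h (K, e) (conj (fsubset_refl _) (lexx _)) (val chi) (set_mem (valP chi)).
by exists u; split=> // chi' hchi'; exact: hu.
Qed.

Lemma eval_ball_open (x0 : {ptws M -> C}) p : open (eval_ball x0 p).
Proof.
case: p => K e; rewrite openE => x hx; rewrite /interior.
suff : \forall x' \near x, forall m, m \in enum_fset K -> normc (x' m - x0 m) < e by [].
have {hx} : forall m, m \in enum_fset K -> normc (x m - x0 m) < e by exact: hx.
elim: (enum_fset K) => [_|a s IHs hs].
  by apply: (@filterE _ (nbhs x) (nbhs_filter x)) => x' m; rewrite in_nil.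
have ha : 0 < e - normc (x a - x0 a) by rewrite subr_gt0 hs// mem_head.
have {}IHs := IHs (fun m ms => hs m (mem_behead (s := a :: s) ms)).
apply: (@filterS2 _ (nbhs x) (nbhs_filter x) _ _ _ _ (near_eval x a ha) IHs).
move=> x' h1 h2 m; rewrite inE => /predU1P[->|]; last exact: h2.
have -> : x' a - x0 a = (x' a - x a) + (x a - x0 a) by rewrite addrA subrK.
by rewrite (le_lt_trans (normc_triangle _ _))// -ltrBrDr.
Qed.

Lemma generator_cover K e : 0 < e -> open_cover
  (range (fun chi : X =>
     [set chi' : X | forall m, m \in K -> normc (val chi' m - val chi m) < e])).
Proof.
move=> e0; split=> [_ [chi _ <-]|].
  by exists (eval_ball (val chi) (K, e)); first exact: eval_ball_open.
apply/seteqP; split=> // chi _.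
exists [set chi' : X | forall m, m \in K -> normc (val chi' m - val chi m) < e].
  by exists chi.
by move=> m _; rewrite subrr normc0.
Qed.

End Topology.

(** * The inverse in the l1-algebra *)

Lemma big_fset_disjointU (V : nmodType) (I : choiceType) (A B : {fset I}) (u : I -> V) :
  [disjoint A & B]%fset ->
  \sum_(i <- (A `|` B)%fset) u i = \sum_(i <- A) u i + \sum_(i <- B) u i.
Proof.
move=> dAB; rewrite (big_fsetID _ (mem A))/=.
have -> : [fset x in (A `|` B)%fset | x \in A]%fset = A.
  by apply/fsetP => x; rewrite !inE/=; case: (x \in A); rewrite ?andbF.
have -> // : [fset x in (A `|` B)%fset | x \notin A]%fset = B.
apply/fsetP => x; rewrite !inE/=; have [xA|xA] := boolP (x \in A).
  by rewrite andbF (negbTE (fdisjointP dAB _ xA)).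
by rewrite andbT.
Qed.

Section L1Inverse.
Variables (R : realType) (G : groupType) (f : group_ring G).
Local Notation C := R[i]^o.
Local Notation delta1 := (fun g : G => (g == 1%g)%:R : R).
Hypothesis f_unit : l1_unit (to_l1 R f).

Let Re_intM (n : int) (z : C) : complex.Re (n%:~R * z) = n%:~R * complex.Re z.
Proof.
by rewrite -(rmorph_int (real_complex R)); case: z => a b /=; rewrite mul0r subr0.
Qed.

(** As f has integral coefficients, the real part of a complex inverse is again an inverse. The
    first identity serves to solve [tau f th = z], the second to recover u from [tau f u]. *)
Lemma l1_inverse : exists b : G -> R, [/\
  forall h, \sum_(g <- finsupp f) (f g)%:~R * b (g^-1 * h)%g = delta1 h,
  forall h, \sum_(g <- finsupp f) (f g)%:~R * b (h * g^-1)%g = delta1 h,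
  exists N, 0 <= N /\ forall A : {fset G}, \sum_(g <- A) `|b g| <= N &
  forall e, 0 < e -> exists A : {fset G}, forall B : {fset G},
    [disjoint A & B]%fset -> \sum_(g <- B) `|b g| <= e].
Proof.
have [_ [b [bsum b1 b2]]] := f_unit.
have Re_delta (h : G) : complex.Re (delta R 1%g h) = delta1 h.
  by rewrite /delta; case: (h == 1%g).
set s := (\esum_(g in setT) (normc (b g))%:E)%E in bsum.
have s_ge0 : (0 <= s)%E by apply: esum_ge0 => g _; rewrite lee_fin normc_ge0.
have s_fin : s \is a fin_num by rewrite ge0_fin_numE.
have sumN (A : {fset G}) : \sum_(g <- A) normc (b g) <= fine s.
  rewrite -lee_fin fineK//; apply: esum_ge; exists [set` A]; first by split.
  by rewrite fsbig_finite//= set_fsetK sumEFin.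
have ReN (A : {fset G}) : \sum_(g <- A) `|complex.Re (b g)| <= \sum_(g <- A) normc (b g).
  by apply: ler_sum => g _; exact: Re_normc.
exists (fun g => complex.Re (b g)); split.
- move=> h; have := congr1 (fun u => complex.Re (u h)) b1; rewrite Re_delta => <-.
  rewrite /convolution (has_sum_sum (has_sum_finite (A := finsupp f) _)).
    rewrite Re_sum; apply: eq_bigr => g _; exact/esym/Re_intM.
  by move=> g gf; rewrite /to_l1 fsfun_dflt// mul0r.
- move=> h; have := congr1 (fun u => complex.Re (u h)) b2; rewrite Re_delta => <-.
  pose A := [fset (h * g^-1)%g | g in finsupp f]%fset.
  rewrite /convolution (has_sum_sum (has_sum_finite (A := A) _)).
    rewrite big_imfset/=; last by move=> g g' _ _ /mulgI/invg_inj.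
    rewrite Re_sum; apply: eq_bigr => g _.
    by rewrite invgM invgK mulgVK [in RHS]mulrC Re_intM.
  move=> g gA; rewrite /to_l1 fsfun_dflt ?mulr0//; apply: contra gA => gf.
  by apply/imfsetP; exists (g^-1 * h)%g => //=; rewrite invgM invgK mulVKg.
- exists (fine s); split; first exact: fine_ge0.
  by move=> A; exact: le_trans (ReN A) (sumN A).
- move=> e e0; have : ((fine s - e)%:E < s)%E.
    by rewrite -[s in ltRHS]fineK// lte_fin ltrBlDr ltrDl.
  move=> /ereal_sup_gt[_ [A [finA _] <-]].
  rewrite fsbig_finite//= sumEFin lte_fin => h.
  exists (fset_set A) => B dAB; apply: (le_trans (ReN B)).
  have := sumN (fset_set A `|` B)%fset.
  rewrite (big_fset_disjointU _ dAB); lra.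
Qed.

(** The kernel b(h^-1 p) of the inverse is summed against z. The sup bound involves only the l1-norm
    of b and not F, which makes the number of boundary values in the lower bound uniform. *)
Lemma preimage_of_finite : exists N : R, 0 <= N /\
  forall (F : {fset G}) (z : G -> R) (M : R),
  (forall g, g \notin F -> z g = 0) -> (forall g, `|z g| <= M) ->
  exists th : G -> R, (forall h, tau f th h = z h) /\ forall h, `|th h| <= N * M.
Proof.
have [b [b1 _ [N [N0 hN]] _]] := l1_inverse; exists N; split=> // F z M zF zM.
exists (fun h => \sum_(p <- F) b (h^-1 * p)%g * z p); split=> h.
  rewrite /tau; under eq_bigr do rewrite mulr_sumr.
  rewrite exchange_big/=.
  transitivity (\sum_(p <- F) delta1 (h^-1 * p)%g * z p).
    apply: eq_bigr => p _; rewrite -b1 mulr_suml; apply: eq_bigr => g _.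
    by rewrite mulrA invgM mulgA.
  have [hF|hF] := boolP (h \in F).
    rewrite (big_fsetD1 h)//= mulVg eqxx mul1r big_seq big1 ?addr0// => p.
    rewrite !inE => /andP[ph _]; rewrite -(inj_eq (mulgI h)) mulVKg mulg1.
    by rewrite (negbTE ph) mul0r.
  rewrite zF// big_seq big1// => p pF; rewrite -(inj_eq (mulgI h)) mulVKg mulg1.
  by case: eqP pF hF => [-> ->|_ _ _]//; rewrite mul0r.
rewrite (le_trans (ler_norm_sum _ _ _))//.
apply: (@le_trans _ _ (\sum_(p <- F) `|b (h^-1 * p)%g| * M)).
  by apply: ler_sum => p _; rewrite normrM ler_wpM2l.
rewrite -mulr_suml ler_wpM2r//; first by rewrite (le_trans _ (zM 1%g)).
have := hN [fset (h^-1 * p)%g | p in F]%fset.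
by rewrite big_imfset//= => ? ? _ _; exact: mulgI.
Qed.

(** Applying b to [tau f u] returns u; cutting b off outside a finite set A makes u h depend on
    finitely many values of [tau f u], up to the tail of b times the bound of u. *)
Lemma inverse_approx (e : R) : 0 < e -> exists (A : {fset G}) (N : R), 0 <= N /\
  forall (u : G -> R) (M Y : R) h, 0 <= Y -> (forall g, `|u g| <= M) ->
  (forall m, m \in A -> `|tau f u (h * m)%g| <= Y) -> `|u h| <= N * Y + e * M.
Proof.
move=> e0; have [b [_ b2 [N [N0 hN]] tail]] := l1_inverse.
have n1 : 0 < gr_norm f R + 1 by rewrite ltr_wpDl ?gr_norm_ge0.
(* The tail of b is convolved with f before it meets u, which costs a factor [gr_norm]. *)
have [A hA] := tail (e / (gr_norm f R + 1)) (divr_gt0 e0 n1).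
exists A, N; split=> // u M Y h Y0 uM uY.
have M0 : 0 <= M by exact: le_trans (uM 1%g).
pose S := (1%g |` fset_mulg A (finsupp f))%fset.
pose bA g : R := if g \in A then b g else 0.
pose bC g : R := if g \in A then 0 else b g.
have bE g : b g = bA g + bC g by rewrite /bA /bC; case: ifP; rewrite ?addr0 ?add0r.
(* u is expanded through b f = delta. The set S contains 1 and every k at which the truncated b
   times f can be nonzero. *)
have uE : u h = \sum_(k <- S)
    (\sum_(g <- finsupp f) (f g)%:~R * b (k * g^-1)%g) * u (h * k)%g.
  rewrite (big_fsetD1 1%g) ?fset1U1//= b2 eqxx mul1r mulg1 big_seq big1 ?addr0// => k.
  by rewrite in_fsetD1 => /andP[/negbTE k1 _]; rewrite b2 k1 mul0r.
have AE : \sum_(m <- A) b m * tau f u (h * m)%g =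
    \sum_(k <- S) (\sum_(g <- finsupp f) (f g)%:~R * bA (k * g^-1)%g) * u (h * k)%g.
  under [RHS]eq_bigr do rewrite mulr_suml.
  rewrite [RHS]exchange_big/=.
  transitivity (\sum_(g <- finsupp f) \sum_(m <- A) b m * ((f g)%:~R * u (h * m * g)%g)).
    by rewrite exchange_big; apply: eq_bigr => m _; rewrite mulr_sumr.
  rewrite big_seq [RHS]big_seq; apply: eq_bigr => g gf.
  rewrite -[RHS](big_fset_incl _ (A := [fset (m * g)%g | m in A]%fset)).
  - rewrite big_imfset/=; last by move=> ? ? _ _; exact: mulIg.
    rewrite big_seq [RHS]big_seq; apply: eq_bigr => m mA.
    by rewrite mulgK /bA mA mulgA mulrCA mulrA.
  - apply/fsubsetP => _ /imfsetP[m/= mA ->]; rewrite !inE; apply/orP; right.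
    by apply/imfset2P; exists m => //; exists g.
  - move=> k _ kA; rewrite /bA; case: ifPn => kg; last by rewrite mulr0 mul0r.
    by case/negP: kA; apply/imfsetP; exists (k * g^-1)%g => //=; rewrite mulgVK.
have CE : u h = \sum_(m <- A) b m * tau f u (h * m)%g +
    \sum_(g <- finsupp f) (f g)%:~R * \sum_(k <- S) bC (k * g^-1)%g * u (h * k)%g.
  rewrite AE uE.
  under [X in _ = _ + X]eq_bigr do rewrite mulr_sumr.
  rewrite [X in _ = _ + X]exchange_big/= -big_split; apply: eq_bigr => k _ /=.
  have -> : \sum_(g <- finsupp f) (f g)%:~R * (bC (k * g^-1)%g * u (h * k)%g) =
      (\sum_(g <- finsupp f) (f g)%:~R * bC (k * g^-1)%g) * u (h * k)%g.
    by rewrite mulr_suml; apply: eq_bigr => g _; rewrite mulrA.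
  rewrite -mulrDl -big_split; congr (_ * _); apply: eq_bigr => g _.
  by rewrite bE mulrDr.
rewrite CE (le_trans (ler_normD _ _))// lerD//.
  rewrite (le_trans (ler_norm_sum _ _ _))//.
  apply: (@le_trans _ _ (\sum_(m <- A) `|b m| * Y)).
    rewrite big_seq [leRHS]big_seq; apply: ler_sum => m mA.
    by rewrite normrM ler_wpM2l// uY.
  by rewrite -mulr_suml ler_wpM2r.
rewrite (le_trans (ler_norm_sum _ _ _))//.
apply: (@le_trans _ _ (\sum_(g <- finsupp f) `|(f g)%:~R| * (e / (gr_norm f R + 1) * M))).
  apply: ler_sum => g _; rewrite normrM ler_wpM2l// (le_trans (ler_norm_sum _ _ _))//.
  apply: (@le_trans _ _ (\sum_(k <- S) `|bC (k * g^-1)%g| * M)).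
    by apply: ler_sum => k _; rewrite normrM ler_wpM2l.
  rewrite -mulr_suml ler_wpM2r//.
  pose B := ([fset (k * g^-1)%g | k in S] `\` A)%fset.
  have dB : [disjoint A & B]%fset.
    by apply/fdisjointP => x xA; rewrite in_fsetD xA.
  apply: le_trans (hA B dB).
  have -> : \sum_(k <- S) `|bC (k * g^-1)%g| =
      \sum_(k <- [fset (k * g^-1)%g | k in S]%fset) `|bC k|.
    by apply/esym/big_imfset => ? ? _ _; exact: mulIg.
  rewrite -(big_fset_incl _ (A := B)); last 2 first.
  - exact: fsubsetDl.
  - by move=> k kS; rewrite in_fsetD kS andbT negbK /bC => ->; rewrite normr0.
  rewrite big_seq [leRHS]big_seq; apply: ler_sum => k.
  by rewrite in_fsetD /bC => /andP[/negbTE-> _].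
rewrite -mulr_suml -/(gr_norm f R) mulrA ler_wpM2r// mulrCA -[leRHS]mulr1 ler_pM2l//.
by rewrite ler_pdivrMr// mul1r lerDl.
Qed.

(* A first application of the approximation bounds u by a constant depending only
   on Y, so that A does not depend on the bound of u. *)
Lemma small_lift (Y e : R) : 0 <= Y -> 0 < e -> exists A : {fset G},
  forall (u : G -> R), (exists M, forall g, `|u g| <= M) ->
  (forall g, `|tau f u g| <= Y) -> forall h,
  (forall m, m \in A -> tau f u (h * m)%g = 0) -> `|u h| < e.
Proof.
move=> Y0 e0; have h2 : 0 < 2^-1 :> R by rewrite invr_gt0 ltr0n.
have [A0 [N [N0 approx0]]] := inverse_approx h2.
(* The first approximation, with factor 1/2, gives sup|u| <= N Y + sup|u| / 2, hence sup|u| <=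
   [M0]. *)
pose M0 := 2 * (N * Y); have M00 : 0 <= M0 by rewrite !mulr_ge0.
have d0 : 0 < e / (M0 + 1) / 2 by rewrite !divr_gt0// ltr_wpDl.
have [A [N' [_ approx]]] := inverse_approx d0.
exists A => u [M uM] uY h uA.
have uM0 g : `|u g| <= M0.
  pose E := range (fun g => `|u g|).
  have supE : has_sup E.
    by split; [exists `|u 1%g|, 1%g|exists M => _ [x _ <-]].
  have le_sup x : `|u x| <= sup E by apply: ub_le_sup; [case: supE|exists x].
  have : sup E <= N * Y + 2^-1 * sup E.
    apply: ge_sup; first by case: supE.
    by move=> _ [x _ <-]; apply: approx0 => // m _.
  by rewrite /M0 => hs; rewrite (le_trans (le_sup g))//; lra.
have := approx u M0 0 h (lexx 0) uM0.
rewrite mulr0 add0r => /(_ _) /le_lt_trans; apply.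
  by move=> m mA; rewrite uA// normr0.
have M1 : 0 < M0 + 1 by rewrite ltr_wpDl.
rewrite -mulrA [2^-1 * _]mulrC mulrA.
rewrite (@le_lt_trans _ _ (e / 2))//; last by rewrite ltr_pdivrMr// ltr_pMr// ltr1n.
rewrite ler_wpM2r ?invr_ge0// -mulrA -[leRHS]mulr1 ler_pM2l//.
by rewrite mulrC ler_pdivrMr// mul1r lerDl.
Qed.

End L1Inverse.

(** * Covering numbers *)

Section CoveringNumbers.
Variable X : topologicalType.
Implicit Types V W : set (set X).

Lemma card_range_fin (E : finType) (T : Type) (w : E -> T) :
  exists n, (range w #= `I_n)%card /\ (n <= #|E|)%N.
Proof.
have leE : ([set: E] #<= `I_#|E|)%card.
  have /card_eqPle[_ h] := @inj_card_eq _ _ [set: E] (fun e => enum_rank e : nat)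
    (fun e e' _ _ h => enum_rank_inj (val_inj h)).
  by apply: (card_le_trans h); apply: subset_card_le => _ [e _ <-] /=.
have le := card_le_trans (card_image_le w [set: E]) leE.
have /finite_setP[n hn] : finite_set (range w).
  exact: card_le_finite le (finite_II _).
by exists n; split=> //; rewrite -card_le_II -(card_le_eql hn).
Qed.

Lemma subcover_card_le (V : set (set X)) (E : finType) (w : E -> set X) :
  (forall e, V (w e)) -> (forall x, exists e, w e x) ->
  exists n, has_subcover_card V n /\ (n <= #|E|)%N.
Proof.
move=> Vw cw; have [n [hn nE]] := card_range_fin w.
exists n; split=> //; exists (range w); split=> //.
  by move=> _ [e _ <-].
apply/seteqP; split=> // x _; have [e ex] := cw x.
by exists (w e) => //; exists e.
Qed.

(** One finite subcover is enough for [covering_number] to be a true minimum instead of its default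
    value. *)
Lemma covering_number_min V n : has_subcover_card V n ->
  has_subcover_card V (covering_number V) /\ (covering_number V <= n)%N.
Proof.
move=> Vn; have ex : exists n, `[< has_subcover_card V n >] by exists n; exact/asboolP.
have ex2 : exists m, [set n | has_subcover_card V n /\
    forall m, has_subcover_card V m -> (n <= m)%N] m.
  case: (ex_minnP ex) => m /asboolP hm mmin; exists m; split=> // k hk.
  by apply: mmin; exact/asboolP.
by have [hc hmin] := xgetPex 0%N ex2; split=> //; exact: hmin.
Qed.

Lemma subcover_index V n : has_subcover_card V n ->
  exists (W : set (set X)) (idx : set X -> nat), [/\ W `<=` V, covers W,
    forall w, W w -> (idx w < n)%N & forall w w', W w -> W w' -> idx w = idx w' -> w = w'].
Proof.
move=> [W [WV cW /card_set_bijP[idx [im inj _]]]].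
exists W, idx; split; [exact: WV|exact: cW|exact: im|].
by move=> w w' Ww Ww'; apply: inj; rewrite inE.
Qed.

End CoveringNumbers.

(** * Counting and estimating integral vectors *)

Section SparseVectors.
Variable R : realType.

Lemma sum_half_pow n : \sum_(k < n) (2^-1 : R) ^+ k <= 2.
Proof.
have h : 0 <= (2^-1 : R) < 1 by apply/andP; split; lra.
have e : 1 - 2^-1 = 2^-1 :> R by rewrite [X in X - _]splitr mul1r addrK.
by have := geometric_tail h (leq0n n); rewrite big_mkord expr0 e mul1r invrK.
Qed.

(* Each such w has weight \prod_i 2 ^- (w i).2 >= 2 ^- L, and the total weight of
   all functions is at most 4 ^+ m. *)
Lemma card_sparse_vectors m L :
  (#|[pred w : {ffun 'I_m -> bool * 'I_L.+1} | (\sum_i (w i).2 <= L)%N]|%:R : R) <=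
  2 ^+ L * 4 ^+ m.
Proof.
set A := [pred w | _]; set h : R := 2^-1.
have h0 : 0 < h by rewrite invr_gt0.
have hL : h ^+ L * #|A|%:R <= 4 ^+ m.
  apply: (@le_trans _ _ (\sum_(w in A) \prod_i h ^+ (w i).2)).
    rewrite mulr_natr -sumr_const; apply: ler_sum => w; rewrite inE => wL.
    rewrite prodrXr ler_wiXn2l//; first exact: ltW.
    by rewrite /h; lra.
  apply: (@le_trans _ _ (\sum_(w : {ffun 'I_m -> bool * 'I_L.+1}) \prod_i h ^+ (w i).2)).
    rewrite [leRHS](bigID (mem A))/= lerDl sumr_ge0// => w _.
    by rewrite prodr_ge0// => i _; rewrite exprn_ge0 ?ltW.
  rewrite -(bigA_distr_bigA (fun _ (j : bool * 'I_L.+1) => h ^+ j.2)).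
  rewrite -[in leRHS](card_ord m) -prodr_const; apply: ler_prod => i _.
  rewrite sumr_ge0 => [|j _]; last by rewrite exprn_ge0 ?ltW.
  rewrite -(pair_bigA _ (fun (b : bool) (k : 'I_L.+1) => h ^+ k))/=.
  rewrite big_bool/=; have := sum_half_pow L.+1; rewrite -/h; lra.
have -> : 2 ^+ L = (h ^+ L)^-1 :> R by rewrite exprVn invrK.
by rewrite ler_pdivlMl ?exprn_gt0.
Qed.

End SparseVectors.

Section IntegerVectors.
Variables (R : realType) (G : groupType) (f : group_ring G).
Local Notation C := R[i]^o.
Local Notation T := (r_op R f).
Implicit Types (F A S : {fset G}) (u : G -> R).

(** Coercivity gives M^-1 |v|^2 <= (B v, v); the right side is split by AM-GM with weight M, and
    half of the left side absorbs the term in v. *)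
Lemma section_mx_inverse_bound F (M Y : R) (v : 'cV[int]_#|`F|) : 0 < M ->
  (forall x : l2 R G, M^-1 * l2_norm x ^+ 2 <= complex.Re (inner (T x) x)) ->
  (forall i, `|((section_mx f F *m v) i 0)%:~R : R| <= Y) ->
  \sum_i ((v i 0)%:~R : R) ^+ 2 <= M ^+ 2 * Y ^+ 2 * #|`F|%:R.
Proof.
move=> M0 cM vY; pose vC : 'cV[C]_#|`F| := map_mx intr v.
have intC (z : int) : (z%:~R : R)%:C%C = z%:~R :> R[i].
  exact: (rmorph_int (real_complex R)).
have vE i : vC i 0 = ((v i 0)%:~R : R)%:C%C by rewrite mxE; exact/esym/intC.
have BvE i : (map_mx intr (section_mx f F) *m vC) i 0 =
    (((section_mx f F *m v) i 0)%:~R : R)%:C%C.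
  by rewrite intC /vC -map_mxM mxE.
have := section_mx_coercive vC cM.
have -> : \sum_i normc (vC i 0) ^+ 2 = \sum_i ((v i 0)%:~R : R) ^+ 2.
  by apply: eq_bigr => i _; rewrite vE normc_real real_normK ?num_real.
have -> : complex.Re (\sum_i (map_mx intr (section_mx f F) *m vC) i 0 * conjc (vC i 0)) =
    \sum_i ((section_mx f F *m v) i 0)%:~R * (v i 0)%:~R.
  rewrite Re_sum; apply: eq_bigr => i _; rewrite BvE vE conjc_real.
  by rewrite /= mulr0 subr0.
set s2 := \sum_i ((v i 0)%:~R : R) ^+ 2 => h.
have hs i : ((section_mx f F *m v) i 0)%:~R * (v i 0)%:~R <=
    M / 2 * Y ^+ 2 + M^-1 / 2 * (v i 0)%:~R ^+ 2 :> R.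
  have Y2 : (((section_mx f F *m v) i 0)%:~R : R) ^+ 2 <= Y ^+ 2.
    rewrite -[leLHS]real_normK ?num_real// ler_sqr ?nnegrE//.
    by rewrite (le_trans _ (vY i)).
  move: (((section_mx f F *m v) i 0)%:~R : R) ((v i 0)%:~R : R) Y2 => a b Y2.
  have := sqr_ge0 (M * a - b); have M2 : 0 < M^-1 / 2 by rewrite divr_gt0 ?invr_gt0.
  move=> /(mulr_ge0 (ltW M2)).
  have -> : M^-1 / 2 * (M * a - b) ^+ 2 = M / 2 * a ^+ 2 - a * b + M^-1 / 2 * b ^+ 2.
    by field; rewrite gt_eqF.
  have := ler_wpM2l (ltW (divr_gt0 M0 (ltr0Sn R 1))) Y2.
  lra.
have {h} := le_trans h (ler_sum _ (fun i _ => hs i)).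
have -> : \sum_(i < #|`F|) (M / 2 * Y ^+ 2 + M^-1 / 2 * (v i 0)%:~R ^+ 2) =
    M / 2 * Y ^+ 2 * #|`F|%:R + M^-1 / 2 * s2.
  by rewrite big_split/= sumr_const card_ord -[X in X + _]mulr_natr -mulr_sumr.
move=> h.
have : M^-1 / 2 * s2 <= M / 2 * Y ^+ 2 * #|`F|%:R by lra.
move=> /(ler_wpM2l (ltW (mulr_gt0 (ltr0Sn R 1) M0))).
have -> : 2 * M * (M^-1 / 2 * s2) = s2 by field; rewrite gt_eqF.
by have -> : 2 * M * (M / 2 * Y ^+ 2 * #|`F|%:R) = M ^+ 2 * Y ^+ 2 * #|`F|%:R by field.
Qed.

(** From |a| <= s a^2 / 2 + 1/(2 s). In use Q is a multiple of |F| and S is the boundary: a small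
    [s] makes the |F| term negligible at the expense of the boundary term. *)
Lemma tau_sum_bound u S (s Q : R) : 0 < s ->
  (forall A, \sum_(g <- A) u g ^+ 2 <= Q) ->
  \sum_(h <- S) `|tau f u h| <= gr_norm f R * (s / 2 * Q + (2 * s)^-1 * #|`S|%:R).
Proof.
move=> s0 uQ; have am_gm (a : R) : `|a| <= s / 2 * a ^+ 2 + (2 * s)^-1.
  have := sqr_ge0 (s * `|a| - 1); have s2 : 0 < (2 * s)^-1 by rewrite invr_gt0 mulr_gt0.
  move=> /(mulr_ge0 (ltW s2)); rewrite -[a ^+ 2]real_normK ?num_real//.
  move: `|a| => b.
  have -> : (2 * s)^-1 * (s * b - 1) ^+ 2 = s / 2 * b ^+ 2 - b + (2 * s)^-1.
    by field; rewrite gt_eqF.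
  lra.
apply: (@le_trans _ _ (\sum_(h <- S) \sum_(g <- finsupp f)
    `|(f g)%:~R| * (s / 2 * u (h * g)%g ^+ 2 + (2 * s)^-1))).
  apply: ler_sum => h _; rewrite (le_trans (ler_norm_sum _ _ _))//.
  by apply: ler_sum => g _; rewrite normrM ler_wpM2l.
rewrite exchange_big/= /gr_norm mulr_suml; apply: ler_sum => g _.
rewrite -mulr_sumr ler_wpM2l// big_split/= lerD//.
  rewrite -mulr_sumr ler_wpM2l ?divr_ge0 ?(ltW s0)//.
  have := uQ [fset (h * g)%g | h in S]%fset.
  by rewrite big_imfset//= => ? ? _ _; exact: mulIg.
by rewrite big_const_seq count_predT iter_addr_0 mulr_natr.
Qed.

Lemma extend_sum_sqr F (v : 'cV[int]_#|`F|) A :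
  \sum_(g <- A) ((extend v g)%:~R : R) ^+ 2 <= \sum_i ((v i 0)%:~R : R) ^+ 2.
Proof.
apply: (@le_trans _ _ (\sum_(g <- (F `|` A)%fset) ((extend v g)%:~R : R) ^+ 2)).
  by apply: ler_fset_sum => [g|]; [rewrite sqr_ge0|exact: fsubsetUr].
rewrite -(big_fset_incl _ (fsubsetUl F A)).
  by rewrite big_fset_enum; apply: ler_sum => i _; rewrite extend_in.
by move=> g _ gF; rewrite extend_out// expr0n.
Qed.

Lemma tau_extend_out F K (v : 'cV[int]_#|`F|) h :
  (forall g, g \in finsupp f -> g^-1%g \in K) ->
  h \notin F -> h \notin boundary F K -> tau f (extend v) h = 0.
Proof.
move=> fK hF hbd; rewrite /tau big_seq big1// => g gf.
rewrite extend_out ?mulr0//; apply: contra hbd => hgF.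
by rewrite in_fsetD hF/= -[h](mulgK g) mem_fset_mulg// fK.
Qed.

Lemma lifts_sub_int th (v : G -> int) (chi : dual_system R f) :
  lifts th chi -> lifts (fun g => th g - (v g)%:~R) chi.
Proof.
move=> hth a; rewrite hth.
have -> : pairing (fun g => th g - (v g)%:~R) a =
    pairing th a - (\sum_(g <- finsupp a) a g * v g)%:~R.
  rewrite /pairing rmorph_sum -sumrB; apply: eq_bigr => g _.
  by rewrite mulrBr rmorphM.
by rewrite circB circ_int conjc1 mulr1.
Qed.

End IntegerVectors.

(** * The upper bound *)

Section UpperBound.
Variables (R : realType) (G : groupType) (f : group_ring G).
Local Notation T := (r_op R f).
Local Notation X := (dual_system R f).
Local Notation M := (quot_module f).
Hypothesis f_unit : l1_unit (to_l1 R f).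
Implicit Types (F K : {fset G}) (chi : X) (th : G -> R) (d : G -> int).

Lemma finite_support_bound (I : eqType) (r : I -> group_ring G) (s : seq I) :
  exists (KG : {fset G}) (W : R), 0 <= W /\ forall m, m \in s ->
    (finsupp (r m) `<=` KG)%fset /\ gr_norm (r m) R <= W.
Proof.
elim: s => [|a s [KG [W [W0 h]]]]; first by exists fset0, 0.
exists (finsupp (r a) `|` KG)%fset, (gr_norm (r a) R + W).
split=> [|m]; first by rewrite addr_ge0 ?gr_norm_ge0.
rewrite inE => /predU1P[->|/h[h1 h2]].
  by rewrite fsubsetUl lerDl.
split; first by rewrite (fsubset_trans h1)// fsubsetUr.
by rewrite (le_trans h2)// lerDr gr_norm_ge0.
Qed.

Lemma pairing_bound th (a : group_ring G) (e : R) :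
  (forall g, g \in finsupp a -> `|th g| <= e) -> `|pairing th a| <= gr_norm a R * e.
Proof.
move=> h; rewrite (le_trans (ler_norm_sum _ _ _))// /gr_norm mulr_suml.
rewrite big_seq [leRHS]big_seq; apply: ler_sum => g ga.
by rewrite normrM ler_wpM2l// h.
Qed.

(** [small_lift] is applied to the difference u of the lifts at the points g k, with k in the
    support of a representative of m. The set K contains all k a with a in the set A of that lemma,
    so [tau f u] vanishes where it must. The bounds B of the lifts may depend on F, whereas K does
    not. *)
Lemma coord_close (Kq : {fset M}) (e : R) : 0 < e -> exists K,
  (forall g, g \in finsupp f -> g^-1%g \in K) /\
  forall F chi chi' th th' d d', lifts th chi -> lifts th' chi' ->
    (exists B, forall g, `|th g| <= B) -> (exists B, forall g, `|th' g| <= B) ->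
    (forall h, tau f th h = (d h)%:~R) -> (forall h, tau f th' h = (d' h)%:~R) ->
    (forall h, h \in F \/ h \in boundary F K -> d h = d' h) ->
    (forall h, `|(d' h)%:~R - (d h)%:~R : R| <= 2 * gr_norm f R) ->
  forall g m, g \in F -> m \in Kq ->
    normc (val (dual_act R f g^-1%g chi') m - val (dual_act R f g^-1%g chi) m) < e.
Proof.
move=> e0; have [dl [dl0 hdl]] := circ_near0 e0.
have [KG [W [W0 hW]]] := finite_support_bound (fun m : M => repr m) (enum_fset Kq).
have W1 : 0 < W + 1 by rewrite ltr_wpDl.
have Y0 : 0 <= 2 * gr_norm f R by rewrite mulr_ge0// gr_norm_ge0.
have [A hA] := small_lift f_unit Y0 (divr_gt0 dl0 W1).
exists (fset_mulg KG A `|` [fset g^-1%g | g in finsupp f])%fset; split.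
  by move=> g gf; rewrite in_fsetU; apply/orP; right; apply/imfsetP; exists g.
set K := (_ `|` _)%fset.
move=> F chi chi' th th' d d' hth hth' [B hB] [B' hB'] Tth Tth' dd' ddY g m gF mK.
pose u h := th' h - th h.
have Tu h : tau f u h = (d' h)%:~R - (d h)%:~R by rewrite tauB Tth Tth'.
have [supp_m norm_m] := hW m mK.
have u_small k : k \in finsupp (repr m) -> `|u (g * k)%g| <= dl / (W + 1).
  move=> km; apply: ltW; apply: hA.
  - exists (B' + B) => h; rewrite (le_trans (ler_normB _ _))// lerD//.
  - by move=> h; rewrite Tu.
  - move=> a aA; rewrite Tu dd' ?subrr//.
    have gkK : (g * k * a)%g \in fset_mulg F K.
      rewrite -mulgA mem_fset_mulg// in_fsetU mem_fset_mulg//.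
      exact: (fsubsetP supp_m).
    have [|gkF] := boolP ((g * k * a)%g \in F); [by left|right].
    by rewrite in_fsetD gkF.
have valE chi0 th0 : lifts th0 chi0 -> val (dual_act R f g^-1%g chi0) m =
    circ (pairing (fun h => th0 (g * h)%g) (repr m)).
  move=> /(lifts_act g^-1%g) h0; have := h0 (repr m); rewrite /coord reprK => ->.
  by rewrite invgK.
rewrite (valE _ _ hth') (valE _ _ hth) circ_dist; apply: hdl.
have -> : pairing (fun h => th' (g * h)%g) (repr m) -
    pairing (fun h => th (g * h)%g) (repr m) =
    pairing (fun h => u (g * h)%g) (repr m).
  by rewrite /pairing -sumrB; apply: eq_bigr => h _; rewrite mulrBr.
rewrite (le_lt_trans (pairing_bound u_small))//.
rewrite (@le_lt_trans _ _ (W * (dl / (W + 1))))//.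
  by rewrite ler_wpM2r// (ltW (divr_gt0 dl0 W1)).
by rewrite mulrCA -[ltRHS]mulr1 ltr_pM2l// ltr_pdivrMr// mul1r ltrDl.
Qed.

(* Starting from a lift th in [-1, 1] with y = tau f th, write y = z e + B v on F
   and subtract from th the extension of v by 0. The l2-norm of v is controlled by
   the coercivity of r(f), and the boundary term is then bounded by AM-GM. *)
Lemma lift_data F K (E : finType) (z : E -> 'cV[int]_#|`F|) (m0 s : R) :
  0 < m0 -> 0 < s ->
  (forall x : l2 R G, m0^-1 * l2_norm x ^+ 2 <= complex.Re (inner (T x) x)) ->
  (forall g, g \in finsupp f -> g^-1%g \in K) ->
  (forall v, exists e w, v = z e + section_mx f F *m w) ->
  (forall e i, `|(z e i 0)%:~R : R| <= gr_norm f R) ->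
  forall chi, exists e th d, [/\ lifts th chi, (exists B, forall g, `|th g| <= B),
    (forall h, tau f th h = (d h)%:~R) /\ (forall i, d (fset_enum i) = z e i 0),
    (forall h, h \notin F -> h \notin boundary F K -> `|(d h)%:~R : R| <= gr_norm f R) &
    \sum_(h <- boundary F K) `|(d h)%:~R : R| <=
      (gr_norm f R + gr_norm f R / (2 * s)) * #|`boundary F K|%:R +
      s * (gr_norm f R / 2 * (m0 ^+ 2 * (2 * gr_norm f R) ^+ 2)) * #|`F|%:R].
Proof.
move=> m00 s0 cM fK zsurj zC chi; have [th [th1 hth]] := exists_lift chi.
have [y Ty] := lift_tau_int hth.
have yC h : `|(y h)%:~R : R| <= gr_norm f R.
  by rewrite -Ty -[leRHS]mulr1; apply: tau_bound => g; exact: th1.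
have [e [v yE]] := zsurj (\col_i y (fset_enum i)).
have yi i : y (fset_enum i) = z e i 0 + (section_mx f F *m v) i 0.
  by have /colP/(_ i) := yE; rewrite !mxE.
have Tv h : tau f (fun g => (extend v g)%:~R : R) h = (tau f (extend v) h)%:~R.
  exact: (tau_morph f (intr : {rmorphism int -> R})).
have Bv i : tau f (extend v) (fset_enum i) = (section_mx f F *m v) i 0.
  rewrite tau_extend; congr ((_ *m v) i 0).
  by apply/matrixP => a b; rewrite !mxE intz.
have v2 : \sum_i ((v i 0)%:~R : R) ^+ 2 <= m0 ^+ 2 * (2 * gr_norm f R) ^+ 2 * #|`F|%:R.
  apply: (section_mx_inverse_bound m00 cM) => i.
  have -> : (section_mx f F *m v) i 0 = y (fset_enum i) - z e i 0.
    by rewrite yi addrC addKr.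
  rewrite rmorphB (le_trans (ler_normB _ _))// mulr_natl mulr2n.
  by apply: lerD; [exact: yC|exact: zC].
pose th' g := th g - (extend v g)%:~R.
exists e, th', (fun h => y h - tau f (extend v) h); split.
- exact: lifts_sub_int.
- exists (1 + \sum_i `|(v i 0)%:~R|) => g.
  rewrite (le_trans (ler_normB _ _))// lerD// /extend rmorph_sum.
  rewrite (le_trans (ler_norm_sum _ _ _))//; apply: ler_sum => i _.
  by case: (_ == _); rewrite ?mulr1n ?mulr0n// normr0.
- split=> [h|i]; first by rewrite tauB Ty Tv rmorphB.
  by rewrite Bv yi addrK.
- by move=> h hF hbd; rewrite (tau_extend_out v fK hF hbd) subr0.
- apply: (@le_trans _ _ (\sum_(h <- boundary F K) (gr_norm f R +
      `|tau f (fun g => (extend v g)%:~R : R) h|))).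
    apply: ler_sum => h _; rewrite rmorphB (le_trans (ler_normB _ _))// Tv lerD//.
    exact: yC.
  rewrite big_split/= big_const_seq count_predT iter_addr_0.
  have := @tau_sum_bound _ _ f (fun g => (extend v g)%:~R : R) (boundary F K) s _ s0
    (fun A => le_trans (extend_sum_sqr R v A) v2).
  rewrite -[gr_norm f R *+ _]mulr_natr => h.
  apply: (le_trans (lerD (lexx _) h)); rewrite le_eqVlt; apply/orP; left; apply/eqP.
  by rewrite invfM; ring.
Qed.

End UpperBound.

Section CodedCover.
Variables (R : realType) (G : groupType) (f : group_ring G).
Local Notation T := (r_op R f).
Local Notation X := (dual_system R f).
Hypothesis posT : positive_op T.
Hypothesis f_unit : l1_unit (to_l1 R f).
Implicit Types (F K : {fset G}) (chi : X) (th : G -> R) (d : G -> int).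

(** A representative B t with t in the unit cube has entries bounded by the row sums of B, hence by
    [gr_norm]. *)
Lemma bounded_representatives F :
  exists (E : finType) (z : E -> 'cV[int]_#|`F|),
    [/\ (#|E|%:R : R) = (\det (section_mx f F))%:~R,
    forall v, exists e w, v = z e + section_mx f F *m w,
    forall e e' w, z e - z e' = section_mx f F *m w -> e = e' &
    forall e i, `|(z e i 0)%:~R : R| <= gr_norm f R].
Proof.
have det0 := det_section_gt0 posT F.
have [E [z [cE zs zi zt]]] := coker_representatives R det0.
exists E, z; split=> // [|e i].
  by rewrite cE -[in RHS](gtz0_abs det0).
have [t [t01 /colP/(_ i)]] := zt e; rewrite !mxE => ->.
rewrite (le_trans (ler_norm_sum _ _ _))// (le_trans _ (section_mx_row_sum R f i))//.
apply: ler_sum => j _; rewrite normrM mxE ler_piMr//.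
by have /andP[t0 t1] := t01 j; rewrite ger0_norm// ltW.
Qed.

(** Sign and modulus are kept apart so that the moduli can be summed as in [card_sparse_vectors]. *)
Definition signed_val L (w : bool * 'I_L.+1) : int := (-1) ^+ w.1 * w.2%:Z.

Lemma signed_val_onto L (a : int) : (`|a| <= L)%N ->
  exists w : bool * 'I_L.+1, signed_val w = a /\ w.2 = `|a|%N :> nat.
Proof.
move=> aL; exists (a < 0, inord `|a|); split; last by rewrite /= inordK.
by rewrite /signed_val/= inordK// -intEsign.
Qed.

Lemma ln2_le1 : ln 2 <= 1 :> R.
Proof. by apply: (@le_ln1Dx R 1); rewrite (lt_trans (ltrN10 R)). Qed.

(** A point is coded by its class in the cokernel and the boundary values of a modified lift. By
    [coord_close] points with the same code lie in one element of the refinement, so the number of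
    codes bounds the covering number. *)
Lemma entropy_upper (U : set (set X)) (e : R) : open_cover U -> 0 < e ->
  exists K (c : R), 0 <= c /\ forall F,
    has_subcover_card (refinement (dual_act R f) U F)
      (covering_number (refinement (dual_act R f) U F)) /\
    ln ((covering_number (refinement (dual_act R f) U F))%:R : R) <=
    ln (\det (section_mx f F))%:~R + e * #|`F|%:R + c * #|`boundary F K|%:R.
Proof.
move=> Uo e0; have [Kq [eps [eps0 hU]]] := lebesgue_number Uo.
have [ub hub] := choice hU.
have [K [fK close]] := coord_close f_unit Kq eps0.
have [m0 [m00 [_ cM]]] := r_op_bounded_below posT.
have C0 := gr_norm_ge0 f R.
pose kap := gr_norm f R / 2 * (m0 ^+ 2 * (2 * gr_norm f R) ^+ 2).
have kap0 : 0 <= kap.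
  by rewrite mulr_ge0 ?divr_ge0//; apply: mulr_ge0; exact: sqr_ge0.
have kap1 : 0 < kap + 1 by rewrite ltr_wpDl.
(* Makes the |F| term of [lift_data], which is s kap |F|, at most e|F|. *)
pose s := e / (kap + 1); have s0 : 0 < s by rewrite divr_gt0.
have s_kap : s * kap <= e.
  by rewrite /s mulrAC ler_pdivrMr// ler_wpM2l ?(ltW e0)// lerDl.
pose c1 := gr_norm f R + gr_norm f R / (2 * s).
have c10 : 0 <= c1 by rewrite addr_ge0// divr_ge0// mulr_ge0// ltW.
have ln4 : 0 <= ln 4 :> R by apply: ln_ge0; rewrite ler1n.
exists K, (c1 + ln 4); split=> [|F]; first exact: addr_ge0.
have [E [z [cE zs _ zC]]] := bounded_representatives F.
set m := #|`boundary F K|.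
pose bnd := c1 * m%:R + e * #|`F|%:R.
have bnd0 : 0 <= bnd by rewrite addr_ge0// mulr_ge0// ltW.
pose L := Num.truncn bnd.
pose W : finType := {w : {ffun 'I_m -> bool * 'I_L.+1} | (\sum_i (w i).2 <= L)%N}.
pose P (p : E * W) chi := exists th d, [/\ lifts th chi, exists B, forall g, `|th g| <= B,
    forall h, tau f th h = (d h)%:~R,
    forall i : 'I_#|`F|, d (fset_enum i) = z p.1 i 0 &
    (forall h, h \notin F -> h \notin boundary F K -> `|(d h)%:~R : R| <= gr_norm f R) /\
    (forall i : 'I_m, d (fset_enum i) = signed_val (val p.2 i))].
have Pex chi : exists p, P p chi.
  have [x [th [d [hth thB [Td dz] dout dsum]]]] :=
    lift_data m00 s0 cM fK zs zC chi.
  pose a (i : 'I_m) := `|d (fset_enum i)|%N.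
  have aL : (\sum_i a i <= L)%N.
    rewrite truncn_ge_nat//; apply: le_trans (le_trans dsum _).
      rewrite big_fset_enum natr_sum; apply: ler_sum => i _.
      by rewrite /a natr_absz intr_norm.
    by rewrite -/m lerD2l ler_wpM2r.
  have ai i : (a i <= L)%N by rewrite (leq_trans _ aL)// (bigD1 i)//= leq_addr.
  have [w hw] := choice (fun i => signed_val_onto (ai i)).
  have wL : (\sum_i ([ffun i => w i] i).2 <= L)%N.
    by rewrite (leq_trans _ aL)//; apply: leq_sum => i _; rewrite ffunE (hw i).2.
  exists (x, exist _ [ffun i => w i] wL), th, d; split=> //; split=> // i.
  by rewrite /= ffunE (hw i).1.
have [chi0 _] : exists chi : X, lifts (fun=> 0) chi.
  apply: (@exists_character _ _ _ _ (fun=> 0)) => h.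
  by rewrite /tau big1// => g _; rewrite mulr0.
(* A code realised by no point gets the arbitrary [chi0]; its set still belongs to the
   refinement. *)
pose rep p := xget chi0 [set chi | P p chi].
pose V p := \bigcap_(g in [set` F]) (dual_act R f g @` ub (dual_act R f g^-1%g (rep p))).
have VU p : refinement (dual_act R f) U F (V p).
  by exists (fun g => ub (dual_act R f g^-1%g (rep p))) => // g _; exact: (hub _).1.
have Vcov chi : exists p, V p chi.
  have [p hp] := Pex chi; exists p => g gF.
  exists (dual_act R f g^-1%g chi); last exact: dual_actK.
  apply: (hub _).2 => k kK.
  have [th [d [h1 h2 h3 h4 [h5 h6]]]] := hp.
  have [th' [d' [h1' h2' h3' h4' [h5' h6']]]] : P p (rep p).
    exact: (xgetPex chi0 (ex_intro _ chi hp)).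
  have agree h : h \in F \/ h \in boundary F K -> d' h = d h.
    by move=> [] /fset_enum_onto[i ->]; rewrite ?h4' ?h4// h6 h6'.
  apply: (close F _ _ _ _ _ _ h1' h1 h2' h2 h3' h3 agree) => // h.
  have [hF|hF] := boolP (h \in F).
    by rewrite agree ?subrr ?normr0 ?mulr_ge0//; left.
  have [hB|hB] := boolP (h \in boundary F K).
    by rewrite agree ?subrr ?normr0 ?mulr_ge0//; right.
  by rewrite (le_trans (ler_normB _ _))// mulr_natl mulr2n lerD ?h5 ?h5'.
have [n [nV nEW]] := subcover_card_le VU Vcov.
have [hN Nn] := covering_number_min nV; split=> // {hN}.
have det0 : 0 < (\det (section_mx f F))%:~R :> R by rewrite ltr0z (det_section_gt0 posT).
set N := covering_number _ in Nn *.
(* For N = 0 the logarithm is 0 by convention, and the right side is nonnegative because the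
   determinant is at least 1. *)
have [N0|N0] := posnP N.
  rewrite N0 ln0//; apply: addr_ge0; last by rewrite mulr_ge0// (addr_ge0 c10 ln4).
  by apply: addr_ge0; [exact: ln_det_ge0|rewrite mulr_ge0// (ltW e0)].
have cW : (#|W|%:R : R) <= 2 ^+ L * 4 ^+ m by rewrite card_sig card_sparse_vectors.
have p2 : 0 < 2 ^+ L :> R by rewrite exprn_gt0.
have p4 : 0 < 4 ^+ m :> R by rewrite exprn_gt0.
apply: (@le_trans _ _ (ln ((\det (section_mx f F))%:~R * (2 ^+ L * 4 ^+ m)))).
  rewrite ler_ln ?posrE ?ltr0n ?mulr_gt0// -cE.
  apply: (@le_trans _ _ (#|E|%:R * #|W|%:R)); last by rewrite ler_wpM2l.
  by rewrite -natrM ler_nat (leq_trans Nn)// (leq_trans nEW)// card_prod.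
rewrite lnM ?posrE ?mulr_gt0// lnM ?posrE// !lnXn// -addrA lerD2l.
have hL : L%:R * ln 2 <= bnd.
  by rewrite (le_trans (ler_wpM2l (ler0n R L) ln2_le1))// mulr1 truncn_le.
rewrite -[ln 2 *+ L]mulr_natl -[ln 4 *+ m]mulr_natr mulrDl addrA lerD2r.
by rewrite [leRHS]addrC.
Qed.

End CodedCover.

(** * The lower bound *)

Section LowerBound.
Variables (R : realType) (G : groupType) (f : group_ring G).
Local Notation T := (r_op R f).
Local Notation X := (dual_system R f).
Local Notation pi a := (\pi_(quot_module f) a)%qT.
Hypothesis posT : positive_op T.
Hypothesis f_unit : l1_unit (to_l1 R f).
Implicit Types (F K : {fset G}) (chi : X) (th u : G -> R).

(** Each rounding error is at most 1/([gr_norm] + 1), so rounding changes [tau f u] by less than 1;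
    both values are integers. *)
Lemma tau_round : exists d : R, 0 < d /\ forall u h (y : int), tau f u h = y%:~R ->
  (forall k, k \in finsupp f -> normc (circ (u (h * k)%g) - 1) < d) ->
  tau f (fun g => round (u g)) h = y.
Proof.
have C1 : 0 < gr_norm f R + 1 by rewrite ltr_wpDl ?gr_norm_ge0.
have eps0 : 0 < (gr_norm f R + 1)^-1 by rewrite invr_gt0.
have [d [d0 hd]] := circ_round eps0; exists d; split=> // u h y uy near1.
have : `|pairing (fun g => u (h * g)%g - (round (u (h * g)%g))%:~R) f| <=
    gr_norm f R * (gr_norm f R + 1)^-1.
  by apply: pairing_bound => g gf; exact/ltW/hd/near1.
have -> : pairing (fun g => u (h * g)%g - (round (u (h * g)%g))%:~R) f =
    (y - tau f (fun g => round (u g)) h)%:~R.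
  rewrite intrB -uy -[X in _ = _ - X](tau_morph f (intr : {rmorphism int -> R})).
  exact: (tauB f u (fun g => (round (u g))%:~R)).
move=> h1; have {h1} : `|(y - tau f (fun g => round (u g)) h)%:~R : R| < 1.
  by rewrite (le_lt_trans h1)// ltr_pdivrMr// mul1r ltrDl.
rewrite -intr_norm ltrz1 => h1.
by apply/esym/eqP; rewrite -subr_eq0 -normr_le0 -ltzD1 add0r.
Qed.

Lemma tau_section F K (v : G -> int) i :
  (forall k, k \in finsupp f -> k \in K) ->
  (forall g, g \in boundary F K -> v g = 0) ->
  tau f v (fset_enum i) = (section_mx f F *m (\col_j v (fset_enum j))) i 0.
Proof.
move=> fK v0; have := tau_extend f (\col_j v (fset_enum j) : 'cV[int]_#|`F|) i.
have -> : map_mx intr (section_mx f F) = section_mx f F.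
  by apply/matrixP => a b; rewrite !mxE intz.
move=> <-; rewrite /tau big_seq [RHS]big_seq; apply: eq_bigr => k kf; congr (_ * _).
have [/fset_enum_onto[j ->]|ikF] := boolP ((fset_enum i * k)%g \in F).
  by rewrite extend_in mxE.
by rewrite extend_out// v0// in_fsetD ikF mem_fset_mulg ?fset_enum_in ?fK.
Qed.

(* Points lifting the preimages of z e and z e' that lie in the same element of a
   subcover differ on F, up to the integral V e e', by an error too small to be
   seen by tau f. Hence e is determined by the element of the subcover containing
   its point together with the values of V on the boundary, relative to a base
   index chosen for that element. *)
Lemma entropy_lower : exists U : set (set X), open_cover U /\ exists K (c : R), 0 <= c /\
  forall F n, has_subcover_card (refinement (dual_act R f) U F) n ->
    ln ((\det (section_mx f F))%:~R : R) <= ln n%:R + c * #|`boundary F K|%:R.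
Proof.
have [d [d0 hd]] := tau_round; have d2 : 0 < d / 2 by rewrite divr_gt0.
(* Translated by F, these coordinates are the g k with k in the support of f, exactly those entering
   [tau f] at g. Radius d/2 puts two points of one ball at distance less than d. *)
pose Kq := [fset pi (gr_elt k) | k in finsupp f]%fset.
eexists; split; first exact: (@generator_cover R G f Kq (d / 2) d2).
have [N [N0 hN]] := preimage_of_finite f_unit.
(* [B] bounds every preimage; a rounded difference of two of them is at most 2 B + 1. *)
pose B := N * gr_norm f R; pose Mb := Num.truncn (B + B + 1).
have B0 : 0 <= B by rewrite mulr_ge0// gr_norm_ge0.
exists (finsupp f), (ln (2 * Mb.+1)%:R); split=> [|F n].
  by apply: ln_ge0; rewrite ler1n.
set Ref := refinement _ _ _ => /subcover_index[W [idx [WRef cW idxn idx_inj]]].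
have [E [z [cE _ zi zC]]] := bounded_representatives posT F.
have exth e : exists th, (forall h, tau f th h = (extend (z e) h)%:~R) /\
    forall h, `|th h| <= B.
  apply: (hN F (fun g => (extend (z e) g)%:~R)) => g; first by move=> gF; rewrite extend_out.
  have [/fset_enum_onto[i ->]|gF] := boolP (g \in F); first by rewrite extend_in.
  by rewrite extend_out// normr0 gr_norm_ge0.
have [th hth] := choice exth.
have [chi hchi] := choice (fun e => exists_character (hth e).1).
have exw e : exists w, W w /\ w (chi e).
  by have : (\bigcup_(u in W) u) (chi e); [rewrite cW|move=> [w]; exists w].
have [w hw] := choice exw.
pose V e e' g := round (th e g - th e' g).
have same e e' g : idx (w e) = idx (w e') -> g \in F ->
    tau f (V e e') g = extend (z e) g - extend (z e') g.
  move=> ww gF; have {}ww := idx_inj _ _ (hw e).1 (hw e').1 ww.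
  apply: hd => [|k kf]; first by rewrite tauB (hth e).1 (hth e').1 rmorphB.
  have [u uU uw] := WRef _ (hw e).1.
  have [psi0 _ up] := uU g gF.
  have mem e1 : w e1 (chi e1) -> w e1 = w e ->
      normc (circ (th e1 (g * k)%g) - val psi0 (pi (gr_elt k))) < d / 2.
    move=> h1 h2; move: h1; rewrite h2 -uw => /(_ g gF)[psi]; rewrite -up => hpsi psiE.
    have -> : circ (th e1 (g * k)%g) = val psi (pi (gr_elt k)).
      have := lifts_act g^-1%g (hchi e1) (gr_elt k).
      by rewrite -psiE dual_actVK pairing_elt invgK.
    by apply: hpsi; apply/imfsetP; exists k.
  rewrite -circ_dist.
  have := mem e (hw e).2 erefl; have := mem e' (hw e').2 (esym ww).
  set p0 := val psi0 _ => h2 h1.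
  have -> : circ (th e (g * k)%g) - circ (th e' (g * k)%g) =
      (circ (th e (g * k)%g) - p0) + (p0 - circ (th e' (g * k)%g)) by rewrite addrA subrK.
  rewrite (le_lt_trans (normc_triangle _ _))// [d]splitr ltrD//.
  by rewrite normc_distC.
have Vb e e' g : (`|V e e' g| <= Mb)%N.
  rewrite truncn_ge_nat ?addr_ge0// natr_absz intr_norm.
  rewrite (le_trans (round_bound _))// lerD2r (le_trans (ler_normB _ _))//.
  by rewrite lerD// (hth _).2.
have [cd hcd] := choice (fun p : E * E * G => signed_val_onto (Vb p.1.1 p.1.2 p.2)).
(* The choice depends only on the index j whenever some element has this index; the default [e]
   merely makes the function total. *)
pose base j e := odflt e [pick e0 | idx (w e0) == j].
have baseE e : idx (w (base (idx (w e)) e)) = idx (w e).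
  by rewrite /base; case: pickP => [e0 /eqP|].
pose m := #|`boundary F (finsupp f)|.
pose code e : 'I_n * {ffun 'I_m -> bool * 'I_Mb.+1} :=
  (Ordinal (idxn _ (hw e).1),
   [ffun i : 'I_m => cd (e, base (idx (w e)) e, fset_enum i)]).
have code_inj : injective code.
  move=> e e' [/= ij /ffunP cc].
  have base_eq : base (idx (w e)) e = base (idx (w e')) e'.
    by rewrite /base ij; case: pickP => // /(_ e'); rewrite eqxx.
  have he0 := baseE e; set e0 := base _ e in he0 base_eq cc.
  (* Equal codes make the integral function V e e0 - V e' e0 vanish on the boundary. On F its image
     under [tau f] is z e - z e', which is therefore in the image of the section. *)
  have agree g : g \in boundary F (finsupp f) -> V e e0 g - V e' e0 g = 0.
    move=> /fset_enum_onto[i ->]; have := cc i; rewrite !ffunE -base_eq => ci.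
    by apply/eqP; rewrite subr_eq0 -(hcd (e, e0, _)).1 ci (hcd (e', e0, _)).1.
  apply: (zi e e' (\col_j (V e e0 (fset_enum j) - V e' e0 (fset_enum j)))).
  apply/colP => i; rewrite -(tau_section i (fun k kf => kf) agree) tauB.
  rewrite !same ?fset_enum_in// -?ij//.
  by rewrite !extend_in !mxE; ring.
have hE := leq_card code code_inj.
have det0 : 0 < (\det (section_mx f F))%:~R :> R by rewrite ltr0z (det_section_gt0 posT).
have n0 : (0 < n)%N.
  have : (0 < #|E|)%N by rewrite -(ltr0n R) cE.
  by move=> /card_gt0P[e _]; rewrite (leq_ltn_trans (leq0n _) (idxn _ (hw e).1)).
have p0 : 0 < (2 * Mb.+1)%:R :> R by rewrite ltr0n.
apply: (@le_trans _ _ (ln (n%:R * (2 * Mb.+1)%:R ^+ m))).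
  rewrite ler_ln ?posrE ?mulr_gt0 ?exprn_gt0 ?ltr0n// -cE -natrX -natrM ler_nat.
  by move: hE; rewrite card_prod card_ord card_ffun card_prod card_bool !card_ord.
by rewrite lnM ?posrE ?exprn_gt0 ?ltr0n// lnXn// mulr_natr.
Qed.

End LowerBound.

(** * The limit along a Foelner sequence *)

Section EntropyFormula.
Variables (R : realType) (G : groupType) (f : group_ring G) (F : nat -> {fset G}).
Local Notation T := (r_op R f).
Local Notation X := (dual_system R f).
Local Notation L := (ln (FK_det T)).
Local Notation cov U n := (covering_number (refinement (dual_act R f) U (F n))).
Hypothesis posT : positive_op T.
Hypothesis f_unit : l1_unit (to_l1 R f).
Hypothesis Foelner_F : Foelner R F.

Lemma Foelner_card_gt0 n : 0 < #|`F n|%:R :> R.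
Proof. by rewrite ltr0n cardfs_gt0; exact: Foelner_F.1. Qed.

(** The outer boundary is one part of the symmetric difference in the Foelner condition. Adjoining 1
    makes K nonempty without shrinking its boundary. *)
Lemma boundary_small (K : {fset G}) (c e : R) : 0 <= c -> 0 < e ->
  \forall n \near \oo, c * #|`boundary (F n) K|%:R <= e * #|`F n|%:R.
Proof.
move=> c0 e0; have c1 : 0 < c + 1 by rewrite ltr_wpDl.
have K1 : (1%g |` K)%fset != fset0.
  by apply/fset0Pn; exists 1%g; rewrite fset1U1.
have e1 : 0 < e / (c + 1) by rewrite divr_gt0.
apply: filterS (cvgr_le _ (Foelner_F.2 _ K1) _ e1) => n.
rewrite ler_pdivrMr ?Foelner_card_gt0// => h.
apply: (@le_trans _ _ ((c + 1) * (e / (c + 1) * #|`F n|%:R))); last first.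
  by rewrite mulrA mulrCA mulfV ?gt_eqF// mulr1.
apply: ler_pM => //; first by rewrite lerDl.
rewrite (le_trans _ h)// ler_nat (leq_trans (card_boundary_le _ (fsubsetU1 1%g K)))//.
by rewrite fsubset_leq_card// fsubsetUl.
Qed.

Lemma log_det_sections (e : R) : 0 < e ->
  \forall n \near \oo, `|ln (\det (section_mx f (F n)))%:~R - #|`F n|%:R * L| <=
    e * #|`F n|%:R.
Proof.
move=> e0; have e2 : 0 < e / 2 by rewrite divr_gt0.
have [K [c [c0 hK]]] := det_asymptotics posT e2.
apply: filterS (boundary_small K c0 e2) => n hn; rewrite (le_trans (hK _))//.
by rewrite (le_trans (lerD (lexx _) hn))// -mulrDl -splitr.
Qed.

(** The logarithms of the section determinants are nonnegative, and so is their limit after division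
    by |F|. *)
Lemma log_FK_det_ge0 : 0 <= L.
Proof.
apply/ler_addgt0Pr => e e0; have [n] := filter_ex (log_det_sections e0).
rewrite ler_norml => /andP[_]; have := ln_det_ge0 posT (F n).
set m : R := #|`F n|%:R; set y := ln (_%:~R) => y0 h.
have : 0 <= m * (L + e) by rewrite mulrDr [m * e]mulrC; lra.
by rewrite pmulr_rge0 ?Foelner_card_gt0.
Qed.

Lemma covering_rate_le U (e : R) : open_cover U -> 0 < e ->
  \forall n \near \oo, ln (cov U n)%:R / #|`F n|%:R <= L + e.
Proof.
move=> Uo e0; have e3 : 0 < e / 3 by rewrite divr_gt0.
have [K [c [c0 hK]]] := entropy_upper posT f_unit Uo e3.
apply: filterS2 (boundary_small K c0 e3) (log_det_sections e3) => n hb hd.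
have [_ hU] := hK (F n); rewrite ler_pdivrMr ?Foelner_card_gt0//.
move: hd; rewrite ler_norml => /andP[_].
move: hb hU; set m : R := #|`F n|%:R; set x := c * _; set y := ln _; set z := ln _.
move=> hb hU hd.
rewrite mulrDl mulrC.
lra.
Qed.

Lemma covering_rate_ge : exists2 U : set (set X), open_cover U & forall e : R, 0 < e ->
  \forall n \near \oo, L - e <= ln (cov U n)%:R / #|`F n|%:R.
Proof.
have [U [Uo [K [c [c0 hK]]]]] := entropy_lower posT f_unit.
exists U => // e e0; have e2 : 0 < e / 2 by rewrite divr_gt0.
(* Called for its first conjunct: some subcover realises the covering number, so that [hK] applies
   to it. *)
have [K' [c' [_ hK']]] := entropy_upper posT f_unit Uo e0.
apply: filterS2 (boundary_small K c0 e2) (log_det_sections e2) => n hb hd.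
have [/hK hU _] := hK' (F n); rewrite ler_pdivlMr ?Foelner_card_gt0//.
move: hd; rewrite ler_norml => /andP[+ _].
move: hb hU; set m : R := #|`F n|%:R; set x := c * _; set y := ln _; set z := ln _.
move=> hb hU hd.
rewrite mulrBl [L * _]mulrC.
lra.
Qed.

Lemma entropy_formula : topological_entropy R (dual_act R f) F = L%:E.
Proof.
apply/eqP; rewrite eq_le; apply/andP; split.
  apply: ge_ereal_sup => _ [U Uo <-].
  (* The [limn] of a divergent sequence is 0, hence the convergence asserted by the
     Ornstein-Weiss lemma is not needed. *)
  have [cvgU|/dvgP->] :=
    pselect (cvgn (fun n => (ln (cov U n)%:R / #|`F n|%:R : R)%:E)); last first.
    by rewrite lee_fin log_FK_det_ge0.
  apply/lee_addgt0Pr => e e0; apply: lime_le => //.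
  by apply: filterS (covering_rate_le Uo e0) => n; rewrite lee_fin.
(* For this cover the upper and lower rates force convergence to L, so the supremum is at least
   L. *)
have [U Uo hU] := covering_rate_ge.
apply: ereal_sup_ubound; exists U => //; apply/cvg_lim => //.
apply: cvg_EFin; first exact: nearW.
apply/cvgrPdist_le => e e0.
apply: filterS2 (covering_rate_le Uo e0) (hU _ e0) => n h1 h2.
by rewrite /= distrC ler_norml; apply/andP; split; lra.
Qed.

End EntropyFormula.

Theorem theorem1 (R : realType) (G : groupType) (f : group_ring G)
  (G_fg : finitely_generated G)
  (G_amenable : amenable G R)
  (G_strong_Foelner : exists F : nat -> {fset G}, strong_Foelner R F)
  (f_l1_unit : l1_unit (to_l1 R f))
  (f_positive : positive_op (r_op R f))
  (F : nat -> {fset G}) (F_Foelner : Foelner R F) :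
  topological_entropy R (dual_act R f) F = (ln (FK_det (r_op R f)))%:E.
Proof. exact: entropy_formula. Qed.
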